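(* Let $\psi=\Gamma'/\Gamma$ be the digamma function, $\gamma$ the Euler constant, $\gamma_1$ the first Stieltjes constant (the coefficient such that $\zeta(s)=\frac{1}{s-1}+\gamma-\gamma_1(s-1)+O((s-1)^2)$ near $s=1$), and $\zeta$ the Riemann zeta function. For $x\in\mathbb{C}\setminus(-\infty,0]$ define $$\psi_1(x):=-\gamma_1-\frac{\log(x)}{x}-\sum_{n=1}^{\infty}\left(\frac{\log(n+x)}{n+x}-\frac{\log(n)}{n}\right),$$ $$\phi_0(x):=\psi(x)+\frac{1}{2x}-\log(x),\qquad \phi_1(x):=\psi_1(x)+\frac{1}{2x}\log(x)-\frac{1}{2}\log^2(x).$$ For $x>0$ and any fixed $0<c<1$ define $$\mathscr{H}(x):=\frac{1}{2\pi i}\int_{c-i\infty}^{c+i\infty}\frac{\pi\,\zeta(w)\,\zeta(1-w)}{\sin(\pi w)}\left(\pi\cot\left(\frac{\pi w}{2}\right)\right)x^{-w}\,dw,$$ and $$\mathscr{F}(x):=\sum_{n=1}^{\infty}\phi_1(nx)-\sum_{n=1}^{\infty}\log(nx)\,\phi_0(nx)+\frac{1}{2}\mathscr{H}(x)-\frac{\pi^2}{12x}.$$ Then for any $\alpha,\beta>0$ with $\alpha\beta=1$, $$\sqrt{\alpha}\,\mathscr{F}(\alpha)=\sqrt{\beta}\,\mathscr{F}(\beta).$$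
   Context: $\psi_1$ is the generalized digamma function of order $1$ (logarithmic derivative of Dilcher's generalized gamma function $\Gamma_1$). The series $\sum_n\phi_1(nx)$ and $\sum_n\log(nx)\phi_0(nx)$ converge absolutely for $x>0$. The integral defining $\mathscr{H}$ is along the vertical line $\mathrm{Re}(w)=c$, $0<c<1$. *)

(* Defs.v *)
(* Stdlib reals with Coquelicot's complex numbers. *)
From Stdlib Require Import Reals Factorial.
From Coquelicot Require Import Coquelicot.

Local Open Scope C_scope.

(** ** Elementary complex functions *)

Definition Cexp (z : C) : C :=
  RtoC (exp (Re z)) * (cos (Im z), sin (Im z)).

(* Principal branch, meaningful on C \ (-oo,0] only: there the half-angle
   formula arg (a + ib) = 2 atan (b / (|z| + a)) has positive denominator and
   takes values in (-PI, PI). *)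
Definition Clog (z : C) : C :=
  (ln (Cmod z), (2 * atan (Im z / (Cmod z + Re z)))%R).

(* a^s for a real base a > 0. *)
Definition Rcpow (a : R) (s : C) : C := Cexp (s * RtoC (ln a)).

Definition Csin (z : C) : C := (Cexp (Ci * z) - Cexp (- (Ci * z))) / (2 * Ci).
Definition Ccos (z : C) : C := (Cexp (Ci * z) + Cexp (- (Ci * z))) / 2.
Definition Ccot (z : C) : C := Ccos z / Csin z.

(** ** Limits, series and integrals of complex-valued functions *)

Definition CLim_seq (u : nat -> C) : C :=
  (real (Lim_seq (fun n => Re (u n))), real (Lim_seq (fun n => Im (u n)))).

Definition CSeries (a : nat -> C) : C :=
  (Series (fun n => Re (a n)), Series (fun n => Im (a n))).

(* Integral of f along Re w = c, upwards: w = c + it, dw = i dt. *)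
Definition vertical_integral (c : R) (f : C -> C) : C :=
  RInt_gen (V := C_R_CompleteNormedModule)
    (fun t : R => f (RtoC c + Ci * RtoC t) * Ci)
    (Rbar_locally m_infty) (Rbar_locally p_infty).

(** ** Riemann zeta function on Re s > 0, s <> 1 *)

(* zeta s = 1/(s-1) + sum_(n >= 1) (n^(-s) - int_n^(n+1) t^(-s) dt).
   The n-th term is O(|s| n^(- Re s - 1)), so that the series converges
   absolutely and locally uniformly for Re s > 0 and the formula is the analytic
   continuation of sum n^(-s): for Re s > 1 the integrals add up to 1/(s-1). *)
Definition zeta (s : C) : C :=
  1 / (s - 1) +
  CSeries (fun k : nat =>
    let n := INR (S k) in
    Rcpow n (- s) - (Rcpow (n + 1) (1 - s) - Rcpow n (1 - s)) / (1 - s)).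

Definition euler_gamma : R :=
  real (Lim_seq (fun N =>
    (sum_n (fun k => / INR (S k)) N - ln (INR (S N)))%R)).

(* zeta s = 1/(s-1) + gamma - gamma1 (s-1) + O((s-1)^2) as s -> 1, which
   determines gamma1. *)
Definition is_first_stieltjes (gamma1 : R) : Prop :=
  exists M delta : R, (0 < delta)%R /\
    forall s : C, (0 < Cmod (s - 1) < delta)%R ->
      (Cmod (zeta s -
             (1 / (s - 1) + RtoC euler_gamma - RtoC gamma1 * (s - 1)))
       <= M * Cmod (s - 1) ^ 2)%R.

(** ** Gamma and digamma functions *)

Fixpoint rising (z : C) (n : nat) : C :=
  match n with
  | O => 1
  | S m => rising z m * (z + RtoC (INR m))
  end.

(* Gauss's limit n! n^z / (z (z+1) ... (z+n)), valid for every z other than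
   0, -1, -2, ... *)
Definition CGamma (z : C) : C :=
  CLim_seq (fun n =>
    RtoC (INR (fact n)) * Rcpow (INR n) z / rising z (S n)).

(* [C_derive] takes the limit of the difference quotient along the real
   direction; this is the complex derivative where the latter exists
   ([is_C_derive_unique]). *)
Definition digamma (z : C) : C := C_derive CGamma z / CGamma z.

(** ** The functions psi_1, phi_0, phi_1 on C \ (-oo,0] *)

Definition psi1 (gamma1 : R) (x : C) : C :=
  - RtoC gamma1 - Clog x / x -
  CSeries (fun k : nat =>
    let n := RtoC (INR (S k)) in Clog (n + x) / (n + x) - Clog n / n).

Definition phi0 (x : C) : C := digamma x + 1 / (2 * x) - Clog x.

Definition phi1 (gamma1 : R) (x : C) : C :=
  psi1 gamma1 x + 1 / (2 * x) * Clog x - 1 / 2 * (Clog x * Clog x).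

(** ** The functions H and F on (0,+oo) *)

Definition scrH (c x : R) : C :=
  1 / (2 * RtoC PI * Ci) *
  vertical_integral c (fun w : C =>
    RtoC PI * zeta w * zeta (1 - w) / Csin (RtoC PI * w) *
    (RtoC PI * Ccot (RtoC PI * w / 2)) * Rcpow x (- w)).

Definition scrF (gamma1 c x : R) : C :=
  CSeries (fun k : nat => phi1 gamma1 (RtoC (INR (S k) * x)))
  - CSeries (fun k : nat =>
      RtoC (ln (INR (S k) * x)) * phi0 (RtoC (INR (S k) * x)))
  + 1 / 2 * scrH c x - RtoC (PI ^ 2 / (12 * x)).

(* Main.v *)
Require Import Defs.
From Stdlib Require Import Reals Lra Lia Psatz Factorial.
From Coquelicot Require Import Coquelicot.
Local Open Scope R_scope.

(** With h(y, u) = ln (1 + u/y) / (u + y), the combination phi_1(y) - ln y phi_0(y)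
    equals g(y) = "int_0^oo - sum_{k >= 1}" h(y, .), and the claim is F(1/x) = x F(x).

    The kernel of H is zeta(w) zeta(1 - w) pi^2 / (1 - cos (pi w)). On the line
    Re w = c each zeta factor is the limit of a half-weighted partial sum
    sum' n^(-s) - N^(1-s)/(1-s), with an error of order |s| that the exponential
    decay of the kernel absorbs. Hence x H(x) - H(1/x) is a limit of finite double
    sums over n, m <= N of inverse Mellin transforms, and the only transform needed
    is that of (y^(-w) - y^(w-1)) pi^2 / (1 - cos (pi w)), proportional to
    ln y / (1 + y); it comes from 2-periodicity of the kernel, Cauchy's theorem and
    the residue at 0. Writing ln (nx/m) = ln (1 + nx/m) - ln (1 + m/(nx)) splits the
    double sum into truncations of x sum g(nx) and of sum g(m/x); the boundary terms
    are trapezoidal sums of a dilogarithm, and their limit, pi^2/12 times a multiple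
    of 1 - x, is half the value pi^2/6 of that dilogarithm at 0. *)

(** All identities between sums and integrals are exact at finite N, because the infinite forms do
    not exist separately: the terms of the double sum are homogeneous of degree -1 in (n, m), so it
    has no absolutely convergent limit, and the integral and the sum in g both grow like a squared
    logarithm. Half weights turn every finite sum into a trapezoidal sum. Its error over a unit
    interval is controlled by the variation of a derivative; for h(y, .) on [k, k + 1] it is at most
    a multiple of y^(-1/2) (y + k)^(-5/2), which can be summed over k and over y = nx. The same
    device describes the special functions: phi_0(y) and phi_1(y) are minus the sums of the
    trapezoidal errors of 1/u and ln u / u on the unit intervals of [y, oo), and ln u = ln (u/y) +
    ln y then produces g. Integrals over vertical lines stay in one class, the continuous functions
    bounded by a multiple of 1/(1 + t^2). Differentiation under the integral, in the abscissa or in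
    y, always rests on a quadratic Taylor remainder that is uniform in t. *)

Lemma mvt_abs_le (f df : R -> R) (a b M : R) : a <= b ->
  (forall x, a <= x <= b -> is_derive f x (df x)) ->
  (forall x, a <= x <= b -> Rabs (df x) <= M) ->
  Rabs (f b - f a) <= M * (b - a).
Proof.
  intros ab Hd Hb.
  destruct (MVT_gen f a b df) as [c [Hc E]].
  - intros x Hx. rewrite Rmin_left, Rmax_right in Hx by lra. apply Hd; lra.
  - intros x Hx. rewrite Rmin_left, Rmax_right in Hx by lra.
    apply continuity_pt_filterlim, (ex_derive_continuous (V := R_NormedModule)).
    exists (df x); apply Hd; lra.
  - rewrite Rmin_left, Rmax_right in Hc by lra.
    rewrite E, Rabs_mult, (Rabs_pos_eq (b - a)) by lra.
    apply Rmult_le_compat_r; [lra | apply Hb; lra].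
Qed.

(** * Trapezoidal rule *)

(* The error over [a, a + h] has derivative (h/2) (F1 (a + h) - F1 xi) in h,
   for some xi in [a, a + h]. *)
Lemma trapezoid_error (W F F1 : R -> R) (a M : R) :
  (forall u, a <= u <= a + 1 -> is_derive W u (F u)) ->
  (forall u, a <= u <= a + 1 -> is_derive F u (F1 u)) ->
  (forall u v, a <= u <= a + 1 -> a <= v <= a + 1 -> Rabs (F1 u - F1 v) <= M) ->
  Rabs ((F a + F (a + 1)) / 2 - (W (a + 1) - W a)) <= M.
Proof.
  intros HW HF HM.
  assert (M0 : 0 <= M).
  { eapply Rle_trans; [| apply (HM a a); lra]. apply Rabs_pos. }
  set (e := fun h => h / 2 * (F a + F (a + h)) - W (a + h)).
  assert (E : (F a + F (a + 1)) / 2 - (W (a + 1) - W a) = e 1 - e 0).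
  { unfold e. rewrite !Rplus_0_r. field. }
  rewrite E. replace M with (M * (1 - 0)) by ring.
  apply (mvt_abs_le e
    (fun h => / 2 * (F a + F (a + h)) + h / 2 * F1 (a + h) - F (a + h))); [lra | |].
  - intros h Hh. unfold e.
    assert (D1 : is_derive (fun h => F (a + h)) h (F1 (a + h))).
    { evar_last. apply (is_derive_comp F (fun h => a + h)).
      apply HF; lra. auto_derive; auto. cbn. unfold mult; cbn; ring. }
    assert (D2 : is_derive (fun h => W (a + h)) h (F (a + h))).
    { evar_last. apply (is_derive_comp W (fun h => a + h)).
      apply HW; lra. auto_derive; auto. cbn. unfold mult; cbn; ring. }
    evar_last.
    apply (is_derive_minus (V := R_NormedModule)); [| exact D2].
    apply (is_derive_mult (fun h => h / 2) (fun h => F a + F (a + h))).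
    + auto_derive; auto.
    + apply (is_derive_plus (V := R_NormedModule)); [| exact D1].
      apply (is_derive_const (V := R_NormedModule)).
    + intros; apply Rmult_comm.
    + unfold minus, plus, opp, mult, zero; cbn. field.
  - intros h Hh.
    destruct (Req_dec h 0) as [-> | h0].
    { rewrite !Rplus_0_r. unfold Rdiv. rewrite !Rmult_0_l.
      replace (/ 2 * (F a + F a) + 0 - F a) with 0 by field. rewrite Rabs_R0; lra. }
    destruct (MVT_gen F a (a + h) F1) as [c [Hc Ec]].
    + intros x Hx. rewrite Rmin_left, Rmax_right in Hx by lra. apply HF; lra.
    + intros x Hx. rewrite Rmin_left, Rmax_right in Hx by lra.
      apply continuity_pt_filterlim, (ex_derive_continuous (V := R_NormedModule)).
      exists (F1 x); apply HF; lra.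
    + rewrite Rmin_left, Rmax_right in Hc by lra.
      replace (/ 2 * (F a + F (a + h)) + h / 2 * F1 (a + h) - F (a + h))
        with (h / 2 * (F1 (a + h) - F1 c)) by
        (replace (F (a + h)) with (F a + F1 c * (a + h - a)) by lra; field).
      rewrite Rabs_mult, Rabs_pos_eq by lra.
      assert (B := HM (a + h) c ltac:(lra) ltac:(lra)).
      assert (0 <= Rabs (F1 (a + h) - F1 c)) by apply Rabs_pos. nra.
Qed.

(** Over a unit interval a bound on [F2] bounds the oscillation of [F1] by the same constant. The
    sharp constant is M/12, but only the summability of the errors matters later. *)
Lemma trapezoid_error2 (W F F1 F2 : R -> R) (a M : R) :
  (forall u, a <= u <= a + 1 -> is_derive W u (F u)) ->
  (forall u, a <= u <= a + 1 -> is_derive F u (F1 u)) ->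
  (forall u, a <= u <= a + 1 -> is_derive F1 u (F2 u)) ->
  (forall u, a <= u <= a + 1 -> Rabs (F2 u) <= M) ->
  Rabs ((F a + F (a + 1)) / 2 - (W (a + 1) - W a)) <= M.
Proof.
  intros HW HF HF1 HM.
  assert (M0 : 0 <= M).
  { eapply Rle_trans; [| apply (HM a); lra]. apply Rabs_pos. }
  assert (K : forall u v, a <= u <= a + 1 -> a <= v <= a + 1 -> u <= v ->
    Rabs (F1 v - F1 u) <= M).
  { intros u v Hu Hv uv. eapply Rle_trans.
    apply (mvt_abs_le F1 F2 u v M uv); intros; [apply HF1 | apply HM]; lra. nra. }
  apply trapezoid_error with F1; auto. intros u v Hu Hv.
  destruct (Rle_dec u v). rewrite Rabs_minus_sym. apply K; auto. apply K; auto; lra.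
Qed.

(** * Integrals over the line of functions bounded by a multiple of 1/(1+t^2) *)

Definition lorentz_bound (f : R -> R) (M : R) := forall t, Rabs (f t) <= M / (1 + t ^ 2).

(** A class closed under linear combinations in which improper integrals converge and are bounded by
    M pi. Every passage to the limit under an integral below reduces to that bound. *)
Definition tame (f : R -> R) :=
  (forall t, continuous f t) /\ exists M, lorentz_bound f M.

(** Symmetric truncation at integers turns the integral into a sequential limit. For [tame]
    functions it agrees with the two-sided improper integral, by [tame_limits]. *)
Definition line_int (f : R -> R) : R :=
  real (Lim_seq (fun n => RInt f (- INR n) (INR n))).

Lemma one_sq_pos t : 0 < 1 + t ^ 2.
Proof. nra. Qed.

Lemma tame_ex_RInt f a b : tame f -> ex_RInt f a b.
Proof.
  intros [H _]. apply (ex_RInt_continuous (V := R_CompleteNormedModule)). auto.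
Qed.

Lemma RInt_lorentz_le f M a b : (forall t, continuous f t) -> lorentz_bound f M -> a <= b ->
  Rabs (RInt f a b) <= M * (atan b - atan a).
Proof.
  intros Hc Hb ab.
  apply (norm_RInt_le (V := R_NormedModule) f (fun t => M / (1 + t ^ 2)) a b _ _ ab).
  - intros; apply Hb.
  - apply (RInt_correct (V := R_CompleteNormedModule)).
    apply (ex_RInt_continuous (V := R_CompleteNormedModule)). auto.
  - evar_last.
    apply (is_RInt_derive (fun t => M * atan t)).
    + intros t _. assert (P := one_sq_pos t). auto_derive; auto. field. lra.
    + intros t _. apply (ex_derive_continuous (V := R_NormedModule)).
      assert (P := one_sq_pos t). auto_derive. simpl in P. lra.
    + unfold minus, plus, opp; cbn. ring.
Qed.

Lemma atan_le_id x : 0 <= x -> atan x <= x.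
Proof.
  intros Hx.
  assert (H : Rabs (atan x - atan 0) <= 1 * (x - 0)).
  { apply (mvt_abs_le atan (fun t => / (1 + t ^ 2)) 0 x 1 Hx).
    - intros t _. apply is_derive_Reals, derivable_pt_lim_atan.
    - intros t _. assert (0 <= t ^ 2) by apply pow2_ge_0.
      rewrite Rabs_pos_eq by (left; apply Rinv_0_lt_compat; lra).
      rewrite <- Rinv_1. apply Rinv_le_contravar; lra. }
  rewrite atan_0 in H. assert (T := Rle_abs (atan x - 0)). lra.
Qed.

Lemma atan_pos x : 0 <= x -> 0 <= atan x.
Proof.
  intros [Hx | <-]; [| rewrite atan_0; lra].
  rewrite <- atan_0. left; apply atan_increasing; auto.
Qed.

Lemma atan_diff_le x y : 0 < x -> x <= y -> atan y - atan x <= / x.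
Proof.
  intros x0 xy. assert (X := atan_inv x x0). assert (Y := atan_inv y ltac:(lra)).
  assert (0 <= atan (/ y)) by (apply atan_pos; left; apply Rinv_0_lt_compat; lra).
  assert (atan (/ x) <= / x) by (apply atan_le_id; left; apply Rinv_0_lt_compat; lra).
  lra.
Qed.

Lemma tame_half_line f : tame f ->
  exists l, filterlim (fun b => RInt f 0 b) (Rbar_locally p_infty) (locally l).
Proof.
  intros Hf. pose proof Hf as [Hc [M HM]].
  apply filterlim_locally_cauchy. intros eps.
  assert (M0 : 0 <= M).
  { assert (H := HM 0). assert (H0 := Rabs_pos (f 0)). unfold Rdiv in H. replace (/ (1 + 0 ^ 2)) with 1 in H by (simpl; field). lra. }
  (* A tail beyond A is at most M / A = eps M / (M + 1), which is below eps; the 1 covers the case M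
     = 0. *)
  set (A := (M + 1) / eps).
  assert (Ap : 0 < A) by (apply Rdiv_lt_0_compat; [lra | apply cond_pos]).
  exists (fun x => A < x). split; [exists A; auto |].
  assert (K : forall u v, A < u -> u <= v -> Rabs (RInt f 0 v - RInt f 0 u) < eps).
  { intros u v Hu uv.
    replace (RInt f 0 v - RInt f 0 u) with (RInt f u v).
    2: { rewrite <- (RInt_Chasles f 0 u v); try apply tame_ex_RInt; auto.
         unfold plus; cbn. ring. }
    eapply Rle_lt_trans. apply (RInt_lorentz_le f M); auto.
    apply Rle_lt_trans with (M * / A).
    apply Rmult_le_compat_l; auto. eapply Rle_trans. apply atan_diff_le; lra.
    apply Rinv_le_contravar; lra.
    unfold A. assert (E := cond_pos eps). replace (M * / ((M + 1) / eps)) with (M / (M + 1) * eps) by (field; lra).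
    apply Rlt_le_trans with (1 * eps); [| lra]. apply Rmult_lt_compat_r; auto.
    apply (Rmult_lt_reg_r (M + 1)); [lra |]. field_simplify; lra. }
  intros u v Hu Hv. destruct (Rle_dec u v).
  - apply K; auto.
  - apply (ball_sym (M := R_UniformSpace)). apply K; auto; lra.
Qed.

Lemma tame_opp_arg f : tame f -> tame (fun t => f (- t)).
Proof.
  intros [Hc [M HM]]. split.
  - intros t. apply (continuous_comp (fun t => - t) f); auto.
    apply (continuous_opp (V := R_NormedModule) (fun t => t)). apply continuous_id.
  - exists M. intros t. replace (t ^ 2) with ((- t) ^ 2) by ring. apply HM.
Qed.

Lemma RInt_neg_half f b : tame f -> RInt f (- b) 0 = RInt (fun t => f (- t)) 0 b.
Proof.
  intros Hf.
  rewrite <- (opp_RInt_swap (V := R_CompleteNormedModule) f) by (apply tame_ex_RInt; auto).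
  symmetry. apply (is_RInt_unique (V := R_CompleteNormedModule)).
  apply (is_RInt_ext (V := R_NormedModule) (fun t => opp (opp (f (- t))))).
  { intros. apply opp_opp. }
  apply (is_RInt_opp (V := R_NormedModule)).
  apply (is_RInt_comp_opp (V := R_NormedModule)). rewrite Ropp_0.
  apply (RInt_correct (V := R_CompleteNormedModule)), tame_ex_RInt; auto.
Qed.

Lemma tame_limits f : tame f -> exists lm lp : R,
  filterlim (fun a => RInt f a 0) (Rbar_locally m_infty) (locally lm) /\
  filterlim (fun b => RInt f 0 b) (Rbar_locally p_infty) (locally lp) /\
  is_lim_seq (fun n => RInt f (- INR n) (INR n)) (lm + lp).
Proof.
  intros Hf.
  destruct (tame_half_line f Hf) as [lp Hp].
  destruct (tame_half_line _ (tame_opp_arg f Hf)) as [lm Hm].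
  exists lm, lp. split; [| split]; auto.
  - apply filterlim_ext with (fun a => RInt (fun t => f (- t)) 0 (- a)).
    { intros a. rewrite <- RInt_neg_half by auto. now rewrite Ropp_involutive. }
    eapply filterlim_comp; [| apply Hm].
    apply (filterlim_Rbar_opp m_infty).
  - apply is_lim_seq_ext with (fun n => RInt (fun t => f (- t)) 0 (INR n) + RInt f 0 (INR n)).
    { intros n. rewrite <- RInt_neg_half by auto.
      apply (RInt_Chasles (V := R_CompleteNormedModule) f (- INR n) 0 (INR n)); apply tame_ex_RInt; auto. }
    apply (is_lim_seq_plus' _ _ lm lp);
    eapply filterlim_comp; [apply is_lim_seq_INR | apply Hm | apply is_lim_seq_INR | apply Hp].
Qed.

Lemma line_int_lim f : tame f ->
  is_lim_seq (fun n => RInt f (- INR n) (INR n)) (line_int f).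
Proof.
  intros Hf. destruct (tame_limits f Hf) as (lm & lp & _ & _ & H).
  unfold line_int. rewrite (is_lim_seq_unique _ _ H). auto.
Qed.

Lemma line_int_unique f (l : R) :
  is_lim_seq (fun n => RInt f (- INR n) (INR n)) l -> line_int f = l.
Proof. intros H. unfold line_int. now rewrite (is_lim_seq_unique _ _ H). Qed.

Lemma line_int_le f M : tame f -> lorentz_bound f M -> Rabs (line_int f) <= M * PI.
Proof.
  intros Hf HM.
  assert (M0 : 0 <= M).
  { assert (H := HM 0). assert (H0 := Rabs_pos (f 0)). unfold Rdiv in H. replace (/ (1 + 0 ^ 2)) with 1 in H by (simpl; field). lra. }
  apply (is_lim_seq_le (fun n => Rabs (RInt f (- INR n) (INR n))) (fun _ => M * PI)
    (Rabs (line_int f)) (M * PI)).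
  - intros n. assert (N := pos_INR n).
    eapply Rle_trans. apply (RInt_lorentz_le f M); auto; [apply Hf | lra].
    rewrite atan_opp. assert (B := atan_bound (INR n)).
    apply Rmult_le_compat_l; lra.
  - apply (is_lim_seq_abs _ (line_int f)). apply line_int_lim; auto.
  - apply is_lim_seq_const.
Qed.

Lemma line_int_ext f g : (forall t, f t = g t) -> line_int f = line_int g.
Proof.
  intros H. unfold line_int. f_equal. apply Lim_seq_ext. intros n. apply RInt_ext. auto.
Qed.

Lemma tame_ext f g : (forall t, f t = g t) -> tame f -> tame g.
Proof.
  intros H [Hc [M HM]]. split.
  - intros t. apply (continuous_ext f); auto.
  - exists M. intros t. rewrite <- H. auto.
Qed.

Lemma tame_plus f g : tame f -> tame g -> tame (fun t => f t + g t).
Proof.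
  intros [Hc [M HM]] [Hd [N HN]]. split.
  - intros t. apply (continuous_plus (V := R_NormedModule)); auto.
  - exists (M + N). intros t. eapply Rle_trans. apply Rabs_triang.
    unfold Rdiv. rewrite Rmult_plus_distr_r. apply Rplus_le_compat; auto.
Qed.

Lemma tame_scal k f : tame f -> tame (fun t => k * f t).
Proof.
  intros [Hc [M HM]]. split.
  - intros t. apply (continuous_scal_r (V := R_NormedModule) k f); auto.
  - exists (Rabs k * M). intros t. rewrite Rabs_mult. unfold Rdiv. rewrite Rmult_assoc.
    apply Rmult_le_compat_l. apply Rabs_pos. apply HM.
Qed.

Lemma line_int_plus f g : tame f -> tame g ->
  line_int (fun t => f t + g t) = line_int f + line_int g.
Proof.
  intros Hf Hg. apply line_int_unique.
  eapply is_lim_seq_ext; [| apply (is_lim_seq_plus' _ _ _ _ (line_int_lim f Hf) (line_int_lim g Hg))].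
  intros n. symmetry. apply (RInt_plus (V := R_CompleteNormedModule)); apply tame_ex_RInt; auto.
Qed.

Lemma line_int_scal k f : tame f -> line_int (fun t => k * f t) = k * line_int f.
Proof.
  intros Hf. apply line_int_unique.
  eapply is_lim_seq_ext; [| apply (is_lim_seq_scal_l _ k _ (line_int_lim f Hf))].
  intros n. symmetry. apply (RInt_scal (V := R_CompleteNormedModule)); apply tame_ex_RInt; auto.
Qed.

Lemma line_int_odd f : tame f -> (forall t, f (- t) = - f t) -> line_int f = 0.
Proof.
  intros Hf Ho. apply line_int_unique.
  apply is_lim_seq_ext with (fun _ => 0); [| apply is_lim_seq_const].
  intros n. symmetry.
  rewrite <- (RInt_Chasles (V := R_CompleteNormedModule) f (- INR n) 0 (INR n)) by (apply tame_ex_RInt; auto).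
  rewrite RInt_neg_half by auto.
  rewrite (RInt_ext (fun t => f (- t)) (fun t => opp (f t))) by (intros; apply Ho).
  rewrite (RInt_opp (V := R_CompleteNormedModule) f) by (apply tame_ex_RInt; auto).
  unfold plus, opp; cbn. ring.
Qed.

(** [RInt_gen] lets the two end points go to infinity independently. The half-line limits of the
    components are therefore combined along the product filter, after splitting the integral at
    0. *)
Lemma line_int_RInt_gen (f : R -> C) :
  tame (fun t => fst (f t)) -> tame (fun t => snd (f t)) ->
  RInt_gen (V := C_R_CompleteNormedModule) f (Rbar_locally m_infty) (Rbar_locally p_infty)
  = (line_int (fun t => fst (f t)), line_int (fun t => snd (f t))).
Proof.
  intros H1 H2.
  destruct (tame_limits _ H1) as (lm1 & lp1 & A1 & B1 & C1).
  destruct (tame_limits _ H2) as (lm2 & lp2 & A2 & B2 & C2).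
  rewrite (line_int_unique _ _ C1), (line_int_unique _ _ C2).
  apply (is_RInt_gen_unique (V := C_R_CompleteNormedModule)).
  intros P HP.
  set (G := fun ab : R * R => ((RInt (fun t => fst (f t)) (fst ab) 0 + RInt (fun t => fst (f t)) 0 (snd ab), RInt (fun t => snd (f t)) (fst ab) 0 + RInt (fun t => snd (f t)) 0 (snd ab)) : C)).
  assert (HG : filterlim G (filter_prod (Rbar_locally m_infty) (Rbar_locally p_infty)) (locally ((lm1 + lp1, lm2 + lp2) : C))).
  { assert (K : forall (h : R -> R) lm lp,
      filterlim (fun a => RInt h a 0) (Rbar_locally m_infty) (locally lm) ->
      filterlim (fun b => RInt h 0 b) (Rbar_locally p_infty) (locally lp) ->
      filterlim (fun ab : R * R => RInt h (fst ab) 0 + RInt h 0 (snd ab))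
        (filter_prod (Rbar_locally m_infty) (Rbar_locally p_infty)) (locally (lm + lp))).
    { intros h lm lp A B.
      eapply (filterlim_comp_2 (fun ab => RInt h (fst ab) 0) (fun ab => RInt h 0 (snd ab)) Rplus).
      - apply (filterlim_comp _ _ _ fst (fun a => RInt h a 0) _ _ _ filterlim_fst A).
      - apply (filterlim_comp _ _ _ snd (fun b => RInt h 0 b) _ _ _ filterlim_snd B).
      - apply (filterlim_plus (V := R_NormedModule)). }
    apply (filterlim_locally (U := prod_UniformSpace R_UniformSpace R_UniformSpace)). intros eps.
    generalize (filter_and _ _ (proj1 (filterlim_locally _ _) (K _ _ _ A1 B1) eps)
      (proj1 (filterlim_locally _ _) (K _ _ _ A2 B2) eps)).
    apply filter_imp. intros ab [U1 U2]. split; assumption. }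
  unfold filtermapi.
  apply (filter_imp (F := filter_prod (Rbar_locally m_infty) (Rbar_locally p_infty))
    (fun ab => P (G ab))); [| exact (HG P HP)].
  intros [a b] HPG. exists (G (a, b)). split; auto.
  apply (is_RInt_fct_extend_pair (U := R_NormedModule) (V := R_NormedModule)); cbn.
  - apply (is_RInt_Chasles (V := R_NormedModule) _ a 0 b);
    apply (RInt_correct (V := R_CompleteNormedModule)), tame_ex_RInt; auto.
  - apply (is_RInt_Chasles (V := R_NormedModule) _ a 0 b);
    apply (RInt_correct (V := R_CompleteNormedModule)), tame_ex_RInt; auto.
Qed.

(** * Complex-valued functions of a real variable *)

Lemma Re_plus z w : Re (z + w)%C = Re z + Re w. Proof. reflexivity. Qed.
Lemma Im_plus z w : Im (z + w)%C = Im z + Im w. Proof. reflexivity. Qed.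
Lemma Re_mult z w : Re (z * w)%C = Re z * Re w - Im z * Im w. Proof. reflexivity. Qed.
Lemma Im_mult z w : Im (z * w)%C = Re z * Im w + Im z * Re w. Proof. reflexivity. Qed.
Lemma Re_RtoC x : Re (RtoC x) = x. Proof. reflexivity. Qed.
Lemma Im_RtoC x : Im (RtoC x) = 0. Proof. reflexivity. Qed.

Lemma C_eq z w : Re z = Re w -> Im z = Im w -> z = w.
Proof. destruct z, w; cbn; intros; subst; auto. Qed.

Lemma Re_le_Cmod z : Rabs (Re z) <= Cmod z.
Proof.
  eapply Rle_trans; [| apply Rmax_Cmod]. apply Rmax_l.
Qed.

Lemma Im_le_Cmod z : Rabs (Im z) <= Cmod z.
Proof.
  eapply Rle_trans; [| apply Rmax_Cmod]. apply Rmax_r.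
Qed.

Lemma Cmod_le_Re_Im z : Cmod z <= Rabs (Re z) + Rabs (Im z).
Proof.
  replace z with (RtoC (Re z) + Ci * RtoC (Im z))%C at 1.
  eapply Rle_trans. apply Cmod_triangle.
  rewrite Cmod_mult, !Cmod_R, Cmod_Ci. lra.
  apply C_eq; cbn; ring.
Qed.

(** Derivative along a real variable, by components, so that real calculus applies. It serves for
    the height t, for the abscissa a of a vertical line and for the positive variable y. *)
Definition Cder (f : R -> C) (x : R) (l : C) :=
  is_derive (fun t => Re (f t)) x (Re l) /\ is_derive (fun t => Im (f t)) x (Im l).

Definition Ccont (f : R -> C) (x : R) :=
  continuous (fun t => Re (f t)) x /\ continuous (fun t => Im (f t)) x.

Lemma Cder_eq f x l l' : Cder f x l -> l = l' -> Cder f x l'.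
Proof. now intros H <-. Qed.

Lemma Cder_ext f g x l : (forall t, f t = g t) -> Cder f x l -> Cder g x l.
Proof.
  intros H [H1 H2]. split; [apply is_derive_ext with (2 := H1) | apply is_derive_ext with (2 := H2)];
  intros t; now rewrite H.
Qed.

Lemma Cder_cont f x l : Cder f x l -> Ccont f x.
Proof.
  intros [H1 H2]. split; apply (ex_derive_continuous (V := R_NormedModule)); eexists; eassumption.
Qed.

Lemma Cder_const c x : Cder (fun _ => c) x 0.
Proof. split; apply (is_derive_const (V := R_NormedModule)). Qed.

Lemma Cder_RtoC f x l : is_derive f x l -> Cder (fun t => RtoC (f t)) x (RtoC l).
Proof. intros H; split; cbn; auto. apply (is_derive_const (V := R_NormedModule)). Qed.

Lemma Cder_plus f g x lf lg : Cder f x lf -> Cder g x lg ->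
  Cder (fun t => f t + g t)%C x (lf + lg)%C.
Proof.
  intros [H1 H2] [K1 K2].
  split; apply (is_derive_plus (V := R_NormedModule)); auto.
Qed.

Lemma is_derive_mult_R f g x lf lg : is_derive f x lf -> is_derive g x lg ->
  is_derive (fun t => f t * g t) x (lf * g x + f x * lg).
Proof.
  intros. apply (is_derive_mult f g x lf lg); auto. intros; apply Rmult_comm.
Qed.

Lemma Cder_mult f g x lf lg : Cder f x lf -> Cder g x lg ->
  Cder (fun t => f t * g t)%C x (lf * g x + f x * lg)%C.
Proof.
  intros [H1 H2] [K1 K2]. split; cbn.
  - evar_last. apply (is_derive_minus (V := R_NormedModule)); apply is_derive_mult_R; eassumption.
    unfold minus, plus, opp; cbn. unfold Re, Im. ring.
  - evar_last. apply (is_derive_plus (V := R_NormedModule)); apply is_derive_mult_R; eassumption.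
    unfold minus, plus, opp; cbn. unfold Re, Im. ring.
Qed.

Lemma Cder_scal c f x l : Cder f x l -> Cder (fun t => c * f t)%C x (c * l)%C.
Proof.
  intros H. eapply Cder_eq. apply (Cder_mult (fun _ => c) f); [apply Cder_const | exact H].
  ring.
Qed.

Lemma Cder_opp f x l : Cder f x l -> Cder (fun t => - f t)%C x (- l)%C.
Proof.
  intros [H1 H2]. split; apply (is_derive_opp (V := R_NormedModule)); auto.
Qed.

Lemma Cder_minus f g x lf lg : Cder f x lf -> Cder g x lg ->
  Cder (fun t => f t - g t)%C x (lf - lg)%C.
Proof. intros. apply Cder_plus; auto. apply Cder_opp; auto. Qed.

Lemma is_derive_comp_R f g x lf lg : is_derive f (g x) lf -> is_derive g x lg ->
  is_derive (fun t => f (g t)) x (lf * lg).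
Proof.
  intros. evar_last. apply (is_derive_comp f g); eassumption.
  unfold scal; cbn; unfold mult; cbn. ring.
Qed.

Lemma Cder_exp f x l : Cder f x l -> Cder (fun t => Cexp (f t)) x (l * Cexp (f x))%C.
Proof.
  intros [H1 H2].
  assert (E := is_derive_comp_R exp (fun t => Re (f t)) x _ _ (is_derive_exp _) H1).
  assert (Co := is_derive_comp_R cos (fun t => Im (f t)) x _ _ (is_derive_cos _) H2).
  assert (Si := is_derive_comp_R sin (fun t => Im (f t)) x _ _ (is_derive_sin _) H2).
  split.
  - apply is_derive_ext with (fun t => exp (Re (f t)) * cos (Im (f t))).
    { intros; cbn; ring. }
    evar_last. apply is_derive_mult_R; eassumption. cbn. unfold Re, Im. ring.
  - apply is_derive_ext with (fun t => exp (Re (f t)) * sin (Im (f t))).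
    { intros; cbn; ring. }
    evar_last. apply is_derive_mult_R; eassumption. cbn. unfold Re, Im. ring.
Qed.

Lemma Cder_inv f x l : Cder f x l -> f x <> 0%C -> Cder (fun t => / f t)%C x (- l * / (f x * f x))%C.
Proof.
  intros [H1 H2] H0.
  assert (N : Re (f x) ^ 2 + Im (f x) ^ 2 <> 0).
  { intros E. apply H0. apply C_eq; cbn; nra. }
  assert (D : is_derive (fun t => Re (f t) ^ 2 + Im (f t) ^ 2) x (2 * Re (f x) * Re l + 2 * Im (f x) * Im l)).
  { apply is_derive_ext with (fun t => Re (f t) * Re (f t) + Im (f t) * Im (f t)).
    { intros; cbn; ring. }
    evar_last. apply (is_derive_plus (V := R_NormedModule)); apply is_derive_mult_R; eassumption.
    unfold plus; cbn. ring. }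
  assert (I := is_derive_inv _ _ _ D N).
  assert (N' : Re (f x) * Re (f x) + Im (f x) * Im (f x) <> 0) by (contradict N; rewrite <- N; ring).
  split; unfold Cinv; cbn [Re Im fst snd].
  - evar_last. apply is_derive_mult_R; [apply H1 | apply I].
    cbv beta. destruct (f x) as [a b], l as [l1 l2]. cbn in *. field. split; contradict N'; [nra | lra].
  - evar_last. apply is_derive_mult_R; [apply (is_derive_opp (V := R_NormedModule)); apply H2 | apply I].
    cbv beta. destruct (f x) as [a b], l as [l1 l2]. cbn in *. unfold opp; cbn. field. split; contradict N'; [nra | lra].
Qed.

Lemma Ccont_const c x : Ccont (fun _ => c) x.
Proof. split; apply continuous_const. Qed.

Lemma Ccont_ext f g x : (forall t, f t = g t) -> Ccont f x -> Ccont g x.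
Proof.
  intros H [H1 H2]. split; [apply continuous_ext with (2 := H1) | apply continuous_ext with (2 := H2)];
  intros t; now rewrite H.
Qed.

Lemma Ccont_plus f g x : Ccont f x -> Ccont g x -> Ccont (fun t => f t + g t)%C x.
Proof.
  intros [H1 H2] [K1 K2]. split; apply (continuous_plus (V := R_NormedModule)); auto.
Qed.

Lemma Ccont_mult f g x : Ccont f x -> Ccont g x -> Ccont (fun t => f t * g t)%C x.
Proof.
  intros [H1 H2] [K1 K2]. split; cbn.
  - apply (continuous_minus (V := R_NormedModule)); apply (continuous_mult (K := R_AbsRing)); auto.
  - apply (continuous_plus (V := R_NormedModule)); apply (continuous_mult (K := R_AbsRing)); auto.
Qed.

(** The mean value theorem is applied to the real and imaginary parts separately, whence the factor
    2. *)
Lemma Cder_mvt f df a b M : a <= b -> (forall x, a <= x <= b -> Cder f x (df x)) ->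
  (forall x, a <= x <= b -> Cmod (df x) <= M) -> Cmod (f b - f a)%C <= 2 * M * (b - a).
Proof.
  intros ab Hd HM.
  eapply Rle_trans. apply Cmod_le_Re_Im.
  replace (2 * M * (b - a)) with (M * (b - a) + M * (b - a)) by ring.
  apply Rplus_le_compat.
  - apply (mvt_abs_le (fun t => Re (f t)) (fun t => Re (df t))); auto.
    + intros x Hx; apply (Hd x Hx).
    + intros x Hx. eapply Rle_trans; [apply Re_le_Cmod | auto].
  - apply (mvt_abs_le (fun t => Im (f t)) (fun t => Im (df t))); auto.
    + intros x Hx; apply (Hd x Hx).
    + intros x Hx. eapply Rle_trans; [apply Im_le_Cmod | auto].
Qed.

(** Two uses of [Cder_mvt], for [df] and then for f minus its tangent, give 2 times 2. Applied for
    each t with M proportional to 1/(1 + t^2), the remainder can be integrated over the line. *)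
Lemma Cder_taylor f df ddf a b M : a <= b ->
  (forall x, a <= x <= b -> Cder f x (df x)) ->
  (forall x, a <= x <= b -> Cder df x (ddf x)) ->
  (forall x, a <= x <= b -> Cmod (ddf x) <= M) ->
  forall x y, a <= x <= b -> a <= y <= b ->
  Cmod (f y - f x - RtoC (y - x) * df x)%C <= 4 * M * (y - x) ^ 2.
Proof.
  intros ab H1 H2 HM x y Hx Hy.
  assert (M0 : 0 <= M) by (eapply Rle_trans; [| apply (HM x Hx)]; apply Cmod_ge_0).
  assert (L : forall u v, a <= u <= b -> a <= v <= b -> Cmod (df v - df u)%C <= 2 * M * Rabs (v - u)).
  { intros u v Hu Hv. destruct (Rle_dec u v).
    - rewrite Rabs_pos_eq by lra. apply Cder_mvt with ddf; auto; intros; [apply H2 | apply HM]; lra.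
    - rewrite <- Cmod_opp. replace (- (df v - df u))%C with (df u - df v)%C by ring.
      rewrite Rabs_minus_sym, Rabs_pos_eq by lra.
      apply Cder_mvt with ddf; try lra; intros; [apply H2 | apply HM]; lra. }
  set (g := fun t => (f t - f x - RtoC (t - x) * df x)%C).
  assert (G0 : g x = 0%C) by (unfold g; replace (x - x) with 0 by ring; ring).
  assert (Gd : forall t, a <= t <= b -> Cder g t (df t - df x)%C).
  { intros t Ht. unfold g. eapply Cder_eq.
    apply Cder_minus. apply Cder_minus. apply H1; auto. apply Cder_const.
    apply Cder_mult. apply Cder_RtoC. apply (is_derive_minus (V := R_NormedModule)). apply is_derive_id. apply is_derive_const. apply Cder_const.
    unfold minus, plus, opp, one, zero; cbn. replace (1 + - 0) with 1 by ring. ring. }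
  change (Cmod (g y) <= 4 * M * (y - x) ^ 2).
  replace (4 * M * (y - x) ^ 2) with (2 * (2 * M * Rabs (y - x)) * Rabs (y - x)).
  2: { rewrite <- (pow2_abs (y - x)). ring. }
  destruct (Rle_dec x y).
  - replace (g y) with (g y - g x)%C by (rewrite G0; ring).
    rewrite (Rabs_pos_eq (y - x)) by lra.
    apply Cder_mvt with (fun t => df t - df x)%C; auto; intros t Ht. apply Gd; lra.
    eapply Rle_trans. apply L; lra. apply Rmult_le_compat_l. lra. rewrite Rabs_pos_eq; lra.
  - replace (g y) with (- (g x - g y))%C by (rewrite G0; ring).
    rewrite Cmod_opp, Rabs_minus_sym, (Rabs_pos_eq (x - y)) by lra.
    apply Cder_mvt with (fun t => df t - df x)%C; try lra; intros t Ht. apply Gd; lra.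
    eapply Rle_trans. apply L; lra. apply Rmult_le_compat_l. lra. rewrite Rabs_minus_sym, Rabs_pos_eq; lra.
Qed.

(** * The complex exponential *)

Lemma Cexp_add z w : Cexp (z + w) = (Cexp z * Cexp w)%C.
Proof.
  apply C_eq; unfold Cexp; cbn; rewrite exp_plus; rewrite ?cos_plus, ?sin_plus; unfold Re, Im; ring.
Qed.

Lemma Cexp_0 : Cexp 0 = 1%C.
Proof. apply C_eq; unfold Cexp; cbn; rewrite exp_0, ?cos_0, ?sin_0; ring. Qed.

Lemma Cexp_RtoC x : Cexp (RtoC x) = RtoC (exp x).
Proof. apply C_eq; unfold Cexp; cbn; rewrite ?cos_0, ?sin_0; ring. Qed.

Lemma Cmod_Cexp z : Cmod (Cexp z) = exp (Re z).
Proof.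
  unfold Cexp. rewrite Cmod_mult, Cmod_R, Rabs_pos_eq by (left; apply exp_pos).
  replace (Cmod _) with 1; [ring |].
  unfold Cmod; cbn. rewrite !Rmult_1_r. assert (H := sin2_cos2 (Im z)). unfold Rsqr in H.
  replace (cos (Im z) * cos (Im z) + sin (Im z) * sin (Im z)) with 1 by lra. now rewrite sqrt_1.
Qed.

Lemma Cmod_Rcpow a s : Cmod (Rcpow a s) = Rpower a (Re s).
Proof.
  unfold Rcpow. rewrite Cmod_Cexp. unfold Rpower. f_equal. cbn. unfold Re. ring.
Qed.

Lemma Rcpow_add a s r : Rcpow a (s + r) = (Rcpow a s * Rcpow a r)%C.
Proof. unfold Rcpow. rewrite <- Cexp_add. f_equal. ring. Qed.

Lemma Rcpow_mult a b s : 0 < a -> 0 < b -> Rcpow (a * b) s = (Rcpow a s * Rcpow b s)%C.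
Proof. intros. unfold Rcpow. rewrite <- Cexp_add, ln_mult, RtoC_plus by auto. f_equal. ring. Qed.

Lemma Rcpow_inv a s : 0 < a -> Rcpow (/ a) s = Rcpow a (- s).
Proof. intros. unfold Rcpow. rewrite ln_Rinv, RtoC_opp by auto. f_equal. ring. Qed.

Lemma Rcpow_1 a : 0 < a -> Rcpow a 1 = RtoC a.
Proof.
  intros. unfold Rcpow. replace (1 * RtoC (ln a))%C with (RtoC (ln a)) by ring.
  now rewrite Cexp_RtoC, exp_ln.
Qed.

Lemma Cder_Rcpow s a : 0 < a -> Cder (fun x => Rcpow x s) a (s * Rcpow a (s - 1))%C.
Proof.
  intros Ha. unfold Rcpow. eapply Cder_eq.
  apply Cder_exp. apply Cder_scal. apply Cder_RtoC.
  apply is_derive_ln; auto.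
  cbv beta. change (Cexp ((s - 1) * RtoC (ln a))) with (Rcpow a (s - 1)).
  change (Cexp (s * RtoC (ln a))) with (Rcpow a s).
  assert (E : Rcpow a s = (Rcpow a (s - 1) * RtoC a)%C).
  { rewrite <- (Rcpow_1 a), <- Rcpow_add by auto. f_equal. ring. }
  rewrite E.
  rewrite RtoC_inv by lra. field.
  intros E0; apply RtoC_inj in E0; lra.
Qed.

(** * Integrals over the line of complex-valued functions *)

Definition Ctame (f : R -> C) := tame (fun t => Re (f t)) /\ tame (fun t => Im (f t)).
Definition Cline_int (f : R -> C) : C :=
  (line_int (fun t => Re (f t)), line_int (fun t => Im (f t))).

Lemma Ctame_intro f M : (forall t, Ccont f t) -> (forall t, Cmod (f t) <= M / (1 + t ^ 2)) -> Ctame f.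
Proof.
  intros Hc HM. split; split; try (intros t; apply Hc); exists M; intros t;
  (eapply Rle_trans; [| apply HM]); [apply Re_le_Cmod | apply Im_le_Cmod].
Qed.

Lemma Cline_int_le f M : Ctame f -> (forall t, Cmod (f t) <= M / (1 + t ^ 2)) ->
  Cmod (Cline_int f) <= 2 * PI * M.
Proof.
  intros [H1 H2] HM. eapply Rle_trans. apply Cmod_le_Re_Im.
  replace (2 * PI * M) with (M * PI + M * PI) by ring.
  apply Rplus_le_compat; apply line_int_le; auto; intros t; (eapply Rle_trans; [| apply HM]);
  [apply Re_le_Cmod | apply Im_le_Cmod].
Qed.

Lemma Ctame_ext f g : (forall t, f t = g t) -> Ctame f -> Ctame g.
Proof.
  intros H [H1 H2]; split; [apply tame_ext with (2 := H1) | apply tame_ext with (2 := H2)];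
  intros t; now rewrite H.
Qed.

Lemma Cline_int_ext f g : (forall t, f t = g t) -> Cline_int f = Cline_int g.
Proof. intros H. unfold Cline_int. f_equal; apply line_int_ext; intros t; now rewrite H. Qed.

Lemma Ctame_plus f g : Ctame f -> Ctame g -> Ctame (fun t => f t + g t)%C.
Proof. intros [] []. split; apply tame_plus; auto. Qed.

Lemma Cline_int_plus f g : Ctame f -> Ctame g ->
  Cline_int (fun t => f t + g t)%C = (Cline_int f + Cline_int g)%C.
Proof.
  intros [] []. apply C_eq; cbn [Re Im fst snd Cline_int Cplus]; apply line_int_plus; auto.
Qed.

Lemma tame_lin a b f g : tame f -> tame g -> tame (fun t => a * f t + b * g t).
Proof. intros. apply tame_plus; apply tame_scal; auto. Qed.

Lemma line_int_lin a b f g : tame f -> tame g ->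
  line_int (fun t => a * f t + b * g t) = a * line_int f + b * line_int g.
Proof. intros. rewrite line_int_plus, !line_int_scal; auto; apply tame_scal; auto. Qed.

Lemma Ctame_scal c f : Ctame f -> Ctame (fun t => c * f t)%C.
Proof.
  intros []. split.
  - apply tame_ext with (fun t => Re c * Re (f t) + - Im c * Im (f t)); [intros; cbn; unfold Re, Im; ring |].
    apply tame_lin; auto.
  - apply tame_ext with (fun t => Im c * Re (f t) + Re c * Im (f t)); [intros; cbn; unfold Re, Im; ring |].
    apply tame_lin; auto.
Qed.

Lemma Cline_int_scal c f : Ctame f -> Cline_int (fun t => c * f t)%C = (c * Cline_int f)%C.
Proof.
  intros []. apply C_eq.
  - rewrite Re_mult. cbn [Re Im fst snd Cline_int].
    rewrite (line_int_ext _ (fun t => Re c * Re (f t) + - Im c * Im (f t))) by (intros; cbn; unfold Re, Im; ring).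
    rewrite line_int_lin; auto. unfold Re, Im. ring.
  - rewrite Im_mult. cbn [Re Im fst snd Cline_int].
    rewrite (line_int_ext _ (fun t => Im c * Re (f t) + Re c * Im (f t))) by (intros; cbn; unfold Re, Im; ring).
    rewrite line_int_lin; auto. unfold Re, Im. ring.
Qed.

Lemma Ctame_minus f g : Ctame f -> Ctame g -> Ctame (fun t => f t - g t)%C.
Proof.
  intros. apply Ctame_plus; auto. apply Ctame_ext with (fun t => (- (1)) * g t)%C. intros; ring.
  apply Ctame_scal; auto.
Qed.

Lemma Cline_int_minus f g : Ctame f -> Ctame g ->
  Cline_int (fun t => f t - g t)%C = (Cline_int f - Cline_int g)%C.
Proof.
  intros. rewrite (Cline_int_ext _ (fun t => f t + (- (1)) * g t)%C) by (intros; ring).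
  rewrite Cline_int_plus, Cline_int_scal; auto. ring. apply Ctame_scal; auto.
Qed.

Lemma vertical_integral_eq c f : Ctame (fun t => f (RtoC c + Ci * RtoC t)%C) ->
  vertical_integral c f = (Ci * Cline_int (fun t => f (RtoC c + Ci * RtoC t)%C))%C.
Proof.
  intros H. unfold vertical_integral.
  assert (H' : Ctame (fun t => f (RtoC c + Ci * RtoC t) * Ci)%C).
  { apply Ctame_ext with (fun t => Ci * f (RtoC c + Ci * RtoC t))%C. intros; ring. apply Ctame_scal; auto. }
  rewrite line_int_RInt_gen by apply H'.
  rewrite <- Cline_int_scal by auto. apply Cline_int_ext. intros; ring.
Qed.

(** * The kernel pi^2 / (1 - cos (pi w)) and its inverse Mellin transform *)

Lemma cosh_ge_1 x : 1 <= cosh x.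
Proof.
  unfold cosh. assert (H := exp_ineq1_le x). assert (H' := exp_ineq1_le (- x)). lra.
Qed.

Lemma cosh_double x : cosh (2 * x) = 2 * cosh x ^ 2 - 1.
Proof.
  unfold cosh. replace (2 * x) with (x + x) by ring.
  replace (- (x + x)) with (- x + - x) by ring. rewrite !exp_plus.
  assert (E : exp x * exp (- x) = 1) by (rewrite <- exp_plus, Rplus_opp_r; apply exp_0).
  field_simplify. nra.
Qed.

Lemma sinh_cosh_sq x : cosh x ^ 2 - sinh x ^ 2 = 1.
Proof.
  unfold cosh, sinh.
  assert (E : exp x * exp (- x) = 1) by (rewrite <- exp_plus, Rplus_opp_r; apply exp_0).
  nra.
Qed.

Lemma sinh_le_cosh x : Rabs (sinh x) <= cosh x.
Proof.
  unfold cosh, sinh. assert (A := exp_pos x). assert (B := exp_pos (- x)).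
  apply Rabs_le. lra.
Qed.

Lemma sinh_opp x : sinh (- x) = - sinh x.
Proof. unfold sinh. rewrite Ropp_involutive. field. Qed.

Lemma cosh_opp x : cosh (- x) = cosh x.
Proof. unfold cosh. rewrite Ropp_involutive. field. Qed.

Lemma cosh_ge_sq x : 1 + x ^ 2 / 2 <= cosh x.
Proof.
  assert (P : forall y, 0 <= y -> y <= sinh y).
  { intros y Hy.
    destruct (MVT_gen sinh 0 y cosh) as [c [_ E]].
    - intros; auto_derive; auto. unfold cosh. field.
    - intros. apply continuity_pt_filterlim, (ex_derive_continuous (V := R_NormedModule)).
      auto_derive; auto.
    - assert (C := cosh_ge_1 c). rewrite sinh_0 in E. nra. }
  assert (Q : forall y, 0 <= y -> 1 + y ^ 2 / 2 <= cosh y).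
  { intros y Hy. replace y with (2 * (y / 2)) at 2 by field. rewrite cosh_double.
    assert (H := sinh_cosh_sq (y / 2)). assert (B := P (y / 2) ltac:(lra)). nra. }
  destruct (Rle_dec 0 x). auto. rewrite <- cosh_opp. replace (x ^ 2) with ((- x) ^ 2) by ring.
  apply Q; lra.
Qed.

Lemma PI_gt_3 : 3 < PI.
Proof. assert (H := PI2_3_2). lra. Qed.

(** From cosh (pi t / 4) >= (1 + t^2)/4 the argument is doubled twice; since cosh (2x) = 2 cosh^2 x
    - 1 >= cosh^2 x, each doubling squares the bound. Hence the power 4 and the constant 256 =
    4^4. *)
Lemma cosh_PI_ge t : (1 + t ^ 2) ^ 4 / 256 <= cosh (PI * t).
Proof.
  assert (H := cosh_ge_sq (PI * t / 4)).
  assert (D1 := cosh_double (PI * t / 4)). assert (D2 := cosh_double (PI * t / 2)).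
  replace (2 * (PI * t / 4)) with (PI * t / 2) in D1 by field.
  replace (2 * (PI * t / 2)) with (PI * t) in D2 by field.
  assert (C1 := cosh_ge_1 (PI * t / 4)). assert (C2 := cosh_ge_1 (PI * t / 2)).
  assert (P := PI_gt_3).
  assert (K : (1 + t ^ 2) / 4 <= cosh (PI * t / 4)).
  { assert (9 * t ^ 2 <= PI ^ 2 * t ^ 2) by (apply Rmult_le_compat_r; nra).
    replace ((PI * t / 4) ^ 2 / 2) with (PI ^ 2 * t ^ 2 / 32) in H by field. nra. }
  assert (0 <= (1 + t ^ 2) / 4) by nra.
  assert (K1 : ((1 + t ^ 2) / 4) ^ 2 <= cosh (PI * t / 2)) by nra.
  assert (0 <= ((1 + t ^ 2) / 4) ^ 2) by nra.
  assert (K2 : (((1 + t ^ 2) / 4) ^ 2) ^ 2 <= cosh (PI * t)) by nra.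
  replace ((1 + t ^ 2) ^ 4 / 256) with ((((1 + t ^ 2) / 4) ^ 2) ^ 2) by field. auto.
Qed.

Lemma inv_cosh_le t : / cosh (PI * t) <= 256 / (1 + t ^ 2) ^ 4.
Proof.
  assert (H := cosh_PI_ge t). assert (P := one_sq_pos t).
  assert (P4 : 0 < (1 + t ^ 2) ^ 4) by (apply pow_lt; auto).
  replace (256 / (1 + t ^ 2) ^ 4) with (/ ((1 + t ^ 2) ^ 4 / 256)) by (field; lra).
  apply Rinv_le_contravar; lra.
Qed.

Lemma inv_cosh_le1 t : / cosh (PI * t) <= 256 / (1 + t ^ 2).
Proof.
  eapply Rle_trans. apply inv_cosh_le. assert (P := one_sq_pos t).
  unfold Rdiv. apply Rmult_le_compat_l; [lra |]. apply Rinv_le_contravar; auto.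
  assert (1 <= 1 + t ^ 2) by nra.
  replace (1 + t ^ 2) with ((1 + t ^ 2) ^ 1) at 1 by ring. apply Rle_pow; auto.
Qed.

Definition wpt (a t : R) : C := (RtoC a + Ci * RtoC t)%C.

Lemma wpt_eq a t : wpt a t = (a, t).
Proof. apply C_eq; cbn; ring. Qed.

Lemma Cder_wpt_a a t : Cder (fun a => wpt a t) a 1.
Proof.
  apply Cder_ext with (fun a => (a, t) : C). intros; symmetry; apply wpt_eq.
  split; cbn; auto_derive; auto.
Qed.

Lemma Cder_wpt_t a t : Cder (fun t => wpt a t) t Ci.
Proof.
  apply Cder_ext with (fun t => (a, t) : C). intros; symmetry; apply wpt_eq.
  split; cbn; auto_derive; auto.
Qed.

(** The function 1 - cos (pi w) at w = a + it, in components so that derivatives and the modulus can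
    be computed with real functions; [omc_Cexp] gives the exponential form. Likewise [sin_pi] is sin
    (pi w). *)
Definition one_minus_cos (a t : R) : C :=
  (1 - cos (PI * a) * cosh (PI * t), sin (PI * a) * sinh (PI * t)).

Definition sin_pi (a t : R) : C :=
  (sin (PI * a) * cosh (PI * t), cos (PI * a) * sinh (PI * t)).

Lemma Cder_omc_a a t : Cder (fun a => one_minus_cos a t) a (RtoC PI * sin_pi a t)%C.
Proof. split; cbn; auto_derive; auto; ring. Qed.

Lemma Cder_omc_t a t : Cder (fun t => one_minus_cos a t) t (Ci * (RtoC PI * sin_pi a t))%C.
Proof. split; cbn; auto_derive; auto; unfold cosh, sinh; field. Qed.

Lemma Cder_sin_pi_a a t : Cder (fun a => sin_pi a t) a (RtoC PI * (1 - one_minus_cos a t))%C.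
Proof. split; cbn; auto_derive; auto; ring. Qed.

Lemma Cder_sin_pi_t a t : Cder (fun t => sin_pi a t) t (Ci * (RtoC PI * (1 - one_minus_cos a t)))%C.
Proof. split; cbn; auto_derive; auto; unfold cosh, sinh; field. Qed.

Lemma sin_pi_sq a t : (sin_pi a t * sin_pi a t)%C = (one_minus_cos a t * (2 - one_minus_cos a t))%C.
Proof.
  assert (H := sinh_cosh_sq (PI * t)). assert (K := sin2_cos2 (PI * a)). unfold Rsqr in K.
  unfold sin_pi, one_minus_cos. apply C_eq; cbn.
  - replace (sin (PI * a) * cosh (PI * t) * (sin (PI * a) * cosh (PI * t))) with
      ((1 - cos (PI * a) * cos (PI * a)) * cosh (PI * t) ^ 2) by (rewrite <- K; ring).
    replace (sin (PI * a) * sinh (PI * t) * (0 + - (sin (PI * a) * sinh (PI * t)))) with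
      (- (1 - cos (PI * a) * cos (PI * a)) * sinh (PI * t) ^ 2) by (rewrite <- K; ring).
    replace (cosh (PI * t) ^ 2) with (1 + sinh (PI * t) ^ 2) by lra.
    assert (E : cosh (PI * t) ^ 2 = 1 + sinh (PI * t) ^ 2) by lra.
    ring_simplify. rewrite E. ring.
  - ring.
Qed.

(** Because 1 - cos z = 2 sin^2 (z/2), the squared modulus is a perfect square. The formula shows
    both the zeros, at the even integers, and the exponential growth in t. *)
Lemma Cmod_omc a t : Cmod (one_minus_cos a t) = cosh (PI * t) - cos (PI * a).
Proof.
  assert (H := sinh_cosh_sq (PI * t)). assert (K := sin2_cos2 (PI * a)). unfold Rsqr in K.
  assert (C1 := cosh_ge_1 (PI * t)). assert (C2 := COS_bound (PI * a)).
  unfold Cmod, one_minus_cos; cbn [fst snd].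
  replace ((1 - cos (PI * a) * cosh (PI * t)) ^ 2 + (sin (PI * a) * sinh (PI * t)) ^ 2)
    with ((cosh (PI * t) - cos (PI * a))²).
  apply sqrt_Rsqr; lra.
  unfold Rsqr. replace ((sin (PI * a) * sinh (PI * t)) ^ 2) with
    ((sin (PI * a) * sin (PI * a)) * sinh (PI * t) ^ 2) by ring.
  replace (sin (PI * a) * sin (PI * a)) with (1 - cos (PI * a) * cos (PI * a)) by lra.
  replace (sinh (PI * t) ^ 2) with (cosh (PI * t) ^ 2 - 1) by lra. ring.
Qed.

Lemma Cmod_sin_pi a t : Cmod (sin_pi a t) <= 2 * cosh (PI * t).
Proof.
  eapply Rle_trans. apply Cmod_le_Re_Im. cbn. rewrite !Rabs_mult.
  assert (C1 := cosh_ge_1 (PI * t)). rewrite (Rabs_pos_eq (cosh _)) by lra.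
  assert (S := sinh_le_cosh (PI * t)). assert (A := COS_bound (PI * a)). assert (B := SIN_bound (PI * a)).
  assert (Rabs (cos (PI * a)) <= 1) by (apply Rabs_le; lra).
  assert (Rabs (sin (PI * a)) <= 1) by (apply Rabs_le; lra).
  assert (P1 := Rabs_pos (cos (PI * a))). assert (P2 := Rabs_pos (sin (PI * a))).
  assert (P3 := Rabs_pos (sinh (PI * t))). nra.
Qed.

Lemma cos_PI_lt_1 a : 0 < a < 2 -> cos (PI * a) < 1.
Proof.
  intros Ha. assert (P := PI_RGT_0).
  destruct (Rle_dec a 1) as [H | H].
  - rewrite <- cos_0. apply cos_decreasing_1; nra.
  - rewrite <- cos_2PI. apply cos_increasing_1; nra.
Qed.

Lemma omc_lower (rho a t : R) : 0 <= rho -> cos (PI * a) <= rho ->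
  (1 - rho) * cosh (PI * t) <= Cmod (one_minus_cos a t).
Proof. intros. rewrite Cmod_omc. assert (C1 := cosh_ge_1 (PI * t)). nra. Qed.

Lemma omc_neq_0 a t : 0 < a < 2 -> one_minus_cos a t <> 0%C.
Proof.
  intros Ha E. assert (H := Cmod_omc a t). rewrite E, Cmod_0 in H.
  assert (C1 := cosh_ge_1 (PI * t)). assert (C2 := cos_PI_lt_1 a Ha). lra.
Qed.

(** On [p, q] the cosine is largest at an end point. The gap 1 - rho measures the distance of the
    strip from the poles at 0 and 2 and makes the later bounds uniform in the abscissa. *)
Lemma cos_PI_bound p q : 0 < p -> p <= q -> q < 2 ->
  exists rho, 0 <= rho < 1 /\ forall a, p <= a <= q -> cos (PI * a) <= rho.
Proof.
  intros Hp pq Hq. assert (P := PI_RGT_0).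
  exists (Rmax 0 (Rmax (cos (PI * p)) (cos (PI * q)))). split.
  - split. apply Rmax_l. repeat apply Rmax_lub_lt; try lra; apply cos_PI_lt_1; lra.
  - intros a Ha. eapply Rle_trans; [| apply Rmax_r].
    destruct (Rle_dec a 1) as [H | H].
    + eapply Rle_trans; [| apply Rmax_l]. apply cos_decr_1; nra.
    + eapply Rle_trans; [| apply Rmax_r]. apply cos_incr_1; nra.
Qed.

Lemma line_int_of_derivative (g dg : R -> R) M : lorentz_bound g M ->
  (forall t, is_derive g t (dg t)) -> tame dg -> line_int dg = 0.
Proof.
  intros HM Hd Ht. apply line_int_unique.
  apply is_lim_seq_ext with (fun n => g (INR n) - g (- INR n)).
  { intros n. symmetry. apply (is_RInt_unique (V := R_CompleteNormedModule)).
    apply (is_RInt_derive (V := R_CompleteNormedModule) g); intros; [apply Hd | apply Ht]. }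
  assert (Z : forall s : R -> R, (forall t, s t ^ 2 = t ^ 2) -> is_lim_seq (fun n => g (s (INR n))) 0).
  { intros s Hs. apply is_lim_seq_abs_0.
    apply is_lim_seq_le_le with (fun _ => 0) (fun n => Rabs M * / (INR n + 1)).
    - intros n. split. apply Rabs_pos.
      eapply Rle_trans; [apply HM |]. rewrite Hs.
      assert (N := pos_INR n). assert (P := one_sq_pos (INR n)).
      eapply Rle_trans with (Rabs M / (1 + INR n ^ 2)).
      apply Rmult_le_compat_r; [left; apply Rinv_0_lt_compat; auto | apply Rle_abs].
      apply Rmult_le_compat_l; [apply Rabs_pos |].
      destruct n as [| n]. cbn. replace (0 * (0 * 1)) with 0 by ring. lra.
      apply Rinv_le_contravar. lra. rewrite S_INR in *. assert (N' := pos_INR n). nra.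
    - apply is_lim_seq_const.
    - evar_last. apply is_lim_seq_scal_l.
      apply is_lim_seq_inv. apply is_lim_seq_plus with (l1 := p_infty) (l2 := 1). apply is_lim_seq_INR. apply is_lim_seq_const. reflexivity. discriminate.
      cbn. f_equal. ring. }
  evar_last. apply is_lim_seq_minus'; [apply (Z (fun t => t)) | apply (Z Ropp)]; intros; ring.
  cbn; f_equal; ring.
Qed.

(* At w = a + it; kern1 and kern2 are the first two derivatives in w, kern2 being
   simplified with sin^2 = (1 - cos) (1 + cos). *)
Definition kern (L a t : R) : C := (Cexp (- RtoC L * wpt a t) * / one_minus_cos a t)%C.
Definition kern1 (L a t : R) : C :=
  (Cexp (- RtoC L * wpt a t) * (- RtoC L * / one_minus_cos a t
    - RtoC PI * sin_pi a t * / (one_minus_cos a t * one_minus_cos a t)))%C.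
Definition kern2 (L a t : R) : C :=
  (Cexp (- RtoC L * wpt a t) *
    (RtoC L * RtoC L * / one_minus_cos a t
     + 2 * RtoC L * RtoC PI * sin_pi a t * / (one_minus_cos a t * one_minus_cos a t)
     + RtoC PI * RtoC PI * (3 - one_minus_cos a t) * / (one_minus_cos a t * one_minus_cos a t)))%C.

Lemma Cder_kern_a L a t : 0 < a < 2 -> Cder (fun a => kern L a t) a (kern1 L a t).
Proof.
  intros Ha. assert (N := omc_neq_0 a t Ha). unfold kern, kern1. eapply Cder_eq.
  apply Cder_mult. apply Cder_exp. apply Cder_scal. apply Cder_wpt_a.
  apply Cder_inv. apply Cder_omc_a. auto.
  cbv beta. generalize (Cexp (- RtoC L * wpt a t)). intros. field. auto.
Qed.

Lemma Cder_kern_t L a t : 0 < a < 2 -> Cder (fun t => kern L a t) t (Ci * kern1 L a t)%C.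
Proof.
  intros Ha. assert (N := omc_neq_0 a t Ha). unfold kern, kern1. eapply Cder_eq.
  apply Cder_mult. apply Cder_exp. apply Cder_scal. apply Cder_wpt_t.
  apply Cder_inv. apply Cder_omc_t. auto.
  cbv beta. generalize (Cexp (- RtoC L * wpt a t)). intros. field. auto.
Qed.

Lemma Cder_kern1_a L a t : 0 < a < 2 -> Cder (fun a => kern1 L a t) a (kern2 L a t).
Proof.
  intros Ha. assert (N := omc_neq_0 a t Ha). unfold kern1, kern2. eapply Cder_eq.
  apply Cder_mult. apply Cder_exp. apply Cder_scal. apply Cder_wpt_a.
  apply Cder_minus. apply Cder_scal. apply Cder_inv. apply Cder_omc_a. auto.
  apply Cder_mult. apply Cder_scal. apply Cder_sin_pi_a.
  apply Cder_inv. apply Cder_mult; apply Cder_omc_a. apply Cmult_neq_0; auto.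
  cbv beta. generalize (Cexp (- RtoC L * wpt a t)). intros e.
  assert (S := sin_pi_sq a t). revert S N. generalize (sin_pi a t) (one_minus_cos a t). intros s d S N.
  replace (RtoC PI * RtoC PI * (3 - d) * / (d * d))%C
    with (RtoC PI * RtoC PI * (2 * (s * s) - d * (1 - d)) * / (d * d * d))%C
    by (rewrite S; field; auto).
  field. auto.
Qed.

Lemma kern1_cont L a t : 0 < a < 2 -> Ccont (fun t => kern1 L a t) t.
Proof.
  intros Ha. assert (N := omc_neq_0 a t Ha). unfold kern1. eapply Cder_cont.
  apply Cder_mult. apply Cder_exp. apply Cder_scal. apply Cder_wpt_t.
  apply Cder_minus. apply Cder_scal. apply Cder_inv. apply Cder_omc_t. auto.
  apply Cder_mult. apply Cder_scal. apply Cder_sin_pi_t.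
  apply Cder_inv. apply Cder_mult; apply Cder_omc_t. apply Cmult_neq_0; auto.
Qed.

(** A quadratic remainder survives integration and pointwise limits, so this criterion
    differentiates functions defined by an integral or as a limit of a sequence. *)
Lemma is_derive_of_quadratic_bound (g : R -> R) (x l d K : R) : 0 < d -> 
  (forall y, Rabs (y - x) < d -> Rabs (g y - g x - l * (y - x)) <= K * (y - x) ^ 2) ->
  is_derive g x l.
Proof.
  intros Hd HK. apply is_derive_Reals. intros eps Heps.
  assert (K1 : 0 < Rabs K + 1) by (assert (H := Rabs_pos K); lra).
  assert (P : 0 < Rmin d (eps / (Rabs K + 1))).
  { apply Rmin_pos; auto. apply Rdiv_lt_0_compat; auto. }
  exists (mkposreal _ P). cbn. intros h h0 Hh.
  assert (h1 : Rabs h < d) by (eapply Rlt_le_trans; [apply Hh | apply Rmin_l]).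
  assert (h2 : Rabs h < eps / (Rabs K + 1)) by (eapply Rlt_le_trans; [apply Hh | apply Rmin_r]).
  assert (B := HK (x + h)). replace (x + h - x) with h in B by ring. specialize (B h1).
  replace ((g (x + h) - g x) / h - l) with ((g (x + h) - g x - l * h) / h) by (field; auto).
  assert (Ah := Rabs_pos_lt h h0).
  unfold Rdiv. rewrite Rabs_mult, Rabs_inv.
  apply (Rmult_lt_reg_r (Rabs h)); auto.
  rewrite Rmult_assoc, Rinv_l, Rmult_1_r by lra.
  eapply Rle_lt_trans. apply B. rewrite <- (pow2_abs h).
  apply Rle_lt_trans with ((Rabs K + 1) * Rabs h * Rabs h).
  { assert (J := Rle_abs K). nra. }
  apply Rmult_lt_compat_r; auto.
  apply (Rmult_lt_reg_r (/ (Rabs K + 1))). apply Rinv_0_lt_compat; auto.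
  replace ((Rabs K + 1) * Rabs h * / (Rabs K + 1)) with (Rabs h) by (field; lra). auto.
Qed.

(** A quadratic modulus of continuity forces a zero derivative in the interior. *)
Lemma quadratic_bound_constant (g : R -> C) (p q K : R) :
  (forall x y, p <= x <= q -> p <= y <= q -> Cmod (g y - g x)%C <= K * (y - x) ^ 2) ->
  forall x y, p < x -> x <= y -> y < q -> g x = g y.
Proof.
  intros HK x y px xy yq.
  assert (D : forall (r : C -> R), (forall z, Rabs (r z) <= Cmod z) ->
    (forall z w, r (z - w)%C = r z - r w) -> r (g x) = r (g y)).
  { intros r Hr Hm.
    assert (E : Rabs (r (g y) - r (g x)) <= 0 * (y - x)).
    { apply (mvt_abs_le (fun t => r (g t)) (fun _ => 0)); auto.
      2: intros; rewrite Rabs_R0; lra.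
      intros t Ht. apply is_derive_of_quadratic_bound with (d := Rmin (t - p) (q - t)) (K := K).
      - apply Rmin_pos; lra.
      - intros s Hs. rewrite Rmult_0_l, Rminus_0_r, <- Hm. eapply Rle_trans; [apply Hr |].
        assert (s1 := Rlt_le_trans _ _ _ Hs (Rmin_l _ _)).
        assert (s2 := Rlt_le_trans _ _ _ Hs (Rmin_r _ _)).
        apply Rabs_def2 in s1. apply Rabs_def2 in s2. apply HK; lra. }
    rewrite Rmult_0_l in E. assert (Z := Rabs_pos (r (g y) - r (g x))).
    assert (Rabs (r (g y) - r (g x)) = 0) by lra.
    apply Rabs_eq_0 in H. lra. }
  apply C_eq.
  - apply (D Re). apply Re_le_Cmod. intros; cbn; unfold Re; ring.
  - apply (D Im). apply Im_le_Cmod. intros; cbn; unfold Im; ring.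
Qed.

Lemma Cmod_Cexp_lin L a t : Cmod (Cexp (- RtoC L * wpt a t)) = exp (- L * a).
Proof. rewrite Cmod_Cexp, wpt_eq. f_equal. cbn. ring. Qed.

Lemma Cmod_minus_le z w : Cmod (z - w)%C <= Cmod z + Cmod w.
Proof. eapply Rle_trans. apply Cmod_triangle. rewrite Cmod_opp. lra. Qed.

Ltac pos := repeat first [assumption | lra | apply pow2_ge_0 | apply Rplus_le_le_0_compat | apply Rmult_le_pos].

Lemma kern_bounds L p q : 0 < p -> p <= q -> q < 2 ->
  exists M, forall a t, p <= a <= q ->
    Cmod (kern L a t) <= M / (1 + t ^ 2) /\
    Cmod (kern1 L a t) <= M / (1 + t ^ 2) /\
    Cmod (kern2 L a t) <= M / (1 + t ^ 2).
Proof.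
  intros Hp pq Hq. destruct (cos_PI_bound p q Hp pq Hq) as (rho & Hrho & Hcos).
  set (k := / (1 - rho)).
  assert (k1 : 1 <= k).
  { unfold k. rewrite <- Rinv_1 at 1. apply Rinv_le_contravar; lra. }
  (* A adds the coefficients of [/ ch] that occur in the bounds of the three functions, so that one
     constant serves for all. In the witness, exp (2 |L|) bounds e^(-La) for 0 < a < 2, and 256
     comes from [inv_cosh_le1]. *)
  set (A := Rabs L ^ 2 * k + Rabs L * k + 4 * PI * Rabs L * k ^ 2 + 2 * PI * k ^ 2 + 3 * PI ^ 2 * k ^ 2 + PI ^ 2 * k + k).
  exists (exp (Rabs L * 2) * A * 256). intros a t Ha.
  assert (PP := PI_RGT_0). assert (L0 := Rabs_pos L).
  assert (N := omc_neq_0 a t ltac:(lra)).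
  assert (B := omc_lower rho a t ltac:(lra) (Hcos a Ha)).
  assert (C1 := cosh_ge_1 (PI * t)).
  assert (S := Cmod_sin_pi a t).
  set (d := one_minus_cos a t) in *. set (s := sin_pi a t) in *. set (ch := cosh (PI * t)) in *.
  assert (I : Cmod (/ d)%C <= k * / ch).
  { rewrite Cmod_inv by auto. unfold k. rewrite <- Rinv_mult. apply Rinv_le_contravar; auto.
    apply Rmult_lt_0_compat; lra. }
  assert (I0 : 0 <= Cmod (/ d)%C) by apply Cmod_ge_0.
  assert (Nd : (d * d)%C <> 0%C) by (apply Cmult_neq_0; auto).
  assert (I2 : Cmod (/ (d * d))%C = Cmod (/ d)%C * Cmod (/ d)%C).
  { rewrite !Cmod_inv, Cmod_mult, Rinv_mult; auto. }
  assert (ci : 0 < / ch) by (apply Rinv_0_lt_compat; lra).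
  assert (ci1 : / ch <= 1) by (rewrite <- Rinv_1; apply Rinv_le_contravar; lra).
  assert (I3 : Cmod (/ (d * d))%C <= k ^ 2 * / ch * / ch) by (rewrite I2; nra).
  assert (I4 : Cmod (/ (d * d))%C <= k ^ 2 * / ch).
  { eapply Rle_trans. apply I3. rewrite <- (Rmult_1_r (k ^ 2 * / ch)) at 2. apply Rmult_le_compat_l; auto. nra. }
  assert (I5 : Cmod (s * / (d * d))%C <= 2 * k ^ 2 * / ch).
  { rewrite Cmod_mult. eapply Rle_trans.
    apply Rmult_le_compat; [apply Cmod_ge_0 | apply Cmod_ge_0 | apply S | apply I3].
    replace (2 * ch * (k ^ 2 * / ch * / ch)) with (2 * k ^ 2 * / ch) by (field; lra). lra. }
  assert (I6 : Cmod (d * / (d * d))%C <= k * / ch).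
  { replace (d * / (d * d))%C with (/ d)%C by (field; auto). auto. }
  assert (e1 : exp (- L * a) <= exp (Rabs L * 2)).
  { assert (T := Rle_abs (- L)). rewrite Rabs_Ropp in T.
    assert (X : - L * a <= Rabs L * 2) by nra. destruct X as [X | ->]; [left; apply exp_increasing; auto | lra]. }
  assert (e0 := exp_pos (- L * a)).
  assert (k0 : 0 < k) by lra.
  assert (X1 : 0 <= k ^ 2) by nra.
  assert (F : forall X, Cmod X <= A * / ch -> Cmod (Cexp (- RtoC L * wpt a t) * X)%C <= exp (Rabs L * 2) * A * 256 / (1 + t ^ 2)).
  { intros X HX. rewrite Cmod_mult, Cmod_Cexp_lin.
    assert (A0 : 0 <= A).
    { unfold A. pos. }
    apply Rle_trans with (exp (Rabs L * 2) * (A * / ch)).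
    - apply Rmult_le_compat; try lra. apply Cmod_ge_0.
    - unfold Rdiv. rewrite !Rmult_assoc. apply Rmult_le_compat_l. left; apply exp_pos.
      apply Rmult_le_compat_l; auto. apply inv_cosh_le1. }
  assert (a2 : forall z w, Cmod (z + w)%C <= Cmod z + Cmod w) by apply Cmod_triangle.
  assert (cL : Cmod (RtoC L) = Rabs L) by apply Cmod_R.
  assert (cP : Cmod (RtoC PI) = PI) by (rewrite Cmod_R; apply Rabs_pos_eq; lra).
  assert (M1 : forall x y z, 0 <= z -> x <= y -> z * x <= z * y) by (intros; apply Rmult_le_compat_l; auto).
  split; [| split]; apply F; fold d s.
  - eapply Rle_trans; [apply I |]. apply Rmult_le_compat_r; [lra |]. unfold A.
    assert (0 <= Rabs L ^ 2 * k + Rabs L * k + 4 * PI * Rabs L * k ^ 2 + 2 * PI * k ^ 2 + 3 * PI ^ 2 * k ^ 2 + PI ^ 2 * k) by pos. lra.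
  - eapply Rle_trans; [apply Cmod_minus_le |].
    replace (RtoC PI * s * / (d * d))%C with (RtoC PI * (s * / (d * d)))%C by ring.
    rewrite (Cmod_mult (RtoC PI)), (Cmod_mult (- RtoC L)), Cmod_opp, cL, cP.
    assert (H1 := M1 _ _ _ L0 I). assert (H2 := M1 _ _ PI (Rlt_le _ _ PP) I5).
    apply Rle_trans with ((Rabs L * k + 2 * PI * k ^ 2) * / ch). lra.
    apply Rmult_le_compat_r; [lra |]. unfold A.
    assert (0 <= Rabs L ^ 2 * k + 4 * PI * Rabs L * k ^ 2 + 3 * PI ^ 2 * k ^ 2 + PI ^ 2 * k + k) by pos. lra.
  - eapply Rle_trans; [apply a2 |]. eapply Rle_trans; [apply Rplus_le_compat_r; apply a2 |].
    replace (RtoC PI * RtoC PI * (3 - d) * / (d * d))%C with (RtoC PI * RtoC PI * (RtoC 3 * / (d * d) - d * / (d * d)))%C by (cbn; ring).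
    replace (2 * RtoC L * RtoC PI * s * / (d * d))%C with (RtoC 2 * RtoC L * RtoC PI * (s * / (d * d)))%C by ring.
    rewrite (Cmod_mult (RtoC L * RtoC L)), (Cmod_mult (RtoC 2 * RtoC L * RtoC PI)), (Cmod_mult (RtoC PI * RtoC PI)), !(Cmod_mult (RtoC _)), (Cmod_mult (RtoC 2 * RtoC L)), (Cmod_mult (RtoC 2)), cL, cP.
    rewrite (Cmod_R 2), (Rabs_pos_eq 2) by lra.
    assert (H3 : Cmod (RtoC 3 * / (d * d) - d * / (d * d))%C <= 3 * (k ^ 2 * / ch) + k * / ch).
    { eapply Rle_trans; [apply Cmod_minus_le |]. rewrite Cmod_mult, Cmod_R, (Rabs_pos_eq 3) by lra. lra. }
    assert (H1 := M1 _ _ (Rabs L * Rabs L) ltac:(nra) I).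
    assert (H2 := M1 _ _ (2 * Rabs L * PI) ltac:(nra) I5).
    assert (H4 := M1 _ _ (PI * PI) ltac:(nra) H3).
    apply Rle_trans with ((Rabs L ^ 2 * k + 4 * PI * Rabs L * k ^ 2 + 3 * PI ^ 2 * k ^ 2 + PI ^ 2 * k) * / ch). lra.
    apply Rmult_le_compat_r; [lra |]. unfold A.
    assert (0 <= Rabs L * k + 2 * PI * k ^ 2 + k) by pos. lra.
Qed.

Lemma kern_tame L a : 0 < a < 2 -> Ctame (fun t => kern L a t).
Proof.
  intros Ha. destruct (kern_bounds L a a) as [M HM]; try lra.
  apply Ctame_intro with M.
  - intros t. eapply Cder_cont. apply Cder_kern_t; auto.
  - intros t. apply HM; lra.
Qed.

Lemma kern1_tame L a : 0 < a < 2 -> Ctame (fun t => kern1 L a t).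
Proof.
  intros Ha. destruct (kern_bounds L a a) as [M HM]; try lra.
  apply Ctame_intro with M.
  - intros t. apply kern1_cont; auto.
  - intros t. apply HM; lra.
Qed.

(** By the Cauchy-Riemann equations i [kern1] is the t-derivative of [kern], which vanishes at both
    ends of the line. *)
Lemma kern1_int L a : 0 < a < 2 -> Cline_int (fun t => kern1 L a t) = 0%C.
Proof.
  intros Ha. destruct (kern_bounds L a a) as [M HM]; try lra.
  assert (T := kern1_tame L a Ha).
  assert (T' := Ctame_scal Ci _ T).
  assert (E : Cline_int (fun t => Ci * kern1 L a t)%C = 0%C).
  { apply C_eq; cbn [Cline_int Re Im fst snd RtoC].
    - apply line_int_of_derivative with (g := fun t => Re (kern L a t)) (M := M).
      + intros t. eapply Rle_trans; [apply Re_le_Cmod |]. apply HM; lra.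
      + intros t. apply (Cder_kern_t L a t Ha).
      + apply T'.
    - apply line_int_of_derivative with (g := fun t => Im (kern L a t)) (M := M).
      + intros t. eapply Rle_trans; [apply Im_le_Cmod |]. apply HM; lra.
      + intros t. apply (Cder_kern_t L a t Ha).
      + apply T'. }
  rewrite Cline_int_scal in E by auto.
  assert (E2 : forall z, z = (- Ci * (Ci * z))%C) by (intros; apply C_eq; cbn; unfold Re, Im; ring).
  rewrite (E2 (Cline_int _)). transitivity (- Ci * 0)%C; [f_equal; exact E | ring].
Qed.

(* Cauchy's theorem on the strip 0 < Re w < 2: the derivative of the integral
   with respect to the abscissa is the integral of a t-derivative. *)
Lemma kern_int_constant L a b : 0 < a -> a <= b -> b < 2 ->
  Cline_int (fun t => kern L a t) = Cline_int (fun t => kern L b t).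
Proof.
  (* [p, q] is a larger interval inside the strip: [quadratic_bound_constant] gives equality only at
     interior points, and a and b must be interior. *)
  intros Ha ab Hb. set (p := a / 2). set (q := (b + 2) / 2).
  destruct (kern_bounds L p q) as [M HM]; try (unfold p, q; lra).
  apply (quadratic_bound_constant (fun x => Cline_int (fun t => kern L x t)) p q (2 * PI * (4 * M)));
    try (unfold p, q; lra).
  intros x y Hx Hy.
  assert (Hx2 : 0 < x < 2) by (unfold p, q in *; lra).
  assert (Hy2 : 0 < y < 2) by (unfold p, q in *; lra).
  assert (Tx := kern_tame L x Hx2). assert (Ty := kern_tame L y Hy2). assert (T1 := kern1_tame L x Hx2).
  assert (T1' := Ctame_scal (RtoC (y - x)) _ T1). assert (Td := Ctame_minus _ _ Ty Tx).
  assert (T := Ctame_minus _ _ Td T1').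
  (* As the integral of [kern1] is 0, a linear term can be inserted, which turns the difference of
     integrals into the integral of a Taylor remainder. *)
  replace (Cline_int (fun t => kern L y t) - Cline_int (fun t => kern L x t))%C
    with (Cline_int (fun t => kern L y t - kern L x t - RtoC (y - x) * kern1 L x t)%C).
  2: { rewrite (Cline_int_minus _ _ Td T1'), (Cline_int_minus _ _ Ty Tx), (Cline_int_scal _ _ T1).
       rewrite (kern1_int L x Hx2). ring. }
  replace (2 * PI * (4 * M) * (y - x) ^ 2) with (2 * PI * (4 * M * (y - x) ^ 2)) by ring.
  apply Cline_int_le; auto. intros t.
  replace (4 * M * (y - x) ^ 2 / (1 + t ^ 2)) with (4 * (M / (1 + t ^ 2)) * (y - x) ^ 2).
  2: { field. apply Rgt_not_eq, one_sq_pos. }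
  apply (Cder_taylor (fun a => kern L a t) (fun a => kern1 L a t) (fun a => kern2 L a t) p q); auto.
  - unfold p, q; lra.
  - intros z Hz. apply Cder_kern_a. unfold p, q in *; lra.
  - intros z Hz. apply Cder_kern1_a. unfold p, q in *; lra.
  - intros z Hz. apply HM; auto.
Qed.

Lemma kern_conj L a t : kern L a (- t) = Cconj (kern L a t).
Proof.
  unfold kern. rewrite !wpt_eq. unfold one_minus_cos.
  replace (PI * - t) with (- (PI * t)) by ring. rewrite sinh_opp, cosh_opp.
  assert (E : Cexp (- RtoC L * (a, - t)) = Cconj (Cexp (- RtoC L * (a, t)))).
  { apply C_eq; unfold Cexp; cbn.
    - replace (- L * - t + - 0 * a) with (- (- L * t + - 0 * a)) by ring. rewrite cos_neg, sin_neg.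
      replace (- L * a - - 0 * - t) with (- L * a - - 0 * t) by ring. ring.
    - replace (- L * - t + - 0 * a) with (- (- L * t + - 0 * a)) by ring. rewrite cos_neg, sin_neg.
      replace (- L * a - - 0 * - t) with (- L * a - - 0 * t) by ring. ring. }
  rewrite E. generalize (Cexp (- RtoC L * (a, t))). intros z.
  apply C_eq; unfold Cconj; cbn; unfold Rdiv; rewrite ?Rmult_1_r.
  - replace (sin (PI * a) * - sinh (PI * t) * (sin (PI * a) * - sinh (PI * t))) with (sin (PI * a) * sinh (PI * t) * (sin (PI * a) * sinh (PI * t))) by ring. ring.
  - replace (sin (PI * a) * - sinh (PI * t) * (sin (PI * a) * - sinh (PI * t))) with (sin (PI * a) * sinh (PI * t) * (sin (PI * a) * sinh (PI * t))) by ring. ring.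
Qed.

Lemma kern_int_real L a : 0 < a < 2 -> Im (Cline_int (fun t => kern L a t)) = 0.
Proof.
  intros Ha. apply line_int_odd. apply (kern_tame L a Ha).
  intros t. rewrite kern_conj. reflexivity.
Qed.

(** The point 2 - a + it is 2 minus the conjugate a - it. Periodicity and evenness of the cosine
    leave the denominator at a - it, and e^(-Lw) becomes e^(-2L) e^(L(a - it)). Together with the
    independence of the abscissa, this relates the transforms at L and at -L. *)
Lemma kern_reflect L a t : kern L (2 - a) t = (RtoC (exp (- 2 * L)) * Cconj (kern (- L) a t))%C.
Proof.
  rewrite <- kern_conj. unfold kern. rewrite !wpt_eq, <- Cexp_RtoC.
  replace (one_minus_cos (2 - a) t) with (one_minus_cos a (- t)).
  2: { unfold one_minus_cos. replace (PI * - t) with (- (PI * t)) by ring.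
       rewrite sinh_opp, cosh_opp. replace (PI * (2 - a)) with (- (PI * a) + 2 * PI) by ring.
       rewrite cos_plus, sin_plus, cos_2PI, sin_2PI, cos_neg, sin_neg. f_equal; ring. }
  rewrite Cmult_assoc, <- Cexp_add. f_equal. f_equal. apply C_eq; cbn; ring.
Qed.

Lemma kern_int_reflect L a : 0 < a < 2 ->
  Re (Cline_int (fun t => kern L (2 - a) t)) = exp (- 2 * L) * Re (Cline_int (fun t => kern (- L) a t)).
Proof.
  intros Ha. cbn [Cline_int Re fst]. rewrite <- line_int_scal by apply (kern_tame (- L) a Ha).
  apply line_int_ext. intros t. rewrite kern_reflect. generalize (kern (- L) a t). intros. cbn. unfold Re. ring.
Qed.

Lemma Cder_tau z x : Cder (fun t => Cexp (RtoC t * z)) x (z * Cexp (RtoC x * z))%C.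
Proof.
  eapply Cder_eq. apply Cder_exp. apply Cder_mult. apply Cder_RtoC. apply is_derive_id. apply Cder_const.
  unfold one; cbn. f_equal. change (1 * z + RtoC x * 0 = z)%C. ring.
Qed.

(** The successive remainders are integrated along the segment from 0 to z. Each use of [Cder_mvt]
    contributes a factor 2, hence the constants 2, 4 and 8. *)
Lemma Cexp_taylor z R0 : Cmod z <= R0 ->
  Cmod (Cexp z - 1 - z)%C <= 4 * exp R0 * Cmod z ^ 2 /\
  Cmod (Cexp z - 1 - z - z * z / 2)%C <= 8 * exp R0 * Cmod z ^ 3.
Proof.
  intros Hz. set (r := Cmod z) in *. assert (r0 : 0 <= r) by apply Cmod_ge_0.
  assert (e0 := exp_pos R0).
  assert (B0 : forall x, 0 <= x <= 1 -> Cmod (Cexp (RtoC x * z)) <= exp R0).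
  { intros x Hx. rewrite Cmod_Cexp.
    assert (X : Re (RtoC x * z)%C <= R0).
    { eapply Rle_trans. apply Rle_abs. eapply Rle_trans. apply Re_le_Cmod.
      rewrite Cmod_mult, Cmod_R, Rabs_pos_eq by lra. fold r. nra. }
    destruct X as [X | ->]; [left; apply exp_increasing; auto | lra]. }
  assert (z0 : Cexp (RtoC 0 * z) = 1%C) by (rewrite Cmult_0_l; apply Cexp_0).
  assert (B1 : forall x, 0 <= x <= 1 -> Cmod (Cexp (RtoC x * z) - 1)%C <= 2 * r * exp R0).
  { intros x Hx. rewrite <- z0 at 1.
    eapply Rle_trans. apply (Cder_mvt (fun t => Cexp (RtoC t * z)) (fun t => z * Cexp (RtoC t * z))%C 0 x (r * exp R0)).
    lra. intros; apply Cder_tau.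
    intros t Ht. rewrite Cmod_mult. apply Rmult_le_compat_l; auto. apply B0; lra.
    assert (0 <= r * exp R0) by nra. nra. }
  assert (D1 : forall x, Cder (fun t => Cexp (RtoC t * z) - 1 - RtoC t * z)%C x (z * (Cexp (RtoC x * z) - 1))%C).
  { intros x. eapply Cder_eq. apply Cder_minus. apply Cder_minus. apply Cder_tau. apply Cder_const.
    apply Cder_mult. apply Cder_RtoC. apply is_derive_id. apply Cder_const.
    unfold one; cbn. change (z * Cexp (RtoC x * z) - 0 - (1 * z + RtoC x * 0) = z * (Cexp (RtoC x * z) - 1))%C. ring. }
  assert (B2 : forall x, 0 <= x <= 1 -> Cmod (Cexp (RtoC x * z) - 1 - RtoC x * z)%C <= 4 * r ^ 2 * exp R0).
  { intros x Hx.
    replace (Cexp (RtoC x * z) - 1 - RtoC x * z)%C with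
      ((Cexp (RtoC x * z) - 1 - RtoC x * z) - (Cexp (RtoC 0 * z) - 1 - RtoC 0 * z))%C by (rewrite z0; ring).
    eapply Rle_trans. apply (Cder_mvt (fun t => Cexp (RtoC t * z) - 1 - RtoC t * z)%C (fun t => z * (Cexp (RtoC t * z) - 1))%C 0 x (r * (2 * r * exp R0))).
    lra. intros; apply D1.
    intros t Ht. rewrite Cmod_mult. apply Rmult_le_compat_l; auto. apply B1; lra.
    assert (0 <= r * (2 * r * exp R0)) by pos. nra. }
  assert (D2 : forall x, Cder (fun t => Cexp (RtoC t * z) - 1 - RtoC t * z - RtoC t * RtoC t * z * z / 2)%C x (z * (Cexp (RtoC x * z) - 1 - RtoC x * z))%C).
  { intros x. eapply Cder_eq. apply Cder_minus. apply D1. unfold Cdiv.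
    apply Cder_mult. apply Cder_mult. apply Cder_mult. apply Cder_mult.
    apply Cder_RtoC, is_derive_id. apply Cder_RtoC, is_derive_id. apply Cder_const. apply Cder_const. apply Cder_const.
    cbv beta. change (RtoC one) with (RtoC 1). field. }
  split.
  - assert (H := B2 1 ltac:(lra)). rewrite !Cmult_1_l in H. lra.
  - replace (Cexp z - 1 - z - z * z / 2)%C with
      ((Cexp (RtoC 1 * z) - 1 - RtoC 1 * z - RtoC 1 * RtoC 1 * z * z / 2)
       - (Cexp (RtoC 0 * z) - 1 - RtoC 0 * z - RtoC 0 * RtoC 0 * z * z / 2))%C
      by (rewrite z0, !Cmult_1_l; field).
    eapply Rle_trans. apply (Cder_mvt (fun t => Cexp (RtoC t * z) - 1 - RtoC t * z - RtoC t * RtoC t * z * z / 2)%C (fun t => z * (Cexp (RtoC t * z) - 1 - RtoC t * z))%C 0 1 (r * (4 * r ^ 2 * exp R0))).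
    lra. intros; apply D2.
    intros t Ht. rewrite Cmod_mult. apply Rmult_le_compat_l; auto.
    right; ring.
Qed.

Lemma omc_Cexp a t : one_minus_cos a t =
  (1 - (Cexp (Ci * RtoC PI * wpt a t) + Cexp (- (Ci * RtoC PI * wpt a t))) / 2)%C.
Proof.
  rewrite wpt_eq. unfold one_minus_cos.
  replace (Ci * RtoC PI * (a, t))%C with ((- (PI * t), PI * a) : C) by (apply C_eq; cbn; ring).
  apply C_eq; unfold Cexp, cosh, sinh; cbn; rewrite ?Ropp_involutive, ?cos_neg, ?sin_neg; field.
Qed.

(** This is -2 sinh (L w). Its zero at 0 lowers the double pole of 1/(1 - cos (pi w)) to a simple
    one. *)
Definition sh_pair (L : R) (w : C) : C := (Cexp (- RtoC L * w) - Cexp (RtoC L * w))%C.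

(* The pole of sh_pair / (1 - cos (pi w)) at 0 is simple with residue -4L/pi^2. *)
Lemma residue_bound L : exists r0 K, 0 < r0 <= 1 /\ 0 <= K /\
  forall a t, wpt a t <> 0%C -> Cmod (wpt a t) <= r0 ->
  Cmod (sh_pair L (wpt a t) * / one_minus_cos a t + RtoC (4 * L / PI ^ 2) * / wpt a t)%C <= K.
Proof.
  assert (PP := PI_RGT_0). assert (P3 := PI_gt_3).
  set (K1 := 8 * exp PI * PI ^ 3).
  set (K2 := 8 * exp (Rabs L) * Rabs L ^ 2).
  assert (K10 : 0 < K1).
  { unfold K1. apply Rmult_lt_0_compat. assert (E := exp_pos PI); lra. apply pow_lt; auto. }
  assert (K20 : 0 <= K2).
  { unfold K2. apply Rmult_le_pos. assert (E := exp_pos (Rabs L)); lra. apply pow2_ge_0. }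
  exists (Rmin 1 (/ K1)), (PI ^ 2 * K2 + 4 * Rabs L * K1).
  assert (r1 : 0 < Rmin 1 (/ K1)) by (apply Rmin_pos; [lra | apply Rinv_0_lt_compat; auto]).
  split. split; auto. apply Rmin_l.
  split. { assert (0 <= Rabs L) by apply Rabs_pos. pos. }
  intros a t Hw Hr. set (w := wpt a t) in *. set (d := one_minus_cos a t).
  assert (h1 : Cmod w <= 1) by (eapply Rle_trans; [apply Hr | apply Rmin_l]).
  assert (h2 : Cmod w <= / K1) by (eapply Rle_trans; [apply Hr | apply Rmin_r]).
  assert (w0 : 0 < Cmod w) by (apply Cmod_gt_0; auto).
  assert (cP : Cmod (RtoC PI) = PI) by (rewrite Cmod_R; apply Rabs_pos_eq; lra).
  assert (T1 : Cmod (d - RtoC PI * RtoC PI * w * w / 2)%C <= K1 * Cmod w ^ 3).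
  { set (z := (Ci * RtoC PI * w)%C).
    assert (Hz : Cmod z = PI * Cmod w) by (unfold z; rewrite !Cmod_mult, Cmod_Ci, cP; ring).
    destruct (Cexp_taylor z PI) as [_ A1]. rewrite Hz; nra.
    destruct (Cexp_taylor (- z) PI) as [_ A2]. rewrite Cmod_opp, Hz; nra.
    rewrite Cmod_opp in A2. rewrite Hz in A1, A2.
    replace (d - RtoC PI * RtoC PI * w * w / 2)%C with
     (RtoC (- / 2) * ((Cexp z - 1 - z - z * z / 2) + (Cexp (- z) - 1 - - z - - z * - z / 2)))%C.
    2: { unfold d. rewrite omc_Cexp. fold w. fold z.
         replace (RtoC PI * RtoC PI * w * w)%C with (- (z * z))%C.
         rewrite RtoC_opp, RtoC_inv by lra. field.
         unfold z. transitivity (- (Ci * Ci) * (RtoC PI * RtoC PI * w * w))%C. ring.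
         replace (Ci * Ci)%C with (- (1))%C by (apply C_eq; cbn; ring). ring. }
    rewrite Cmod_mult, Cmod_R, Rabs_Ropp, Rabs_pos_eq by lra.
    eapply Rle_trans. apply Rmult_le_compat_l. lra. apply Cmod_triangle.
    unfold K1. replace (8 * exp PI * PI ^ 3 * Cmod w ^ 3) with (/ 2 * (8 * exp PI * (PI * Cmod w) ^ 3 + 8 * exp PI * (PI * Cmod w) ^ 3)) by field. lra. }
  assert (T2 : Cmod (sh_pair L w + 2 * RtoC L * w)%C <= K2 * Cmod w ^ 2).
  { set (z := (RtoC L * w)%C).
    assert (L0 := Rabs_pos L).
    assert (Hz : Cmod z = Rabs L * Cmod w) by (unfold z; rewrite Cmod_mult, Cmod_R; ring).
    destruct (Cexp_taylor z (Rabs L)) as [A1 _]. rewrite Hz; nra.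
    destruct (Cexp_taylor (- z) (Rabs L)) as [A2 _]. rewrite Cmod_opp, Hz; nra.
    rewrite Cmod_opp in A2. rewrite Hz in A1, A2.
    replace (sh_pair L w + 2 * RtoC L * w)%C with ((Cexp (- z) - 1 - - z) - (Cexp z - 1 - z))%C.
    2: { unfold sh_pair. fold z. replace (- RtoC L * w)%C with (- z)%C by (unfold z; ring). unfold z; ring. }
    eapply Rle_trans. apply Cmod_minus_le.
    unfold K2. replace (8 * exp (Rabs L) * Rabs L ^ 2 * Cmod w ^ 2) with (4 * exp (Rabs L) * (Rabs L * Cmod w) ^ 2 + 4 * exp (Rabs L) * (Rabs L * Cmod w) ^ 2) by ring. lra. }
  (* The radius is at most 1/[K1], so the cubic remainder is at most |w|^2, while the main term
     exceeds 4 |w|^2 because pi > 3. This is where the denominator is bounded below. *)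
  assert (T3 : Cmod w ^ 2 <= Cmod d).
  { assert (X : Cmod (RtoC PI * RtoC PI * w * w / 2)%C <= Cmod d + K1 * Cmod w ^ 3).
    { replace (RtoC PI * RtoC PI * w * w / 2)%C with (d - (d - RtoC PI * RtoC PI * w * w / 2))%C by ring.
      eapply Rle_trans. apply Cmod_minus_le. lra. }
    replace (RtoC PI * RtoC PI * w * w / 2)%C with (RtoC (PI * PI / 2) * (w * w))%C in X.
    2: { rewrite RtoC_div, RtoC_mult by lra. field. }
    rewrite Cmod_mult, Cmod_mult, Cmod_R, Rabs_pos_eq in X by nra.
    assert (K1 * Cmod w <= 1).
    { apply (Rmult_le_reg_l (/ K1)). apply Rinv_0_lt_compat; auto. rewrite <- Rmult_assoc, Rinv_l, Rmult_1_l, Rmult_1_r by lra. auto. }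
    assert (K1 * Cmod w ^ 3 <= 1 * Cmod w ^ 2) by (replace (K1 * Cmod w ^ 3) with (K1 * Cmod w * Cmod w ^ 2) by ring; apply Rmult_le_compat_r; nra).
    assert (9 * (Cmod w * Cmod w) <= PI * PI * (Cmod w * Cmod w)) by (apply Rmult_le_compat_r; nra).
    nra. }
  assert (w2 : 0 < Cmod w ^ 2) by nra.
  assert (Nd : d <> 0%C) by (intros E; rewrite E, Cmod_0 in T3; lra).
  assert (NP : RtoC PI <> 0%C) by (intros E; apply RtoC_inj in E; lra).
  replace (sh_pair L w * / d + RtoC (4 * L / PI ^ 2) * / w)%C with
    ((RtoC (PI ^ 2) * (w * (sh_pair L w + 2 * RtoC L * w)) + RtoC (4 * L) * (d - RtoC PI * RtoC PI * w * w / 2)) * / (RtoC (PI ^ 2) * (w * d)))%C.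
  2: { replace (PI ^ 2) with (PI * PI) by ring. rewrite RtoC_div, !RtoC_mult by nra. field. auto. }
  assert (Pd : 1 <= Cmod (RtoC (PI ^ 2)) ).
  { rewrite Cmod_R, Rabs_pos_eq; nra. }
  assert (Cw3 : 0 < Cmod w ^ 3) by (apply pow_lt; auto).
  assert (D : Cmod w ^ 3 <= Cmod (RtoC (PI ^ 2) * (w * d))%C).
  { rewrite !Cmod_mult. replace (Cmod w ^ 3) with (1 * (Cmod w * Cmod w ^ 2)) by ring.
    apply Rmult_le_compat; auto; try lra. nra. }
  rewrite Cmod_mult, Cmod_inv.
  2: { intros E. rewrite E, Cmod_0 in D. lra. }
  apply (Rmult_le_reg_r (Cmod (RtoC (PI ^ 2) * (w * d))%C)). lra.
  rewrite Rmult_assoc, Rinv_l, Rmult_1_r by lra.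
  apply Rle_trans with ((PI ^ 2 * K2 + 4 * Rabs L * K1) * Cmod w ^ 3).
  - eapply Rle_trans. apply Cmod_triangle.
    rewrite (Cmod_mult (RtoC (PI ^ 2))), (Cmod_mult w), (Cmod_mult (RtoC (4 * L))), !Cmod_R, Rabs_mult, (Rabs_pos_eq (PI ^ 2)), (Rabs_pos_eq 4) by nra.
    replace ((PI ^ 2 * K2 + 4 * Rabs L * K1) * Cmod w ^ 3) with (PI ^ 2 * (Cmod w * (K2 * Cmod w ^ 2)) + 4 * Rabs L * (K1 * Cmod w ^ 3)) by ring.
    apply Rplus_le_compat.
    + apply Rmult_le_compat_l. nra. apply Rmult_le_compat_l; lra.
    + apply Rmult_le_compat_l; auto. assert (0 <= Rabs L) by apply Rabs_pos. lra.
  - apply Rmult_le_compat_l; auto. assert (0 <= Rabs L) by apply Rabs_pos. pos.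
Qed.

Definition ures (L a t : R) : R := Re (sh_pair L (wpt a t) * / one_minus_cos a t)%C.

Lemma ures_kern L a t : ures L a t = Re (kern L a t) + (- 1) * Re (kern (- L) a t).
Proof.
  unfold ures, kern, sh_pair. rewrite !RtoC_opp. replace (- - RtoC L)%C with (RtoC L) by ring.
  generalize (Cexp (- RtoC L * wpt a t)) (Cexp (RtoC L * wpt a t)) (/ one_minus_cos a t)%C.
  intros. cbn. unfold Re. ring.
Qed.

Lemma ures_tame L a : 0 < a < 2 -> tame (ures L a).
Proof.
  intros Ha. apply tame_ext with (fun t => Re (kern L a t) + (- 1) * Re (kern (- L) a t)).
  intros; symmetry; apply ures_kern.
  apply tame_plus. apply (kern_tame L a Ha). apply tame_scal. apply (kern_tame (- L) a Ha).
Qed.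

Lemma ures_near L : exists r0 K, 0 < r0 <= 1 /\ 0 <= K /\
  forall a t, 0 < a -> Rabs a + Rabs t <= r0 ->
  Rabs (ures L a t + 4 * L / PI ^ 2 * (a / (a ^ 2 + t ^ 2))) <= K.
Proof.
  destruct (residue_bound L) as (r0 & K & Hr & HK & H). exists r0, K. repeat split; try apply Hr; auto.
  intros a t Ha Hat.
  assert (Nw : wpt a t <> 0%C) by (rewrite wpt_eq; intros E; injection E; lra).
  assert (X : Cmod (wpt a t) <= r0).
  { rewrite wpt_eq. eapply Rle_trans; [apply Cmod_le_Re_Im | exact Hat]. }
  specialize (H a t Nw X). eapply Rle_trans; [| apply H].
  eapply Rle_trans; [| apply Re_le_Cmod]. right. f_equal. unfold ures.
  rewrite Re_plus, (Re_mult (RtoC _)). f_equal. rewrite wpt_eq. cbn.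
  assert (PP := PI_RGT_0). field. split; nra.
Qed.

(** On the line a = 0 the quotient -2 sinh (L w) / (1 - cos (pi w)) is purely imaginary: the
    numerator is a multiple of i sin (L t) and the denominator is 1 - cosh (pi t). Away from the
    pole its real part is therefore O(a). *)
Lemma ures_far L delta : 0 < delta -> exists K, 0 <= K /\
  forall a t, 0 < a <= 1 -> delta <= Rabs t -> Rabs (ures L a t) <= K * a / (1 + t ^ 2).
Proof.
  intros Hd. assert (PP := PI_RGT_0).
  set (k := 1 - / cosh (PI * delta)).
  assert (Cd : 1 < cosh (PI * delta)).
  { assert (X := cosh_ge_sq (PI * delta)). assert (0 < PI * delta) by nra. nra. }
  assert (k0 : 0 < k).
  { unfold k. assert (/ cosh (PI * delta) < 1); [| lra]. rewrite <- Rinv_1. apply Rinv_lt_contravar; lra. }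
  assert (L0 := Rabs_pos L).
  set (M := 4 * Rabs L * cosh L + 2 * PI * cosh L).
  assert (cL := cosh_ge_1 L).
  assert (M0 : 0 <= M) by (unfold M; pos).
  assert (k2 : 0 < / k ^ 2) by (apply Rinv_0_lt_compat; nra).
  exists (M * / k ^ 2 * 256). split. pos.
  intros a t Ha Ht.
  set (ch := cosh (PI * t)). assert (C1 := cosh_ge_1 (PI * t)). fold ch in C1.
  assert (mono : forall x y, 0 <= x -> x <= y -> cosh x <= cosh y).
  { intros x y Hx xy.
    destruct (MVT_gen cosh x y sinh) as [c [Hc E]].
    - intros; auto_derive; auto. unfold sinh. field.
    - intros. apply continuity_pt_filterlim, (ex_derive_continuous (V := R_NormedModule)). auto_derive; auto.
    - rewrite Rmin_left, Rmax_right in Hc by lra.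
      assert (0 <= sinh c). { destruct (Req_dec c 0) as [-> | ?]. rewrite sinh_0; lra. unfold sinh. assert (exp (- c) < exp c) by (apply exp_increasing; lra). lra. }
      nra. }
  assert (chd : cosh (PI * delta) <= ch).
  { unfold ch. destruct (Rle_dec 0 t).
    - rewrite Rabs_pos_eq in Ht by lra. apply mono; nra.
    - rewrite Rabs_left in Ht by lra. rewrite <- (cosh_opp (PI * t)). apply mono; nra. }
  assert (Dl : k * ch <= ch - cos (PI * a)).
  { assert (X := COS_bound (PI * a)). unfold k.
    assert (1 <= / cosh (PI * delta) * ch).
    { apply (Rmult_le_reg_l (cosh (PI * delta))). lra. rewrite <- Rmult_assoc, Rinv_r by lra. lra. }
    lra. }
  assert (Hm := Cmod_omc a t). fold ch in Hm.
  (* N is the real part of the numerator times the conjugate denominator. Each of its two terms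
     contains a factor, sinh (L a) or sin (pi a), that vanishes with a. *)
  set (N := - 2 * sinh (L * a) * cos (L * t) * (1 - cos (PI * a) * ch) - 2 * cosh (L * a) * sin (L * t) * (sin (PI * a) * sinh (PI * t))).
  assert (E : ures L a t = N / (ch - cos (PI * a)) ^ 2).
  { unfold ures. rewrite <- Hm.
    assert (D0 : Cmod (one_minus_cos a t) ^ 2 <> 0).
    { apply pow_nonzero. rewrite Hm. assert (0 < k * ch) by nra. lra. }
    unfold Cmod in *. rewrite pow2_sqrt in * by nra.
    unfold sh_pair. rewrite wpt_eq. unfold N, ch, one_minus_cos, sinh, cosh in *. unfold Cexp. cbn in D0 |- *.
    replace (- L * a - - 0 * t) with (- (L * a)) by ring. replace (- L * t + - 0 * a) with (- (L * t)) by ring.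
    replace (L * a - 0 * t) with (L * a) by ring. replace (L * t + 0 * a) with (L * t) by ring.
    rewrite cos_neg, sin_neg. field.
    intros Z; apply D0. apply (Rmult_eq_reg_l 4); [rewrite Rmult_0_r, <- Z; field | lra]. }
  assert (sL : Rabs (sinh (L * a)) <= Rabs L * a * cosh L).
  { assert (X : Rabs (sinh (L * a) - sinh (L * 0)) <= (Rabs L * cosh L) * (a - 0)).
    { apply (mvt_abs_le (fun a => sinh (L * a)) (fun a => L * cosh (L * a))). lra.
      intros; auto_derive; auto. unfold cosh; field.
      intros x Hx. rewrite Rabs_mult. apply Rmult_le_compat_l; auto.
      rewrite Rabs_pos_eq by (assert (X := cosh_ge_1 (L * x)); lra).
      destruct (Rle_dec 0 L). apply mono; nra. rewrite <- (cosh_opp L), <- (cosh_opp (L * x)). apply mono; nra. }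
    rewrite Rmult_0_r, sinh_0, !Rminus_0_r in X. lra. }
  assert (cLa : cosh (L * a) <= cosh L).
  { destruct (Rle_dec 0 L). apply mono; nra. rewrite <- (cosh_opp L), <- (cosh_opp (L * a)). apply mono; nra. }
  assert (spa : Rabs (sin (PI * a)) <= PI * a).
  { assert (X : Rabs (sin (PI * a) - sin (PI * 0)) <= PI * (a - 0)).
    { apply (mvt_abs_le (fun a => sin (PI * a)) (fun a => PI * cos (PI * a))). lra.
      intros; auto_derive; auto; ring.
      intros x Hx. rewrite Rabs_mult, (Rabs_pos_eq PI) by lra. assert (X := COS_bound (PI * x)).
      assert (Rabs (cos (PI * x)) <= 1) by (apply Rabs_le; lra). nra. }
    rewrite Rmult_0_r, sin_0, !Rminus_0_r in X. auto. }
  assert (HN : Rabs N <= M * a * ch).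
  { unfold N. eapply Rle_trans. apply Rabs_triang. rewrite Rabs_Ropp, !Rabs_mult.
    rewrite (Rabs_left (-2)), (Rabs_pos_eq 2) by lra.
    assert (X1 := COS_bound (L * t)). assert (X2 := SIN_bound (L * t)). assert (X3 := COS_bound (PI * a)).
    assert (Y1 : Rabs (cos (L * t)) <= 1) by (apply Rabs_le; lra).
    assert (Y2 : Rabs (sin (L * t)) <= 1) by (apply Rabs_le; lra).
    assert (Y3 : Rabs (1 - cos (PI * a) * ch) <= 2 * ch) by (apply Rabs_le; split; nra).
    assert (Y4 := sinh_le_cosh (PI * t)). fold ch in Y4.
    assert (Y5 : Rabs (cosh (L * a)) <= cosh L) by (rewrite Rabs_pos_eq; auto; assert (X := cosh_ge_1 (L * a)); lra).
    unfold M. replace ((4 * Rabs L * cosh L + 2 * PI * cosh L) * a * ch) with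
      (2 * (Rabs L * a * cosh L) * 1 * (2 * ch) + 2 * cosh L * 1 * (PI * a * ch)) by ring.
    apply Rplus_le_compat; repeat (apply Rmult_le_compat; try apply Rabs_pos; try lra; auto); repeat apply Rmult_le_pos; try apply Rabs_pos; try lra. }
  rewrite E. unfold Rdiv. rewrite Rabs_mult, Rabs_inv, <- RPow_abs, (Rabs_pos_eq (ch - _)) by nra.
  apply Rle_trans with (M * a * ch * / (k * ch) ^ 2).
  - apply Rmult_le_compat; auto. apply Rabs_pos. left; apply Rinv_0_lt_compat, pow_lt. nra.
    apply Rinv_le_contravar. apply pow_lt; nra. apply pow_incr; split; nra.
  - replace (M * a * ch * / (k * ch) ^ 2) with (M * / k ^ 2 * a * / ch) by (field; lra).
    replace (M * / k ^ 2 * 256 * a * / (1 + t ^ 2)) with (M * / k ^ 2 * a * (256 / (1 + t ^ 2))) by (field; assert (X := one_sq_pos t); lra).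
    apply Rmult_le_compat_l. apply Rmult_le_pos; [pos | lra]. apply inv_cosh_le1.
Qed.

Lemma tame_split f a b n : tame f -> 
  RInt f (- n) n = RInt f (- n) a + RInt f a b + RInt f b n.
Proof.
  intros Hf.
  rewrite <- (RInt_Chasles (V := R_CompleteNormedModule) f (- n) a n) by (apply tame_ex_RInt; auto).
  rewrite <- (RInt_Chasles (V := R_CompleteNormedModule) f a b n) by (apply tame_ex_RInt; auto).
  unfold plus; cbn. ring.
Qed.

Lemma RInt_lorentz_le_loc f M a b : tame f -> a <= b ->
  (forall t, a <= t <= b -> Rabs (f t) <= M / (1 + t ^ 2)) -> 0 <= M ->
  Rabs (RInt f a b) <= M * PI.
Proof.
  intros Hf ab Hb M0.
  apply Rle_trans with (M * (atan b - atan a)).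
  2: { apply Rmult_le_compat_l; auto. assert (A := atan_bound a). assert (B := atan_bound b). lra. }
  apply (norm_RInt_le (V := R_NormedModule) f (fun t => M / (1 + t ^ 2)) a b _ _ ab).
  - intros; apply Hb; auto.
  - apply (RInt_correct (V := R_CompleteNormedModule)). apply tame_ex_RInt; auto.
  - evar_last.
    apply (is_RInt_derive (fun t => M * atan t)).
    + intros t _. assert (P := one_sq_pos t). auto_derive; auto. field. lra.
    + intros t _. apply (ex_derive_continuous (V := R_NormedModule)).
      assert (P := one_sq_pos t). auto_derive. simpl in P. lra.
    + unfold minus, plus, opp; cbn. ring.
Qed.

(* Independent of a by Cauchy's theorem: the value is the limit as a -> 0, where
   the integrand concentrates into the Poisson kernel a / (a^2 + t^2). *)
Lemma ures_int L a : 0 < a < 1 -> line_int (ures L a) = - (4 * L / PI).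
Proof.
  intros Ha.
  assert (Cst : forall e, 0 < e < 1 -> line_int (ures L e) = line_int (ures L a)).
  { intros e He.
    assert (X : forall e, 0 < e < 1 -> line_int (ures L e) = Re (Cline_int (fun t => kern L 1 t)) + (-1) * Re (Cline_int (fun t => kern (- L) 1 t))).
    { clear - Ha. intros e He. rewrite <- (kern_int_constant L e 1), <- (kern_int_constant (- L) e 1) by lra.
      cbn [Cline_int Re fst]. rewrite <- line_int_scal, <- line_int_plus.
      apply line_int_ext. intros t. apply ures_kern.
      apply (kern_tame L e); lra. apply tame_scal, (kern_tame (- L) e); lra. apply (kern_tame (- L) e); lra. }
    rewrite !X; auto. }
  set (U := line_int (ures L a)) in *.
  destruct (ures_near L) as (r0 & K0 & Hr & HK & Hnear).
  assert (PP := PI_RGT_0). assert (P3 := PI_gt_3).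
  (* The line is cut at -delta and delta. The outer pieces are O(e); on the middle one the integrand
     differs by at most [K0] from a multiple of the Poisson kernel, whose integral is 2 atan (delta
     / e). *)
  assert (Main : forall delta, 0 < delta <= r0 / 2 -> exists K1, 0 <= K1 /\
    forall e, 0 < e < 1 -> e <= r0 / 2 ->
    Rabs (U + 4 * L / PI ^ 2 * (2 * atan (delta / e))) <= 2 * delta * K0 + K1 * e).
  { intros delta Hdelta. destruct (ures_far L delta) as (K1 & HK1 & Hfar). lra.
    exists (2 * K1 * PI). split. pos. intros e He1 He2.
    rewrite <- (Cst e He1).
    assert (T := ures_tame L e ltac:(lra)).
    set (c := 4 * L / PI ^ 2).
    assert (Bd : forall n, Rabs (RInt (ures L e) (- INR (S n)) (INR (S n)) + c * (2 * atan (delta / e))) <= 2 * delta * K0 + 2 * K1 * PI * e).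
    { intros n. assert (N1 : 1 <= INR (S n)) by (rewrite S_INR; assert (X := pos_INR n); lra).
      rewrite (tame_split _ (- delta) delta) by auto.
      assert (B1 : Rabs (RInt (ures L e) (- INR (S n)) (- delta)) <= K1 * e * PI).
      { apply RInt_lorentz_le_loc; auto; try lra. intros t Ht. apply Hfar. lra. rewrite Rabs_left; lra. apply Rmult_le_pos; lra. }
      assert (B3 : Rabs (RInt (ures L e) delta (INR (S n))) <= K1 * e * PI).
      { apply RInt_lorentz_le_loc; auto; try lra. intros t Ht. apply Hfar. lra. rewrite Rabs_pos_eq; lra. apply Rmult_le_pos; lra. }
      assert (I2 : is_RInt (fun t => ures L e t + c * (e / (e ^ 2 + t ^ 2))) (- delta) delta
        (RInt (ures L e) (- delta) delta + c * (2 * atan (delta / e)))).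
      { apply (is_RInt_plus (V := R_NormedModule)).
        apply (RInt_correct (V := R_CompleteNormedModule)), tame_ex_RInt; auto.
        evar_last. apply (is_RInt_scal (V := R_NormedModule)).
        apply (is_RInt_derive (fun t => atan (t / e))).
        - intros t _. auto_derive; auto. field. split; nra.
        - intros t _. apply (ex_derive_continuous (V := R_NormedModule)). auto_derive. nra.
        - unfold minus, plus, opp, scal; cbn. unfold mult; cbn.
          replace (- delta / e) with (- (delta / e)) by (field; lra). rewrite atan_opp. ring. }
      assert (B2 : Rabs (RInt (ures L e) (- delta) delta + c * (2 * atan (delta / e))) <= 2 * delta * K0).
      { replace (2 * delta * K0) with ((delta - - delta) * K0) by ring.
        apply (norm_RInt_le_const (V := R_NormedModule)) with (3 := I2). lra.
        intros t Ht. apply Hnear. lra. rewrite (Rabs_pos_eq e) by lra.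
        assert (Rabs t <= delta) by (apply Rabs_le; lra). lra. }
      replace (RInt (ures L e) (- INR (S n)) (- delta) + RInt (ures L e) (- delta) delta + RInt (ures L e) delta (INR (S n)) + c * (2 * atan (delta / e)))
        with (RInt (ures L e) (- INR (S n)) (- delta) + (RInt (ures L e) (- delta) delta + c * (2 * atan (delta / e))) + RInt (ures L e) delta (INR (S n))) by ring.
      eapply Rle_trans. apply Rabs_triang. eapply Rle_trans. apply Rplus_le_compat_r. apply Rabs_triang. lra. }
    apply (is_lim_seq_le (fun n => Rabs (RInt (ures L e) (- INR (S n)) (INR (S n)) + c * (2 * atan (delta / e)))) (fun _ => 2 * delta * K0 + 2 * K1 * PI * e) (Rabs (line_int (ures L e) + c * (2 * atan (delta / e)))) (2 * delta * K0 + 2 * K1 * PI * e)); auto.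
    2: apply is_lim_seq_const.
    apply (is_lim_seq_abs _ (line_int (ures L e) + c * (2 * atan (delta / e)))).
    apply is_lim_seq_plus'; [| apply is_lim_seq_const].
    apply (is_lim_seq_incr_1 (fun n => RInt (ures L e) (- INR n) (INR n))). apply line_int_lim; auto. }
  (* The order of choice matters: delta is fixed first, to control the middle error, and e
     afterwards, because [K1] depends on delta. *)
  assert (Small : forall eta, 0 < eta -> Rabs (U + 4 * L / PI) <= eta).
  { intros eta Heta.
    set (delta := Rmin (r0 / 2) (eta / (8 * (K0 + 1)))).
    assert (d1 : delta <= r0 / 2) by apply Rmin_l.
    assert (d2 : delta <= eta / (8 * (K0 + 1))) by apply Rmin_r.
    assert (d0 : 0 < delta) by (apply Rmin_pos; [lra | apply Rdiv_lt_0_compat; lra]).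
    destruct (Main delta (conj d0 d1)) as (K1 & HK1 & HM).
    set (A := K1 + 8 * Rabs L / PI ^ 2 * / delta + 1).
    assert (L0 := Rabs_pos L).
    assert (P2 : 0 < PI ^ 2) by nra.
    assert (id : 0 < / delta) by (apply Rinv_0_lt_compat; lra).
    assert (ip : 0 < / PI ^ 2) by (apply Rinv_0_lt_compat; lra).
    assert (A2 : 0 <= 8 * Rabs L / PI ^ 2 * / delta) by (unfold Rdiv; pos).
    assert (A1 : 1 <= A) by (unfold A; lra).
    set (e := Rmin (r0 / 2) (eta / (2 * A))).
    assert (e1 : e <= r0 / 2) by apply Rmin_l.
    assert (e2 : e <= eta / (2 * A)) by apply Rmin_r.
    assert (e0 : 0 < e) by (apply Rmin_pos; [lra | apply Rdiv_lt_0_compat; lra]).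
    assert (B := HM e ltac:(lra) e1).
    assert (At : PI / 2 - atan (delta / e) = atan (e / delta)).
    { replace (e / delta) with (/ (delta / e)) by (field; lra).
      rewrite atan_inv by (apply Rdiv_lt_0_compat; lra). lra. }
    assert (At1 : 0 <= atan (e / delta) <= e / delta).
    { assert (0 <= e / delta) by (left; apply Rdiv_lt_0_compat; lra). split; [apply atan_pos | apply atan_le_id]; auto. }
    replace (U + 4 * L / PI) with (U + 4 * L / PI ^ 2 * (2 * atan (delta / e)) + 8 * L / PI ^ 2 * atan (e / delta)).
    2: { rewrite <- At. field. lra. }
    eapply Rle_trans. apply Rabs_triang.
    assert (B2 : Rabs (8 * L / PI ^ 2 * atan (e / delta)) <= 8 * Rabs L / PI ^ 2 * / delta * e).
    { unfold Rdiv. rewrite !Rabs_mult, (Rabs_pos_eq 8), (Rabs_pos_eq (/ PI ^ 2)), (Rabs_pos_eq (atan _)) by (unfold Rdiv in At1; lra).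
      rewrite !Rmult_assoc. repeat apply Rmult_le_compat_l; try lra. }
    assert (B3 : 2 * delta * K0 <= eta / 4).
    { apply Rle_trans with (2 * (eta / (8 * (K0 + 1))) * (K0 + 1)). 
      assert (delta * K0 <= eta / (8 * (K0 + 1)) * (K0 + 1)) by (apply Rmult_le_compat; lra). lra.
      right; field; lra. }
    assert (B4 : A * e <= eta / 2).
    { apply Rle_trans with (A * (eta / (2 * A))). apply Rmult_le_compat_l; lra. right; field; lra. }
    unfold A in B4. lra. }
  assert (Z : Rabs (U + 4 * L / PI) = 0).
  { apply Rle_antisym; [| apply Rabs_pos]. apply Rnot_lt_le. intros H.
    assert (S := Small (Rabs (U + 4 * L / PI) / 2) ltac:(lra)). lra. }
  apply Rabs_eq_0 in Z. lra.
Qed.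

(** Two linear relations determine the transforms at L and -L: their difference is given by
    [ures_int], and the reflection a -> 2 - a makes their ratio e^(-2L). The result stays in product
    form because 1 - e^(2L) vanishes at L = 0. *)
Lemma kern_int_value L a : 0 < a < 2 ->
  (RtoC (1 - exp (2 * L)) * Cline_int (fun t => kern L a t))%C = RtoC (- (4 * L / PI)).
Proof.
  intros Ha.
  assert (E : forall b, 0 < b < 2 -> Cline_int (fun t => kern L b t) = Cline_int (fun t => kern L a t)).
  { intros b Hb. destruct (Rle_dec b a).
    apply kern_int_constant; lra. symmetry; apply kern_int_constant; lra. }
  assert (Im0 := kern_int_real L a Ha).
  assert (U := ures_int L (1 / 2) ltac:(lra)).
  rewrite (line_int_ext _ _ (ures_kern L (1 / 2))) in U.
  assert (T1 := kern_tame L (1 / 2) ltac:(lra)). assert (T2 := kern_tame (- L) (1 / 2) ltac:(lra)).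
  rewrite line_int_plus, line_int_scal in U; try apply T1; try apply T2; try (apply tame_scal; apply T2).
  assert (R2 := kern_int_reflect L (1 / 2) ltac:(lra)).
  rewrite (E (2 - 1 / 2)) in R2 by lra.
  assert (R1 := f_equal Re (E (1 / 2) ltac:(lra))).
  cbn [Cline_int Re fst] in R1, R2.
  assert (X : exp (2 * L) * exp (- 2 * L) = 1).
  { rewrite <- exp_plus. replace (2 * L + - 2 * L) with 0 by ring. apply exp_0. }
  apply C_eq.
  - rewrite Re_mult, Im0, !Re_RtoC. cbn [Cline_int Re fst].
    rewrite R1 in U. rewrite <- U, R2. 
    replace ((1 - exp (2 * L)) * (exp (-2 * L) * line_int (fun t => Re (kern (- L) (1 / 2) t))))
      with (exp (- 2 * L) * line_int (fun t => Re (kern (- L) (1 / 2) t)) - (exp (2 * L) * exp (-2 * L)) * line_int (fun t => Re (kern (- L) (1 / 2) t))) by ring.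
    rewrite X. cbn [Im RtoC snd]. ring.
  - rewrite Im_mult, Im0. cbn [Im Re RtoC snd fst]. ring.
Qed.

Lemma taylor_abs_le f df ddf a b M : a <= b ->
  (forall x, a <= x <= b -> is_derive f x (df x)) ->
  (forall x, a <= x <= b -> is_derive df x (ddf x)) ->
  (forall x, a <= x <= b -> Rabs (ddf x) <= M) ->
  forall x y, a <= x <= b -> a <= y <= b ->
  Rabs (f y - f x - (y - x) * df x) <= 4 * M * (y - x) ^ 2.
Proof.
  intros ab H1 H2 HM x y Hx Hy.
  assert (H := Cder_taylor (fun t => RtoC (f t)) (fun t => RtoC (df t)) (fun t => RtoC (ddf t)) a b M ab).
  rewrite <- Cmod_R, !RtoC_minus, RtoC_mult, RtoC_minus. rewrite <- (RtoC_minus y x). apply H; auto.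
  - intros; apply Cder_RtoC; auto.
  - intros; apply Cder_RtoC; auto.
  - intros; rewrite Cmod_R; auto.
Qed.

Lemma ln_le_sub_1 x : 0 < x -> ln x <= x - 1.
Proof. intros Hx. assert (H := exp_ineq1_le (ln x)). rewrite exp_ln in H by auto. lra. Qed.

(** * The dilogarithm *)

(** The value at 0 is the continuous extension, so that integrals may start there and the primitive
    is differentiable at 0. *)
Definition ln1p_div (r : R) : R := if Req_EM_T r 0 then 1 else ln (1 + r) / r.

Lemma ln1p_div_0 : ln1p_div 0 = 1.
Proof. unfold ln1p_div. destruct (Req_EM_T 0 0); auto. lra. Qed.

Lemma ln1p_div_neq r : r <> 0 -> ln1p_div r = ln (1 + r) / r.
Proof. unfold ln1p_div. destruct (Req_EM_T r 0); auto. contradiction. Qed.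

Lemma continuous_ln1p_div r : -1 < r -> continuous ln1p_div r.
Proof.
  intros Hr. destruct (Req_dec r 0) as [-> | r0].
  - apply continuity_pt_filterlim. intros eps Heps.
    assert (D : derivable_pt_lim (fun r => ln (1 + r)) 0 1).
    { apply is_derive_Reals. auto_derive. lra. field. }
    destruct (D eps Heps) as [d Hd]. exists d. split. apply cond_pos.
    intros x [[_ Hx0] Hx]. simpl in *. unfold R_dist in *. rewrite Rminus_0_r in Hx.
    rewrite ln1p_div_0, ln1p_div_neq by auto. specialize (Hd x ltac:(auto) Hx).
    rewrite Rplus_0_l, Rplus_0_r, ln_1, Rminus_0_r in Hd. auto.
  - apply continuous_ext_loc with (fun r => ln (1 + r) / r).
    + apply (locally_interval _ r (if Rlt_dec r 0 then m_infty else 0) (if Rlt_dec r 0 then 0 else p_infty));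
      destruct (Rlt_dec r 0); simpl; auto; try lra; intros y H1 H2; rewrite ln1p_div_neq; auto; lra.
    + apply (ex_derive_continuous (V := R_NormedModule)). auto_derive. lra.
Qed.

(** In the usual notation this is -Li_2(-y). *)
Definition dilog (y : R) : R := RInt ln1p_div 0 y.

Lemma ex_RInt_ln1p_div a b : -1 < a -> -1 < b -> ex_RInt ln1p_div a b.
Proof.
  intros Ha Hb. apply (ex_RInt_continuous (V := R_CompleteNormedModule)).
  intros z Hz. apply continuous_ln1p_div. unfold Rmin in Hz. destruct (Rle_dec a b); lra.
Qed.

Lemma is_derive_dilog0 y : -1 < y -> is_derive dilog y (ln1p_div y).
Proof.
  intros Hy. apply (is_derive_RInt (V := R_NormedModule) ln1p_div dilog 0 y).
  - apply (locally_interval _ y (-1) p_infty); simpl; auto.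
    intros x Hx _. apply (RInt_correct (V := R_CompleteNormedModule)). apply ex_RInt_ln1p_div; lra.
  - apply continuous_ln1p_div; auto.
Qed.

Lemma is_derive_dilog y : 0 < y -> is_derive dilog y (ln (1 + y) / y).
Proof. intros Hy. rewrite <- ln1p_div_neq by lra. apply is_derive_dilog0; lra. Qed.

Lemma dilog_0 : dilog 0 = 0.
Proof. exact (RInt_point 0 ln1p_div). Qed.

Lemma ln1p_div_bound r : 0 <= r -> 0 <= ln1p_div r <= 1.
Proof.
  intros [Hr | <-]; [| rewrite ln1p_div_0; lra].
  rewrite ln1p_div_neq by lra.
  assert (0 <= ln (1 + r)) by (rewrite <- ln_1; left; apply ln_increasing; lra).
  assert (ln (1 + r) <= r) by (assert (H2 := ln_le_sub_1 (1 + r) ltac:(lra)); lra).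
  split. apply Rdiv_le_0_compat; auto.
  apply (Rmult_le_reg_r r); auto. unfold Rdiv. rewrite Rmult_assoc, Rinv_l, Rmult_1_r; lra.
Qed.

Lemma dilog_bound y : 0 <= y -> Rabs (dilog y) <= y.
Proof.
  intros Hy. replace (dilog y) with (dilog y - dilog 0) by (rewrite dilog_0; ring).
  replace y with (1 * (y - 0)) at 2 by ring.
  apply mvt_abs_le with ln1p_div; auto; intros x Hx.
  - apply is_derive_dilog0; lra.
  - rewrite Rabs_pos_eq; apply ln1p_div_bound; lra.
Qed.

(** This is ln |1 + r e^(i th)|^2 / r, extended to r = 0 by its limit. *)
Definition basel_integrand (th r : R) : R :=
  if Req_EM_T r 0 then 2 * cos th else ln (1 + 2 * r * cos th + r ^ 2) / r.
Definition basel_den (th r : R) : R := 1 + 2 * r * cos th + r ^ 2.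

Lemma basel_den_ge th r : - / 2 <= cos th -> 0 <= r <= 1 -> 3 / 4 <= basel_den th r.
Proof. intros H Hr. unfold basel_den. assert (- r / 2 <= r * cos th) by nra.
  assert (0 <= (r - / 2) ^ 2) by apply pow2_ge_0. nra. Qed.

Lemma is_derive_basel_th th r : 0 < basel_den th r ->
  is_derive (fun th => basel_integrand th r) th (- 2 * sin th / basel_den th r).
Proof.
  unfold basel_den, basel_integrand. intros H. destruct (Req_EM_T r 0) as [-> | r0].
  - auto_derive; auto. field.
  - auto_derive. simpl in H. lra. simpl in H. field. lra.
Qed.

Lemma is_derive2_basel_th th r : 0 < basel_den th r ->
  is_derive (fun th => - 2 * sin th / basel_den th r) th
    (- 2 * cos th / basel_den th r - 4 * r * sin th ^ 2 / basel_den th r ^ 2).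
Proof.
  unfold basel_den. intros H. auto_derive. simpl in H. lra. simpl in H. field. lra.
Qed.

(** The primitive is -2 arg (1 + r e^(i th)); the condition on the cosine keeps the real part of 1 +
    r e^(i th) positive, so the arctangent is the argument. *)
Lemma basel_antiderivative th r : - / 2 <= cos th -> 0 <= r <= 1 ->
  is_derive (fun r => -2 * atan (r * sin th / (1 + r * cos th))) r (- 2 * sin th / basel_den th r).
Proof.
  intros H Hr. assert (P := basel_den_ge th r H Hr). unfold basel_den in *.
  assert (Q : 0 < 1 + r * cos th) by nra.
  assert (S := sin2_cos2 th). unfold Rsqr in S.
  assert (N : (1 + r * cos th) ^ 2 + (r * sin th) ^ 2 = 1 + 2 * r * cos th + r ^ 2).
  { replace ((r * sin th) ^ 2) with (r ^ 2 * (sin th * sin th)) by ring.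
    replace (sin th * sin th) with (1 - cos th * cos th) by lra. ring. }
  rewrite <- N in *. auto_derive. lra. field. split; lra.
Qed.

Lemma basel_cont th r : - / 2 <= cos th -> 0 <= r <= 1 -> continuous (basel_integrand th) r.
Proof.
  intros H Hr. destruct (Req_dec r 0) as [-> | r0].
  - apply continuity_pt_filterlim. intros eps Heps.
    assert (D : derivable_pt_lim (fun r => ln (1 + 2 * r * cos th + r ^ 2)) 0 (2 * cos th)).
    { apply is_derive_Reals. auto_derive. rewrite !Rmult_0_r, !Rmult_0_l. lra. field. }
    destruct (D eps Heps) as [d Hd]. exists d. split. apply cond_pos.
    intros x [[_ Hx0] Hx]. simpl in *. unfold R_dist in *. rewrite Rminus_0_r in Hx.
    specialize (Hd x ltac:(auto) Hx). unfold basel_integrand.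
    destruct (Req_EM_T x 0) as [E | E]; [subst; lra |]. destruct (Req_EM_T 0 0) as [_ | E']; [| lra].
    replace (1 + 2 * 0 * cos th + 0 * (0 * 1)) with 1 in Hd by ring.
    rewrite Rplus_0_l, ln_1, Rminus_0_r in Hd. exact Hd.
  - assert (P := basel_den_ge th r H Hr). unfold basel_den in P.
    apply continuous_ext_loc with (fun r => ln (1 + 2 * r * cos th + r ^ 2) / r).
    + apply (locally_interval _ r 0 p_infty); simpl; auto. lra.
      intros y H1 _. unfold basel_integrand. destruct (Req_EM_T y 0); auto. lra.
    + apply (ex_derive_continuous (V := R_NormedModule)). auto_derive. simpl in P. lra.
Qed.

(** The margin 1/4 around [0, pi/2] leaves room for two-sided derivatives at the end points. It
    stays below 2 pi/3, where the cosine equals -1/2. *)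
Lemma cos_ge_mhalf th : -1 / 4 <= th <= PI / 2 + / 4 -> - / 2 <= cos th.
Proof.
  intros H. assert (P := PI_RGT_0). assert (P3 : 3 < PI) by (assert (X := PI2_3_2); lra).
  assert (C := cos_2PI3). 
  destruct (Rle_dec 0 th).
  - assert (cos (2 * (PI / 3)) <= cos th) by (apply cos_decr_1; lra). lra.
  - rewrite <- cos_neg. assert (cos (2 * (PI / 3)) <= cos (- th)) by (apply cos_decr_1; lra). lra.
Qed.

(* The integral over [0, 1] of basel_integrand th has derivative -th in th; it is
   2 dilog 1 at th = 0 and, by r |-> r^2, half of dilog 1 at th = pi/2. *)
Lemma dilog_1 : dilog 1 = PI ^ 2 / 12.
Proof.
  assert (P := PI_RGT_0). assert (P3 : 3 < PI) by (assert (X := PI2_3_2); lra). assert (P4 := PI_4).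
  set (J := fun th => RInt (basel_integrand th) 0 1).
  assert (Ex : forall th, -1/4 <= th <= PI / 2 + / 4 -> ex_RInt (basel_integrand th) 0 1).
  { intros th Hth. apply (ex_RInt_continuous (V := R_CompleteNormedModule)).
    intros z Hz. rewrite Rmin_left, Rmax_right in Hz by lra. apply basel_cont; auto. apply cos_ge_mhalf; auto. }
  assert (I1 : forall th, -1/4 <= th <= PI / 2 + / 4 -> is_RInt (fun r => - 2 * sin th / basel_den th r) 0 1 (-2 * atan (sin th / (1 + cos th)))).
  { intros th Hth. assert (Hc := cos_ge_mhalf th Hth). evar_last.
    apply (is_RInt_derive (fun r => -2 * atan (r * sin th / (1 + r * cos th)))).
    - intros r Hr. rewrite Rmin_left, Rmax_right in Hr by lra. apply basel_antiderivative; auto.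
    - intros r Hr. rewrite Rmin_left, Rmax_right in Hr by lra.
      assert (X := basel_den_ge th r Hc Hr). unfold basel_den in *.
      apply (ex_derive_continuous (V := R_NormedModule)). auto_derive. simpl in X. lra.
    - unfold minus, plus, opp; cbn. rewrite !Rmult_1_l, !Rmult_0_l. unfold Rdiv at 2. rewrite Rmult_0_l, atan_0. ring. }
  (* Half-angle formula: arg (1 + e^(i th)) = th/2. *)
  assert (At : forall th, 0 <= th <= PI / 2 -> -2 * atan (sin th / (1 + cos th)) = - th).
  { intros th Hth. assert (Hc := cos_ge_mhalf th ltac:(lra)).
    replace (sin th / (1 + cos th)) with (tan (th / 2)).
    rewrite atan_tan by lra. field.
    assert (c2 : 0 < cos (th / 2)) by (apply cos_gt_0; lra).
    unfold tan. replace th with (2 * (th / 2)) at 3 4 by field.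
    rewrite sin_2a, cos_2a_cos. field. split; nra. }
  assert (D : forall th, 0 <= th <= PI / 2 -> is_derive J th (- th)).
  (* The second derivative in th is at most 8/3 + 64/9 < 11 in absolute value, uniformly in r; the
     factor 4 is that of [taylor_abs_le]. *)
  { intros th Hth. apply is_derive_of_quadratic_bound with (d := 1 / 4) (K := 4 * 11); [lra |].
    intros y Hy. apply Rabs_def2 in Hy.
    assert (Rt : -1/4 <= th <= PI / 2 + / 4) by lra. assert (Ry : -1/4 <= y <= PI / 2 + / 4) by lra.
    assert (I : is_RInt (fun r => basel_integrand y r - basel_integrand th r - (y - th) * (- 2 * sin th / basel_den th r)) 0 1
      (J y - J th - - th * (y - th))).
    { replace (J y - J th - - th * (y - th)) with (J y - J th - (y - th) * - th) by ring.
      apply (is_RInt_minus (V := R_NormedModule)). apply (is_RInt_minus (V := R_NormedModule));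
      apply (RInt_correct (V := R_CompleteNormedModule)); auto.
      apply (is_RInt_scal (V := R_NormedModule) (fun r => - 2 * sin th / basel_den th r)).
      rewrite <- At by auto. auto. }
    replace (4 * 11 * (y - th) ^ 2) with ((1 - 0) * (4 * 11 * (y - th) ^ 2)) by ring.
    apply (norm_RInt_le_const (V := R_NormedModule)) with (3 := I). lra.
    intros r Hr.
    apply (taylor_abs_le (fun th => basel_integrand th r) (fun th => - 2 * sin th / basel_den th r)
       (fun th => - 2 * cos th / basel_den th r - 4 * r * sin th ^ 2 / basel_den th r ^ 2) (-1/4) (PI / 2 + / 4)); try lra.
    - intros x Hx. assert (X := basel_den_ge x r (cos_ge_mhalf x Hx) Hr). apply is_derive_basel_th; lra.
    - intros x Hx. assert (X := basel_den_ge x r (cos_ge_mhalf x Hx) Hr). apply is_derive2_basel_th; lra.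
    - intros x Hx. assert (X := basel_den_ge x r (cos_ge_mhalf x Hx) Hr).
      assert (C := COS_bound x). assert (S := SIN_bound x).
      set (d := basel_den x r) in *.
      assert (i0 : 0 < / d) by (apply Rinv_0_lt_compat; lra).
      assert (i1 : / d <= 4 / 3) by (replace (4 / 3) with (/ (3 / 4)) by field; apply Rinv_le_contravar; lra).
      replace (- 2 * cos x / d - 4 * r * sin x ^ 2 / d ^ 2) with (- (2 * cos x * / d) + - (4 * (r * sin x ^ 2) * (/ d * / d))) by (field; lra).
      assert (s2 : 0 <= sin x ^ 2 <= 1) by nra.
      assert (rs : 0 <= r * sin x ^ 2 <= 1) by nra.
      assert (dd : 0 <= / d * / d <= 16 / 9) by nra.
      eapply Rle_trans. apply Rabs_triang. rewrite !Rabs_Ropp.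
      assert (Rabs (2 * cos x * / d) <= 8 / 3) by (apply Rabs_le; nra).
      assert (Rabs (4 * (r * sin x ^ 2) * (/ d * / d)) <= 64 / 9) by (apply Rabs_le; split; nra).
      lra. }
  assert (J0 : J 0 = 2 * dilog 1).
  { unfold J, dilog. rewrite <- (RInt_scal (V := R_CompleteNormedModule) ln1p_div) by (apply ex_RInt_ln1p_div; lra).
    apply RInt_ext. intros r Hr. rewrite Rmin_left, Rmax_right in Hr by lra.
    unfold basel_integrand. rewrite ln1p_div_neq by lra. destruct (Req_EM_T r 0); [lra |].
    rewrite cos_0. replace (1 + 2 * r * 1 + r ^ 2) with ((1 + r) * (1 + r)) by ring. rewrite ln_mult by lra.
    unfold scal; cbn; unfold mult; cbn. field. auto. }
  assert (J1 : J (PI / 2) = / 2 * dilog 1).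
  { unfold J. apply (is_RInt_unique (V := R_CompleteNormedModule)). evar_last.
    apply (is_RInt_ext (V := R_NormedModule) (fun r => r * ln1p_div (r ^ 2))).
    - intros r Hr. rewrite Rmin_left, Rmax_right in Hr by lra. unfold basel_integrand.
      destruct (Req_EM_T r 0); [lra |]. rewrite cos_PI2, ln1p_div_neq by nra.
      replace (1 + 2 * r * 0 + r ^ 2) with (1 + r ^ 2) by ring.
      match goal with |- ?a = ?b => change (@eq R a b) end. field. auto.
    - apply (is_RInt_derive (fun r => / 2 * dilog (r ^ 2))).
      + intros r _. evar_last. apply (is_derive_scal (fun r => dilog (r ^ 2))).
        apply (is_derive_comp_R dilog (fun r => r ^ 2)). apply is_derive_dilog0. nra.
        auto_derive; auto. unfold mult; cbn. field.
      + intros r _. apply (continuous_mult (K := R_AbsRing) (fun r => r)). apply continuous_id.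
        apply (continuous_comp (fun r => r ^ 2) ln1p_div). apply (ex_derive_continuous (V := R_NormedModule)). auto_derive; auto.
        apply continuous_ln1p_div. nra.
    - change (/ 2 * dilog (1 ^ 2) - / 2 * dilog (0 ^ 2) = / 2 * dilog 1).
      rewrite pow1, pow_i, dilog_0 by lia. ring. }
  (* J(th) + th^2/2 is constant. Its values at 0 and pi/2 give 2 D = D/2 + pi^2/8 for D =
     [dilog 1]. *)
  assert (E : (J (PI / 2) + (PI / 2) ^ 2 / 2) - (J 0 + 0 ^ 2 / 2) = 0).
  { assert (X : Rabs ((J (PI / 2) + (PI / 2) ^ 2 / 2) - (J 0 + 0 ^ 2 / 2)) <= 0 * (PI / 2 - 0)).
    { apply (mvt_abs_le (fun th => J th + th ^ 2 / 2) (fun _ => 0)); try lra.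
      - intros x Hx.
        assert (D2 : is_derive (fun th => th ^ 2 / 2) x x) by (auto_derive; auto; field).
        evar_last. apply (is_derive_plus (V := R_NormedModule)); [apply D; lra | exact D2].
        unfold plus; cbn. ring.
      - intros; rewrite Rabs_R0; lra. }
    rewrite Rmult_0_l in X. assert (Y := Rabs_pos ((J (PI / 2) + (PI / 2) ^ 2 / 2) - (J 0 + 0 ^ 2 / 2))).
    apply Rabs_eq_0. lra. }
  rewrite J0, J1 in E. simpl in E. simpl. lra.
Qed.

Lemma zero_derivative_constant (f : R -> R) a b : a <= b ->
  (forall x, a <= x <= b -> is_derive f x 0) -> f a = f b.
Proof.
  intros ab H.
  assert (X : Rabs (f b - f a) <= 0 * (b - a)).
  { apply (mvt_abs_le f (fun _ => 0)); auto. intros; rewrite Rabs_R0; lra. }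
  rewrite Rmult_0_l in X. assert (Y := Rabs_pos (f b - f a)).
  assert (Rabs (f b - f a) = 0) by lra. apply Rabs_eq_0 in H0. lra.
Qed.

(** The two sides have the same derivative for v > 0, since ln (1 + 1/v) = ln (1 + v) - ln v; the
    constant is twice [dilog 1], read off at v = 1. *)
Lemma dilog_inversion v : 0 < v -> dilog v + dilog (/ v) = PI ^ 2 / 6 + ln v ^ 2 / 2.
Proof.
  intros Hv. set (f := fun v => dilog v + dilog (/ v) - ln v ^ 2 / 2).
  assert (D : forall x, 0 < x -> is_derive f x 0).
  { intros x Hx. unfold f. assert (ix : 0 < / x) by (apply Rinv_0_lt_compat; auto). evar_last.
    apply (is_derive_minus (V := R_NormedModule)). apply (is_derive_plus (V := R_NormedModule)).
    apply is_derive_dilog; auto.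
    apply (is_derive_comp_R dilog Rinv). apply is_derive_dilog; auto.
    auto_derive; [lra | reflexivity]. auto_derive; [auto | reflexivity].
    unfold minus, plus, opp; cbn.
    replace (1 + / x) with ((1 + x) / x) by (field; lra). rewrite ln_div by lra. field. lra. }
  assert (E : f v = f 1).
  { destruct (Rle_dec v 1).
    - apply zero_derivative_constant; auto. intros; apply D; lra.
    - symmetry. apply zero_derivative_constant; try lra. intros; apply D; lra. }
  unfold f in E. rewrite Rinv_1, ln_1, dilog_1 in E. simpl in *. lra.
Qed.

(** For v >= 0 this is pi^2/6 - Li_2(v/(1 + v)). It is what a boundary term of the double sum keeps
    once its squared logarithm is removed ([qfun_ell]), and it is regular at 0. *)
Definition ell (v : R) : R := PI ^ 2 / 6 + ln (1 + v) ^ 2 / 2 - dilog v.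
(** The primitive of ln y / (1 + y) that tends to 0 at 0. *)
Definition qfun (y : R) : R := ln y * ln (1 + y) - dilog y.

Lemma ell_0 : ell 0 = PI ^ 2 / 6.
Proof. unfold ell. rewrite Rplus_0_r, ln_1, dilog_0. field. Qed.

Lemma qfun_ell y : 0 < y -> qfun y = ln (1 + y) ^ 2 / 2 - ell (/ y).
Proof.
  intros Hy. unfold qfun, ell. assert (I := dilog_inversion y Hy).
  replace (1 + / y) with ((1 + y) / y) by (field; lra). rewrite ln_div by lra.
  replace (dilog y) with (PI ^ 2 / 6 + ln y ^ 2 / 2 - dilog (/ y)) by lra. field.
Qed.

Lemma is_derive_qfun y : 0 < y -> is_derive qfun y (ln y / (1 + y)).
Proof.
  intros Hy. unfold qfun. evar_last. apply (is_derive_minus (V := R_NormedModule)).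
  auto_derive. split; [auto | split; [lra | auto]]. reflexivity. apply is_derive_dilog; auto.
  unfold minus, plus, opp; cbn. field. lra.
Qed.

Lemma is_derive_ell0 v : -1 < v -> is_derive ell v (ln (1 + v) / (1 + v) - ln1p_div v).
Proof.
  intros Hv. unfold ell. evar_last. apply (is_derive_minus (V := R_NormedModule)).
  auto_derive. lra. reflexivity. apply is_derive_dilog0; auto.
  unfold minus, plus, opp; cbn. field. lra.
Qed.

(** A crude rate of decay at 0, from |ln y| <= 2 y^(-1/2); it fixes the constant of integration in
    [bet_int]. *)
Lemma qfun_bound y : 0 < y < 1 -> Rabs (qfun y) <= 3 * sqrt y.
Proof.
  intros Hy. unfold qfun. assert (D := dilog_bound y ltac:(lra)).
  set (s := sqrt y). assert (s0 : 0 < s) by (apply sqrt_lt_R0; lra).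
  assert (E : y = s * s) by (symmetry; apply sqrt_sqrt; lra).
  assert (s1 : s < 1) by nra.
  assert (L : Rabs (ln y) <= 2 * / s).
  { rewrite E, ln_mult by lra. assert (ln s < 0) by (rewrite <- ln_1; apply ln_increasing; lra).
    rewrite Rabs_left by lra. assert (X := ln_le_sub_1 (/ s) ltac:(apply Rinv_0_lt_compat; auto)).
    rewrite ln_Rinv in X by auto. lra. }
  assert (L1 : Rabs (ln (1 + y)) <= y).
  { assert (0 <= ln (1 + y)) by (rewrite <- ln_1; left; apply ln_increasing; lra).
    rewrite Rabs_pos_eq by auto. assert (X := ln_le_sub_1 (1 + y) ltac:(lra)); lra. }
  eapply Rle_trans. apply Rabs_triang. rewrite Rabs_Ropp, Rabs_mult.
  assert (Rabs (ln y) * Rabs (ln (1 + y)) <= 2 * / s * y) by (apply Rmult_le_compat; auto; apply Rabs_pos).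
  assert (2 * / s * y = 2 * s) by (rewrite E; field; lra). nra.
Qed.

(** * The kernel of H and its transforms in a positive variable y *)

Definition mker (c t : R) : C := (RtoC (PI ^ 2) * / one_minus_cos c t)%C.

Lemma omc_half_angle c t : one_minus_cos c t =
  (- (Cexp (Ci * (RtoC PI * wpt c t / 2)) - Cexp (- (Ci * (RtoC PI * wpt c t / 2))))
   * (Cexp (Ci * (RtoC PI * wpt c t / 2)) - Cexp (- (Ci * (RtoC PI * wpt c t / 2)))) / 2)%C.
Proof.
  rewrite omc_Cexp. set (z := (Ci * (RtoC PI * wpt c t / 2))%C).
  replace (Ci * RtoC PI * wpt c t)%C with (z + z)%C by (unfold z; field).
  replace (- (z + z))%C with (- z + - z)%C by ring. rewrite !Cexp_add.
  assert (E : (Cexp z * Cexp (- z))%C = 1%C).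
  { rewrite <- Cexp_add, <- Cexp_0. f_equal. ring. }
  replace (1 - (Cexp z * Cexp z + Cexp (- z) * Cexp (- z)) / 2)%C
   with (Cexp z * Cexp (- z) - (Cexp z * Cexp z + Cexp (- z) * Cexp (- z)) / 2)%C by (rewrite E; ring).
  field.
Qed.

Lemma Ci_sq : (Ci * Ci = - (1))%C.
Proof. apply C_eq; cbn; ring. Qed.

Lemma RtoC_PI_neq_0 : RtoC PI <> 0%C.
Proof. intros E. apply RtoC_inj in E. assert (P := PI_RGT_0). lra. Qed.

(** The identity is pi/sin (pi w) times pi cot (pi w/2) = pi^2/(2 sin^2 (pi w/2)) = pi^2/(1 - cos
    (pi w)), after cancelling cos (pi w/2). It is checked as a rational identity in a = e^(i pi w/2)
    and b = e^(-i pi w/2) with ab = 1. *)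
Lemma scrH_kernel c t (z1 z2 r : C) : 0 < c < 1 ->
  (RtoC PI * z1 * z2 / Csin (RtoC PI * wpt c t) * (RtoC PI * Ccot (RtoC PI * wpt c t / 2)) * r)%C
  = (mker c t * (z1 * z2 * r))%C.
Proof.
  intros Hc. assert (N1 := omc_neq_0 c t ltac:(lra)). assert (N2 := omc_neq_0 (1 + c) t ltac:(lra)).
  (* At abscissa 1 + c the denominator is 1 + cos (pi w) = 2 cos^2 (pi w/2). That it does not vanish
     is what allows the cosine to be cancelled. *)
  assert (S : one_minus_cos (1 + c) t = (2 - one_minus_cos c t)%C).
  { unfold one_minus_cos. replace (PI * (1 + c)) with (PI * c + PI) by ring. rewrite neg_cos, neg_sin.
    apply C_eq; cbn; ring. }
  rewrite S in N2. clear S.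
  unfold mker, Ccot, Csin, Ccos. rewrite omc_half_angle in *.
  set (z := (Ci * (RtoC PI * wpt c t / 2))%C) in *.
  replace (Ci * (RtoC PI * wpt c t))%C with (z + z)%C by (unfold z; field).
  replace (- (z + z))%C with (- z + - z)%C by ring. rewrite !Cexp_add.
  assert (E : (Cexp z * Cexp (- z))%C = 1%C).
  { rewrite <- Cexp_add, <- Cexp_0. f_equal. ring. }
  replace (RtoC (PI ^ 2)) with (RtoC PI * RtoC PI)%C by (rewrite <- RtoC_mult; f_equal; ring).
  revert N1 N2 E. generalize (Cexp z) (Cexp (- z)). intros a b N1 N2 E.
  assert (M1 : (a - b)%C <> 0%C).
  { intros Z. apply N1. rewrite Z. field. }
  assert (M2 : (a + b)%C <> 0%C).
  { intros Z. apply N2. replace b with ((a + b) - a)%C by ring. rewrite Z.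
    replace (a - (0 - a))%C with (2 * a)%C by ring.
    assert (E2 : (a * a = - (1))%C).
    { rewrite <- E. replace b with ((a + b) - a)%C by ring. rewrite Z. ring. }
    replace (2 - - (2 * a) * (2 * a) / 2)%C with (2 + 2 * (a * a))%C by field. rewrite E2. ring. }
  assert (Ni : Ci <> 0%C) by (intros Z; injection Z; lra).
  assert (M3 : (a * a - b * b)%C <> 0%C).
  { replace (a * a - b * b)%C with ((a - b) * (a + b))%C by ring. apply Cmult_neq_0; auto. }
  transitivity (RtoC PI * RtoC PI * z1 * z2 * r * (2 * (Ci * Ci)) / ((a - b) * (a - b)))%C.
  - field. repeat split; auto.
  - rewrite Ci_sq. field. auto.
Qed.

(** Of the exponential decay only a power is kept: it absorbs up to three factors of size 1 + t^2
    and leaves an integrable one. The two zeta factors take two of them. *)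
Lemma mker_bound c : 0 < c < 2 -> exists M, 0 < M /\ forall t, Cmod (mker c t) <= M / (1 + t ^ 2) ^ 4.
Proof.
  intros Hc. destruct (cos_PI_bound c c) as (rho & Hr & Hcos); try lra.
  assert (P := PI_RGT_0).
  exists (PI ^ 2 * / (1 - rho) * 256). split.
  { assert (0 < / (1 - rho)) by (apply Rinv_0_lt_compat; lra). assert (0 < PI ^ 2) by nra.
    apply Rmult_lt_0_compat; [apply Rmult_lt_0_compat |]; lra. }
  intros t. assert (N := omc_neq_0 c t ltac:(lra)).
  unfold mker. rewrite Cmod_mult, Cmod_inv, Cmod_R, Rabs_pos_eq by (auto; nra).
  assert (B := omc_lower rho c t ltac:(lra) (Hcos c ltac:(lra))).
  assert (C1 := cosh_ge_1 (PI * t)).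
  unfold Rdiv. rewrite !Rmult_assoc. apply Rmult_le_compat_l. nra.
  apply Rle_trans with (/ (1 - rho) * / cosh (PI * t)).
  - rewrite <- Rinv_mult. apply Rinv_le_contravar; auto. apply Rmult_lt_0_compat; lra.
  - apply Rmult_le_compat_l. left; apply Rinv_0_lt_compat; lra. apply inv_cosh_le.
Qed.

Lemma mker_cont c t : 0 < c < 2 -> Ccont (fun t => mker c t) t.
Proof.
  intros Hc. unfold mker. eapply Cder_cont. apply Cder_scal. apply Cder_inv. apply Cder_omc_t.
  apply omc_neq_0; auto.
Qed.

Lemma one_sq_pow_le t n : (n <= 3)%nat -> (1 + t ^ 2) ^ n / (1 + t ^ 2) ^ 4 <= / (1 + t ^ 2).
Proof.
  intros Hn. assert (P := one_sq_pos t). set (x := 1 + t ^ 2) in *.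
  assert (1 <= x) by (unfold x; nra).
  assert (P4 : 0 < x ^ 4) by (apply pow_lt; auto).
  assert (x ^ n <= x ^ 3) by (apply Rle_pow; auto).
  replace (/ x) with (x ^ 3 / x ^ 4) by (field; lra).
  apply Rmult_le_compat_r; auto. left; apply Rinv_0_lt_compat; auto.
Qed.

Lemma mker_mult_bound c M f A n t : (forall t, Cmod (mker c t) <= M / (1 + t ^ 2) ^ 4) -> 0 < M -> 0 <= A ->
  Cmod f <= A * (1 + t ^ 2) ^ n -> (n <= 3)%nat ->
  Cmod (mker c t * f)%C <= (M * A) / (1 + t ^ 2).
Proof.
  intros HM M0 A0 Hf Hn. rewrite Cmod_mult.
  apply Rle_trans with (M / (1 + t ^ 2) ^ 4 * (A * (1 + t ^ 2) ^ n)).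
  apply Rmult_le_compat; auto; apply Cmod_ge_0.
  replace (M / (1 + t ^ 2) ^ 4 * (A * (1 + t ^ 2) ^ n)) with (M * A * ((1 + t ^ 2) ^ n / (1 + t ^ 2) ^ 4)) by (unfold Rdiv; ring).
  unfold Rdiv at 2. apply Rmult_le_compat_l. nra. apply one_sq_pow_le; auto.
Qed.

Lemma mker_Ctame c f A n : 0 < c < 2 -> (forall t, Ccont f t) -> 0 <= A -> (n <= 3)%nat ->
  (forall t, Cmod (f t) <= A * (1 + t ^ 2) ^ n) -> Ctame (fun t => mker c t * f t)%C.
Proof.
  intros Hc Hf A0 Hn HA. destruct (mker_bound c Hc) as (M & M0 & HM).
  apply Ctame_intro with (M * A).
  - intros t. apply Ccont_mult; auto. apply mker_cont; auto.
  - intros t. apply mker_mult_bound with n; auto.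
Qed.

Lemma Cmod_wpt_le c t : 0 < c < 1 -> Cmod (wpt c t) <= 2 * (1 + t ^ 2).
Proof.
  intros Hc. rewrite wpt_eq. eapply Rle_trans. apply Cmod_le_Re_Im. cbn [Re Im fst snd].
  rewrite (Rabs_pos_eq c) by lra. rewrite <- (pow2_abs t). assert (X := Rabs_pos t). nra.
Qed.

Lemma Cmod_1_wpt_le c t : 0 < c < 1 -> Cmod (wpt c t - 1)%C <= 2 * (1 + t ^ 2).
Proof.
  intros Hc. rewrite wpt_eq. eapply Rle_trans. apply Cmod_le_Re_Im. cbn.
  rewrite (Rabs_left (c + - (1))) by lra. replace (t + - 0) with t by ring.
  rewrite Rmult_1_r. assert (X := Rabs_pos t). assert (Y := pow2_abs t). simpl in Y. nra.
Qed.

Lemma wpt_neq_0 c t : 0 < c < 1 -> wpt c t <> 0%C.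
Proof. intros Hc E. rewrite wpt_eq in E. injection E. lra. Qed.

Lemma one_minus_wpt_neq_0 c t : 0 < c < 1 -> (1 - wpt c t)%C <> 0%C.
Proof. intros Hc E. rewrite wpt_eq in E. injection E. lra. Qed.

Lemma Cmod_inv_wpt c t : 0 < c < 1 -> Cmod (/ wpt c t)%C <= / c.
Proof.
  intros Hc. rewrite Cmod_inv by (apply wpt_neq_0; auto). apply Rinv_le_contravar. lra.
  eapply Rle_trans; [| apply Re_le_Cmod]. rewrite wpt_eq. cbn. apply Rle_abs.
Qed.

Lemma Cmod_inv_one_minus_wpt c t : 0 < c < 1 -> Cmod (/ (1 - wpt c t))%C <= / (1 - c).
Proof.
  intros Hc. rewrite Cmod_inv by (apply one_minus_wpt_neq_0; auto). apply Rinv_le_contravar. lra.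
  eapply Rle_trans; [| apply Re_le_Cmod]. rewrite wpt_eq. cbn. apply Rle_abs.
Qed.

Lemma Ccont_Rcpow y (f : R -> C) t : Ccont f t -> Ccont (fun t => Rcpow y (f t)) t.
Proof.
  intros [H1 H2]. unfold Rcpow, Cexp.
  assert (E1 : continuous (fun t => exp (Re (f t) * ln y)) t).
  { apply (continuous_comp (fun t => Re (f t) * ln y) exp).
    apply (continuous_mult (K := R_AbsRing)); auto. apply continuous_const.
    apply (ex_derive_continuous (V := R_NormedModule)). auto_derive; auto. }
  assert (E2 : continuous (fun t => Im (f t) * ln y) t).
  { apply (continuous_mult (K := R_AbsRing)); auto. apply continuous_const. }
  split.
  - apply continuous_ext with (fun t => exp (Re (f t) * ln y) * cos (Im (f t) * ln y)).
    { intros s. cbn. unfold Re, Im. rewrite !Rmult_0_r, Rminus_0_r, Rplus_0_l, Rmult_0_l, Rminus_0_r. reflexivity. }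
    apply (continuous_mult (K := R_AbsRing)); auto.
    apply (continuous_comp (fun t => Im (f t) * ln y) cos); auto. apply continuous_cos.
  - apply continuous_ext with (fun t => exp (Re (f t) * ln y) * sin (Im (f t) * ln y)).
    { intros s. cbn. unfold Re, Im. rewrite !Rmult_0_r, Rminus_0_r, Rplus_0_l, Rmult_0_l, Rplus_0_r. reflexivity. }
    apply (continuous_mult (K := R_AbsRing)); auto.
    apply (continuous_comp (fun t => Im (f t) * ln y) sin); auto. apply continuous_sin.
Qed.

Lemma Ccont_wpt c t : Ccont (fun t => wpt c t) t.
Proof. eapply Cder_cont. apply Cder_wpt_t. Qed.

Lemma Ccont_inv f t : Ccont f t -> f t <> 0%C -> Ccont (fun t => / f t)%C t.
Proof.
  intros [H1 H2] H0.
  assert (N : Re (f t) ^ 2 + Im (f t) ^ 2 <> 0).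
  { intros E. apply H0. apply C_eq; cbn; nra. }
  assert (I : continuous (fun t => / (Re (f t) ^ 2 + Im (f t) ^ 2)) t).
  { apply (continuous_comp (fun t => Re (f t) ^ 2 + Im (f t) ^ 2) Rinv).
    - apply (continuous_plus (V := R_NormedModule)).
      + apply (continuous_comp (fun t => Re (f t)) (fun x => x ^ 2)); auto.
        apply (ex_derive_continuous (V := R_NormedModule)). auto_derive; auto.
      + apply (continuous_comp (fun t => Im (f t)) (fun x => x ^ 2)); auto.
        apply (ex_derive_continuous (V := R_NormedModule)). auto_derive; auto.
    - apply (ex_derive_continuous (V := R_NormedModule)). auto_derive; auto. }
  split; cbn.
  - apply (continuous_mult (K := R_AbsRing)); auto.
  - apply (continuous_mult (K := R_AbsRing)); auto. apply (continuous_opp (V := R_NormedModule)); auto.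
Qed.

Lemma Ccont_opp f t : Ccont f t -> Ccont (fun t => - f t)%C t.
Proof.
  intros H. apply Ccont_ext with (fun t => (- (1)) * f t)%C. intros; ring.
  apply Ccont_mult; auto. apply Ccont_const.
Qed.

Lemma Ccont_minus f g t : Ccont f t -> Ccont g t -> Ccont (fun t => f t - g t)%C t.
Proof. intros. apply Ccont_plus; auto. apply Ccont_opp; auto. Qed.

Ltac ccont := repeat match goal with
  | |- Ccont (fun _ => ?c) _ => apply Ccont_const
  | |- Ccont (fun t => wpt _ t) _ => apply Ccont_wpt
  | |- Ccont (fun t => Cmult (@?a t) (@?b t)) _ => apply (Ccont_mult a b)
  | |- Ccont (fun t => Cplus (@?a t) (@?b t)) _ => apply (Ccont_plus a b)
  | |- Ccont (fun t => Cminus (@?a t) (@?b t)) _ => apply (Ccont_minus a b)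
  | |- Ccont (fun t => Copp (@?a t)) _ => apply (Ccont_opp a)
  | |- Ccont (fun t => Rcpow ?y (@?a t)) _ => apply (Ccont_Rcpow y a)
  | |- Ccont (fun t => Cinv (@?a t)) _ => apply (Ccont_inv a)
  end.

Definition kap (c y t : R) : C := (mker c t * (Rcpow y (- wpt c t) - Rcpow y (wpt c t - 1)))%C.

(** A primitive of [kap] in y, tending to 0 with y after integration. The denominators 1 - w and w
    are those of the power terms in the truncations of zeta(w) and zeta(1 - w). *)
Definition bet (c y t : R) : C :=
  (mker c t * (Rcpow y (1 - wpt c t) * / (1 - wpt c t) - Rcpow y (wpt c t) * / wpt c t))%C.

Definition kap1 (c y t : R) : C :=
  (mker c t * (- wpt c t * Rcpow y (- wpt c t - 1) - (wpt c t - 1) * Rcpow y (wpt c t - 1 - 1)))%C.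

Lemma Rcpow_neg_wpt y c t : Rcpow y (- wpt c t) = Cexp (- RtoC (ln y) * wpt c t).
Proof. unfold Rcpow. f_equal. ring. Qed.

Lemma mker_pow_int c y : 0 < c < 2 ->
  Ctame (fun t => mker c t * Rcpow y (- wpt c t))%C /\
  Cline_int (fun t => mker c t * Rcpow y (- wpt c t))%C = (RtoC (PI ^ 2) * Cline_int (fun t => kern (ln y) c t))%C.
Proof.
  intros Hc. assert (T := kern_tame (ln y) c Hc).
  assert (E : forall t, (RtoC (PI ^ 2) * kern (ln y) c t = mker c t * Rcpow y (- wpt c t))%C).
  { intros t. unfold mker, kern. rewrite Rcpow_neg_wpt. ring. }
  split.
  - apply Ctame_ext with (1 := E). apply Ctame_scal; auto.
  - rewrite <- (Cline_int_ext _ _ E), Cline_int_scal by auto. reflexivity.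
Qed.

Lemma kap_eq c y t : 0 < y -> kap c y t =
  (mker c t * Rcpow y (- wpt c t) - RtoC (/ y) * (mker c t * Rcpow (/ y) (- wpt c t)))%C.
Proof.
  intros Hy. unfold kap. rewrite Rcpow_inv by auto.
  replace (- - wpt c t)%C with (wpt c t) by ring.
  unfold Cminus. rewrite (Rcpow_add y (wpt c t)).
  replace (Rcpow y (- (1))) with (RtoC (/ y)).
  ring. rewrite <- Rcpow_inv by auto. symmetry; apply Rcpow_1. apply Rinv_0_lt_compat; auto.
Qed.

(** The transform of y^(-w) alone is -4 pi ln y / (1 - y^2), by [kern_int_value] with L = ln y.
    Subtracting 1/y times its value at 1/y cancels the factor 1 - y. At y = 1, where that formula
    degenerates, the two terms coincide. *)
Lemma kap_int c y : 0 < c < 2 -> 0 < y -> Ctame (kap c y) /\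
  Cline_int (kap c y) = RtoC (- 4 * PI * (ln y / (1 + y))).
Proof.
  intros Hc Hy. assert (P := PI_RGT_0).
  destruct (mker_pow_int c y Hc) as [T1 I1].
  destruct (mker_pow_int c (/ y) Hc) as [T2 I2].
  assert (T3 := Ctame_scal (RtoC (/ y)) _ T2).
  assert (E : forall t, (mker c t * Rcpow y (- wpt c t) - RtoC (/ y) * (mker c t * Rcpow (/ y) (- wpt c t)))%C = kap c y t).
  { intros; symmetry; apply kap_eq; auto. }
  split. { apply Ctame_ext with (1 := E). apply Ctame_minus; auto. }
  rewrite <- (Cline_int_ext _ _ E), Cline_int_minus, Cline_int_scal, I1, I2 by auto.
  destruct (Req_dec y 1) as [-> | y1].
  - rewrite Rinv_1, ln_1. unfold Rdiv. rewrite Rmult_0_l, Rmult_0_r. ring.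
  - assert (V1 := kern_int_value (ln y) c Hc). assert (V2 := kern_int_value (ln (/ y)) c Hc).
    rewrite ln_Rinv in * by auto.
    replace (exp (2 * ln y)) with (y * y) in V1.
    2: { replace (2 * ln y) with (ln y + ln y) by ring. rewrite exp_plus, exp_ln; auto. }
    replace (exp (2 * - ln y)) with (/ (y * y)) in V2.
    2: { replace (2 * - ln y) with (- (ln y + ln y)) by ring. rewrite exp_Ropp, exp_plus, exp_ln; auto. }
    assert (N1 : 1 - y * y <> 0) by nra.
    assert (N2 : 1 - / (y * y) <> 0).
    { intros Z. apply N1. replace (1 - y * y) with (- (y * y) * (1 - / (y * y))) by (field; lra). rewrite Z; ring. }
    assert (G : forall a z b, a <> 0 -> (RtoC a * z = RtoC b)%C -> z = RtoC (b / a)).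
    { intros a z b Ha H. rewrite RtoC_div, <- H by auto. field. intros E'; apply RtoC_inj in E'; auto. }
    rewrite (G _ _ _ N1 V1), (G _ _ _ N2 V2), <- !RtoC_mult, <- RtoC_minus. f_equal.
    field. repeat split; try lra; nra.
Qed.

Lemma Rcpow_bound p q : 0 < p -> p <= q -> exists E, 0 < E /\
  forall y s, p <= y <= q -> Rabs (Re s) <= 2 -> Cmod (Rcpow y s) <= E.
Proof.
  intros Hp pq. exists (exp (2 * (Rabs (ln p) + Rabs (ln q)))). split. apply exp_pos.
  intros y s Hy Hs. rewrite Cmod_Rcpow. unfold Rpower.
  assert (L1 : ln p <= ln y) by (apply ln_le; lra). assert (L2 : ln y <= ln q) by (apply ln_le; lra).
  assert (A1 := Rle_abs (ln q)). assert (A2 := Rle_abs (- ln p)). rewrite Rabs_Ropp in A2.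
  assert (A : Rabs (ln y) <= Rabs (ln p) + Rabs (ln q)).
  { assert (B1 := Rabs_pos (ln p)). assert (B2 := Rabs_pos (ln q)). apply Rabs_le; lra. }
  assert (X : Re s * ln y <= 2 * (Rabs (ln p) + Rabs (ln q))).
  { eapply Rle_trans. apply Rle_abs. rewrite Rabs_mult. apply Rmult_le_compat; auto; apply Rabs_pos. }
  destruct X as [X | ->]; [left; apply exp_increasing; auto | lra].
Qed.

Lemma Re_wpt c t : Re (wpt c t) = c.
Proof. rewrite wpt_eq. reflexivity. Qed.

Lemma bet_Ctame c y : 0 < c < 1 -> 0 < y -> Ctame (bet c y).
Proof.
  intros Hc Hy. destruct (Rcpow_bound y y Hy ltac:(lra)) as (E & E0 & HE).
  assert (ic : 0 < / c) by (apply Rinv_0_lt_compat; lra). assert (ic' : 0 < / (1 - c)) by (apply Rinv_0_lt_compat; lra).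
  apply (mker_Ctame c (fun t => Rcpow y (1 - wpt c t) * / (1 - wpt c t) - Rcpow y (wpt c t) * / wpt c t)%C (E * / (1 - c) + E * / c) 0); auto.
  - lra.
  - intros t. ccont; [apply one_minus_wpt_neq_0 | apply wpt_neq_0]; auto.
  - pos.
  - intros t. rewrite pow_O, Rmult_1_r. eapply Rle_trans. apply Cmod_minus_le.
    rewrite !Cmod_mult. apply Rplus_le_compat; apply Rmult_le_compat; try apply Cmod_ge_0.
    + apply HE. lra. unfold Cminus. rewrite Re_plus. change (Re (- wpt c t)) with (- Re (wpt c t)).
      rewrite Re_wpt. cbn. apply Rabs_le; lra.
    + apply Cmod_inv_one_minus_wpt; auto.
    + apply HE. lra. rewrite Re_wpt. apply Rabs_le; lra.
    + apply Cmod_inv_wpt; auto.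
Qed.

Lemma Cder_bet c y t : 0 < c < 1 -> 0 < y -> Cder (fun y => bet c y t) y (kap c y t).
Proof.
  intros Hc Hy. assert (N1 := wpt_neq_0 c t Hc). assert (N2 := one_minus_wpt_neq_0 c t Hc).
  unfold bet, kap. eapply Cder_eq. apply Cder_scal. apply Cder_minus.
  apply Cder_mult. apply Cder_Rcpow; auto. apply Cder_const.
  apply Cder_mult. apply Cder_Rcpow; auto. apply Cder_const.
  replace (1 - wpt c t - 1)%C with (- wpt c t)%C by ring. field. auto.
Qed.

Lemma Cder_kap c y t : 0 < y -> Cder (fun y => kap c y t) y (kap1 c y t).
Proof.
  intros Hy. unfold kap, kap1. apply Cder_scal. apply Cder_minus; apply Cder_Rcpow; auto.
Qed.

Lemma bet_int_quadratic c p q : 0 < c < 1 -> 0 < p -> p <= q -> exists K, forall x y, p <= x <= q -> p <= y <= q ->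
  Cmod (Cline_int (bet c y) - Cline_int (bet c x) - RtoC (y - x) * Cline_int (kap c x))%C <= K * (y - x) ^ 2.
Proof.
  intros Hc Hp pq. destruct (Rcpow_bound p q Hp pq) as (E & E0 & HE).
  destruct (mker_bound c ltac:(lra)) as (M & M0 & HM).
  set (A := 4 * E). exists (2 * PI * (4 * (M * A))).
  intros x y Hx Hy.
  assert (Tx := bet_Ctame c x Hc ltac:(lra)). assert (Ty := bet_Ctame c y Hc ltac:(lra)).
  destruct (kap_int c x ltac:(lra) ltac:(lra)) as [Tk _].
  assert (Tk' := Ctame_scal (RtoC (y - x)) _ Tk). assert (Td := Ctame_minus _ _ Ty Tx).
  rewrite <- (Cline_int_scal _ _ Tk), <- (Cline_int_minus _ _ Ty Tx), <- (Cline_int_minus _ _ Td Tk').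
  rewrite (Rmult_assoc (2 * PI)). apply Rle_trans with (2 * PI * (4 * (M * A) * (y - x) ^ 2)); [| right; ring].
  apply Cline_int_le. apply Ctame_minus; auto.
  intros t. replace (4 * (M * A) * (y - x) ^ 2 / (1 + t ^ 2)) with (4 * (M * A / (1 + t ^ 2)) * (y - x) ^ 2).
  2: { field. apply Rgt_not_eq, one_sq_pos. }
  apply (Cder_taylor (fun y => bet c y t) (fun y => kap c y t) (fun y => kap1 c y t) p q); auto.
  - intros z Hz. apply Cder_bet; auto; lra.
  - intros z Hz. apply Cder_kap; lra.
  - intros z Hz. apply mker_mult_bound with (n := 1%nat) (c := c); auto; [unfold A; lra |].
    eapply Rle_trans. apply Cmod_minus_le. rewrite !Cmod_mult, Cmod_opp, pow_1.
    replace (A * (1 + t ^ 2)) with (2 * (1 + t ^ 2) * E + 2 * (1 + t ^ 2) * E) by (unfold A; ring).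
    apply Rplus_le_compat; apply Rmult_le_compat; try apply Cmod_ge_0.
    + apply Cmod_wpt_le; auto.
    + apply HE; auto. unfold Cminus. rewrite Re_plus. change (Re (- wpt c t)) with (- Re (wpt c t)).
      rewrite Re_wpt. cbn. apply Rabs_le; lra.
    + apply Cmod_1_wpt_le; auto.
    + apply HE; auto. unfold Cminus. rewrite !Re_plus, Re_wpt. cbn. apply Rabs_le; lra.
Qed.

Lemma is_derive_bet_int c x : 0 < c < 1 -> 0 < x ->
  is_derive (fun y => Re (Cline_int (bet c y))) x (- 4 * PI * (ln x / (1 + x))) /\
  is_derive (fun y => Im (Cline_int (bet c y))) x 0.
Proof.
  intros Hc Hx. destruct (bet_int_quadratic c (x / 2) (2 * x) Hc) as [K HK]; try lra.
  destruct (kap_int c x ltac:(lra) Hx) as [_ Ik].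
  assert (Q : forall y, Rabs (y - x) < x / 2 ->
    Cmod (Cline_int (bet c y) - Cline_int (bet c x) - RtoC (y - x) * RtoC (- 4 * PI * (ln x / (1 + x))))%C <= K * (y - x) ^ 2).
  { intros y Hy. apply Rabs_def2 in Hy. rewrite <- Ik. apply HK; lra. }
  split; apply is_derive_of_quadratic_bound with (d := x / 2) (K := K); try lra; intros y Hy; specialize (Q y Hy);
  (eapply Rle_trans; [| apply Q]).
  - eapply Rle_trans; [| apply Re_le_Cmod]. right. f_equal. unfold Cminus. rewrite !Re_plus.
    change (Re (- (RtoC (y - x) * RtoC (-4 * PI * (ln x / (1 + x)))))) with (- Re (RtoC (y - x) * RtoC (-4 * PI * (ln x / (1 + x))))).
    rewrite Re_mult. change (Re (- ?z)) with (- Re z). unfold RtoC at 1 2 3 4. cbn [Re Im fst snd Copp]. unfold Re. ring.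
  - eapply Rle_trans; [| apply Im_le_Cmod]. right. f_equal. unfold Cminus. rewrite !Im_plus.
    change (Im (- (RtoC (y - x) * RtoC (-4 * PI * (ln x / (1 + x)))))) with (- Im (RtoC (y - x) * RtoC (-4 * PI * (ln x / (1 + x))))).
    rewrite Im_mult. change (Im (- ?z)) with (- Im z). unfold RtoC at 1 2 3 4. cbn [Re Im fst snd Copp]. unfold Im. ring.
Qed.

Lemma bet_int_small c : 0 < c < 1 -> exists K, 0 <= K /\ forall y, 0 < y < 1 ->
  Cmod (Cline_int (bet c y)) <= K * (Rpower y (1 - c) + Rpower y c).
Proof.
  intros Hc. destruct (mker_bound c ltac:(lra)) as (M & M0 & HM).
  assert (ic : 0 < / c) by (apply Rinv_0_lt_compat; lra). assert (ic' : 0 < / (1 - c)) by (apply Rinv_0_lt_compat; lra).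
  assert (P := PI_RGT_0).
  exists (2 * PI * (M * (/ (1 - c) + / c))). split. pos.
  intros y Hy. assert (R1 : 0 < Rpower y (1 - c)) by apply exp_pos. assert (R2 : 0 < Rpower y c) by apply exp_pos.
  set (A := (/ (1 - c) + / c) * (Rpower y (1 - c) + Rpower y c)).
  assert (A0 : 0 <= A) by (unfold A; pos).
  replace (2 * PI * (M * (/ (1 - c) + / c)) * (Rpower y (1 - c) + Rpower y c)) with (2 * PI * (M * A)) by (unfold A; ring).
  apply Cline_int_le. apply bet_Ctame; lra.
  intros t. apply mker_mult_bound with (n := 0%nat) (c := c); auto.
  rewrite pow_O, Rmult_1_r. eapply Rle_trans. apply Cmod_minus_le. rewrite !Cmod_mult, !Cmod_Rcpow.
  unfold Cminus. rewrite Re_plus. change (Re (- wpt c t)) with (- Re (wpt c t)). rewrite Re_wpt, Re_RtoC.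
  assert (X1 := Cmod_inv_wpt c t Hc). assert (X2 := Cmod_inv_one_minus_wpt c t Hc). unfold Cminus in X2.
  change (1 + - c) with (1 - c).
  assert (Y1 : Rpower y (1 - c) * Cmod (/ (1 + - wpt c t))%C <= Rpower y (1 - c) * / (1 - c)) by (apply Rmult_le_compat_l; lra).
  assert (Y2 : Rpower y c * Cmod (/ wpt c t)%C <= Rpower y c * / c) by (apply Rmult_le_compat_l; lra).
  unfold A. assert (0 <= / (1 - c) * Rpower y c) by pos. assert (0 <= / c * Rpower y (1 - c)) by pos. lra.
Qed.

Lemma zero_of_exp_decay x K s : 0 < s -> (forall n : nat, Rabs x <= K * exp (- s * (INR n + 1))) -> x = 0.
Proof.
  intros Hs H. apply Rabs_eq_0. apply Rle_antisym; [| apply Rabs_pos].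
  apply Rnot_lt_le. intros Hx.
  destruct (INR_archimed (s * Rabs x) K ltac:(nra)) as [n Hn].
  assert (B := H n). assert (E := exp_ineq1_le (s * (INR n + 1))).
  replace (- s * (INR n + 1)) with (- (s * (INR n + 1))) in B by ring.
  rewrite exp_Ropp in B. assert (N := pos_INR n).
  assert (Y : Rabs x * exp (s * (INR n + 1)) <= K).
  { apply (Rmult_le_reg_r (/ exp (s * (INR n + 1)))). apply Rinv_0_lt_compat, exp_pos.
    rewrite Rmult_assoc, Rinv_r by (apply Rgt_not_eq, exp_pos). lra. }
  assert (Rabs x * (1 + s * (INR n + 1)) <= Rabs x * exp (s * (INR n + 1))) by (apply Rmult_le_compat_l; lra).
  nra.
Qed.

(** Both sides have the same derivative in y, by [kap_int], and both tend to 0 at 0. The constant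
    difference is evaluated at e^(-(n+1)), where it decays exponentially in n. *)
Lemma bet_int c y : 0 < c < 1 -> 0 < y -> Cline_int (bet c y) = RtoC (- 4 * PI * qfun y).
Proof.
  intros Hc Hy. assert (P := PI_RGT_0).
  destruct (bet_int_small c Hc) as (K & K0 & HK).
  (* The smallest of the exponents of decay at 0: c and 1 - c from [bet_int_small], 1/2 from
     [qfun_bound]. *)
  set (s := Rmin (Rmin c (1 - c)) (1 / 2)).
  assert (s1 : s <= c) by (eapply Rle_trans; [apply Rmin_l | apply Rmin_l]).
  assert (s2 : s <= 1 - c) by (eapply Rle_trans; [apply Rmin_l | apply Rmin_r]).
  assert (s3 : s <= 1 / 2) by apply Rmin_r.
  assert (s0 : 0 < s) by (repeat apply Rmin_pos; lra).
  assert (ee : forall u v, u <= v -> exp u <= exp v).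
  { intros u v [H | ->]; [left; apply exp_increasing; auto | lra]. }
  assert (Cst : forall f : R -> R, (forall x, 0 < x -> is_derive f x 0) ->
     (forall x, 0 < x < 1 -> Rabs (f x) <= K * (Rpower x (1 - c) + Rpower x c) + 12 * PI * sqrt x) -> f y = 0).
  { intros f Df Bf. apply zero_of_exp_decay with (K := 2 * K + 12 * PI) (s := s); auto.
    intros n. set (x := exp (- (INR n + 1))). assert (N := pos_INR n).
    assert (x0 : 0 < x) by apply exp_pos.
    assert (x1 : x < 1) by (rewrite <- exp_0; apply exp_increasing; lra).
    replace (f y) with (f x).
    2: { destruct (Rle_dec x y). apply zero_derivative_constant; auto. intros; apply Df; lra.
         symmetry. apply zero_derivative_constant; try lra. intros; apply Df; lra. }
    eapply Rle_trans. apply Bf; auto.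
    assert (B1 : Rpower x (1 - c) <= exp (- s * (INR n + 1))).
    { unfold Rpower. apply ee. unfold x. rewrite ln_exp. nra. }
    assert (B2 : Rpower x c <= exp (- s * (INR n + 1))).
    { unfold Rpower. apply ee. unfold x. rewrite ln_exp. nra. }
    assert (B3 : sqrt x <= exp (- s * (INR n + 1))).
    { rewrite <- Rpower_sqrt by auto. unfold Rpower. apply ee. unfold x. rewrite ln_exp. nra. }
    assert (E0 := exp_pos (- s * (INR n + 1))). nra. }
  apply C_eq.
  - rewrite Re_RtoC.
    assert (X : Re (Cline_int (bet c y)) + 4 * PI * qfun y = 0); [| lra].
    apply (Cst (fun y => Re (Cline_int (bet c y)) + 4 * PI * qfun y)).
    + intros x Hx. assert (D1 := proj1 (is_derive_bet_int c x Hc Hx)).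
      assert (D2 := is_derive_scal qfun x (4 * PI) _ (is_derive_qfun x Hx)).
      evar_last. apply (is_derive_plus (V := R_NormedModule)); [exact D1 | exact D2].
      unfold plus, mult; cbn. ring.
    + intros x Hx. eapply Rle_trans. apply Rabs_triang. apply Rplus_le_compat.
      eapply Rle_trans. apply Re_le_Cmod. auto.
      rewrite Rabs_mult, (Rabs_pos_eq (4 * PI)) by lra. assert (Q := qfun_bound x Hx). nra.
  - rewrite Im_RtoC. apply (Cst (fun y => Im (Cline_int (bet c y)))).
    + intros x Hx. exact (proj2 (is_derive_bet_int c x Hc Hx)).
    + intros x Hx. eapply Rle_trans. apply Im_le_Cmod. assert (X := HK x Hx). assert (S := sqrt_pos x). nra.
Qed.

(** * Series *)

Lemma is_series_telescope (c : nat -> R) (l : R) : is_lim_seq c l ->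
  is_series (fun k => c k - c (S k)) (c 0%nat - l).
Proof.
  intros H. change (is_lim_seq (sum_n (fun k => c k - c (S k))) (c 0%nat - l)).
  apply (is_lim_seq_ext (fun n => c 0%nat - c (S n))).
  - intros n. induction n.
    + rewrite sum_O. reflexivity.
    + rewrite sum_Sn, <- IHn. unfold plus; cbn. ring.
  - apply is_lim_seq_minus'. apply is_lim_seq_const. apply (is_lim_seq_incr_1 c). auto.
Qed.

Lemma Series_tail_lim (b : nat -> R) : ex_series b ->
  is_lim_seq (fun N => Series (fun k => b (N + k)%nat)) 0.
Proof.
  intros Hb. apply is_lim_seq_incr_1.
  apply is_lim_seq_ext with (fun N => Series b - sum_n b N).
  - intros N. rewrite (Series_incr_n b (S N)) by (auto; lia). rewrite sum_n_Reals. cbn [pred]. ring.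
  - replace 0 with (Series b - Series b) by ring. apply is_lim_seq_minus'. apply is_lim_seq_const.
    apply (Series_correct b Hb).
Qed.

Lemma is_lim_seq_Rpower s : 0 < s -> is_lim_seq (fun k => Rpower (INR (S k)) (- s)) 0.
Proof.
  intros Hs. unfold Rpower.
  apply (filterlim_comp _ _ _ (fun k => - s * ln (INR (S k))) exp _ (Rbar_locally m_infty)).
  - assert (L : is_lim_seq (fun k => ln (INR (S k))) p_infty).
    { apply (filterlim_comp _ _ _ (fun k => INR (S k)) ln _ (Rbar_locally p_infty)).
      apply (is_lim_seq_incr_1 INR), is_lim_seq_INR. apply is_lim_ln_p. }
    assert (M := is_lim_seq_scal_l _ (- s) _ L). cbn in M.
    destruct (Rle_dec 0 (- s)); [lra |]. exact M.
  - apply is_lim_exp_m.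
Qed.

(** By the mean value theorem every term after the first is at most a difference of consecutive
    values of n^(-s)/s, and these differences telescope. *)
Lemma ex_series_Rpower s : 0 < s -> ex_series (fun k => Rpower (INR (S k)) (- s - 1)).
Proof.
  intros Hs. apply ex_series_incr_1.
  apply (ex_series_le (V := R_CompleteNormedModule) _ (fun k => / s * (Rpower (INR (S k)) (- s) - Rpower (INR (S (S k))) (- s)))).
  - intros k. unfold norm; cbn [NormedModule.norm]. 
    set (x := INR (S k)). assert (x0 : 1 <= x) by (unfold x; rewrite S_INR; assert (P := pos_INR k); lra).
    replace (INR (S (S k))) with (x + 1) by (rewrite (S_INR (S k)); reflexivity).
    change (Rabs (Rpower (x + 1) (- s - 1)) <= / s * (Rpower x (- s) - Rpower (x + 1) (- s))).
    rewrite Rabs_pos_eq by (left; apply exp_pos).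
    destruct (MVT_gen (fun y => Rpower y (- s)) x (x + 1) (fun y => - s * Rpower y (- s - 1))) as [c [Hc E]].
    + intros y Hy. rewrite Rmin_left, Rmax_right in Hy by lra. apply is_derive_Reals, derivable_pt_lim_power. lra.
    + intros y Hy. rewrite Rmin_left, Rmax_right in Hy by lra. apply derivable_continuous_pt.
      exists (- s * Rpower y (- s - 1)). apply derivable_pt_lim_power. lra.
    + rewrite Rmin_left, Rmax_right in Hc by lra.
      replace (Rpower x (- s) - Rpower (x + 1) (- s)) with (s * Rpower c (- s - 1)) by lra.
      rewrite <- Rmult_assoc, Rinv_l, Rmult_1_l by lra.
      unfold Rpower. assert (L : ln c <= ln (x + 1)) by (apply ln_le; lra).
      assert (X : (- s - 1) * ln (x + 1) <= (- s - 1) * ln c) by nra.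
      destruct X as [X | ->]; [left; apply exp_increasing; auto | lra].
  - apply (ex_series_scal (K := R_AbsRing) (V := R_NormedModule)). eexists. apply (is_series_telescope (fun k => Rpower (INR (S k)) (- s))).
    apply is_lim_seq_Rpower; auto.
Qed.

Lemma Series_nonneg (b : nat -> R) : (forall k, 0 <= b k) -> ex_series b -> 0 <= Series b.
Proof.
  intros H Hb. assert (X : Series (fun k => 0 * b k) <= Series b).
  { apply Series_le; auto. intros n. assert (Y := H n). lra. }
  rewrite Series_scal_l in X. lra.
Qed.

(** * Finite sums over 1 <= n <= N, with half weight at N *)

Fixpoint csum (f : nat -> C) (N : nat) : C :=
  match N with O => 0%C | S n => (csum f n + f (S n))%C end.
(** At N = 0 this is -f(0)/2 rather than an empty sum, hence the hypothesis 1 <= N in the lemmas on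
    extensionality. *)
Definition ctrap (f : nat -> C) (N : nat) : C := (csum f N - RtoC (/ 2) * f N)%C.

Fixpoint rsum (f : nat -> R) (N : nat) : R :=
  match N with O => 0 | S n => rsum f n + f (S n) end.
Definition rtrap (f : nat -> R) (N : nat) : R := rsum f N - / 2 * f N.

Lemma csum_ext f g N : (forall n, (1 <= n <= N)%nat -> f n = g n) -> csum f N = csum g N.
Proof.
  induction N; intros H; cbn; auto. rewrite IHN, H; auto; try lia. intros; apply H; lia.
Qed.

Lemma ctrap_ext f g N : (1 <= N)%nat -> (forall n, (1 <= n <= N)%nat -> f n = g n) -> ctrap f N = ctrap g N.
Proof. intros HN H. unfold ctrap. rewrite (csum_ext f g N H), H; auto; lia. Qed.

Lemma ctrap_scal c f N : ctrap (fun n => c * f n)%C N = (c * ctrap f N)%C.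
Proof.
  unfold ctrap. assert (E : csum (fun n => c * f n)%C N = (c * csum f N)%C).
  { induction N; cbn. ring. rewrite IHN; ring. }
  rewrite E. ring.
Qed.

Lemma ctrap_plus f g N : ctrap (fun n => f n + g n)%C N = (ctrap f N + ctrap g N)%C.
Proof.
  unfold ctrap. assert (E : csum (fun n => f n + g n)%C N = (csum f N + csum g N)%C).
  { induction N; cbn. ring. rewrite IHN; ring. }
  rewrite E. ring.
Qed.

Lemma ctrap_lin a b f g N : ctrap (fun n => a * f n + b * g n)%C N = (a * ctrap f N + b * ctrap g N)%C.
Proof. rewrite ctrap_plus, !ctrap_scal. reflexivity. Qed.

Lemma ctrap_RtoC f N : ctrap (fun n => RtoC (f n)) N = RtoC (rtrap f N).
Proof.
  unfold ctrap, rtrap. assert (E : csum (fun n => RtoC (f n)) N = RtoC (rsum f N)).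
  { induction N; cbn. auto. rewrite IHN, RtoC_plus. auto. }
  rewrite E, RtoC_minus, RtoC_mult. auto.
Qed.

Lemma rsum_ext f g N : (forall n, (1 <= n <= N)%nat -> f n = g n) -> rsum f N = rsum g N.
Proof.
  induction N; intros H; cbn; auto. rewrite IHN, H; auto; try lia. intros; apply H; lia.
Qed.

Lemma rtrap_ext f g N : (1 <= N)%nat -> (forall n, (1 <= n <= N)%nat -> f n = g n) -> rtrap f N = rtrap g N.
Proof. intros HN H. unfold rtrap. rewrite (rsum_ext f g N H), H; auto; lia. Qed.

Lemma rtrap_lin a b f g N : rtrap (fun n => a * f n + b * g n) N = a * rtrap f N + b * rtrap g N.
Proof.
  unfold rtrap. assert (E : rsum (fun n => a * f n + b * g n) N = a * rsum f N + b * rsum g N).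
  { induction N; cbn. ring. rewrite IHN; ring. }
  rewrite E. ring.
Qed.

Lemma rtrap_scal a f N : rtrap (fun n => a * f n) N = a * rtrap f N.
Proof.
  unfold rtrap. assert (E : rsum (fun n => a * f n) N = a * rsum f N).
  { induction N; cbn. ring. rewrite IHN; ring. }
  rewrite E. ring.
Qed.

Lemma sum_n_csum (f : nat -> C) (N : nat) (r : C -> R) :
  (forall z w, r (z + w)%C = r z + r w) -> r 0%C = 0 ->
  sum_n (fun k => r (f (S k))) N = r (csum f (S N)).
Proof.
  intros Hr H0. induction N.
  - rewrite sum_O. cbn. rewrite Hr, H0. ring.
  - rewrite sum_Sn, IHN. change (csum f (S (S N))) with (csum f (S N) + f (S (S N)))%C. rewrite Hr. reflexivity.
Qed.

(** * Truncation of the zeta function *)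

Definition zeta_term (s : C) (n : nat) : C :=
  (Rcpow (INR n) (- s) - (Rcpow (INR n + 1) (1 - s) - Rcpow (INR n) (1 - s)) / (1 - s))%C.

Definition zetaN (N : nat) (s : C) : C :=
  (ctrap (fun n => Rcpow (INR n) (- s)) N - Rcpow (INR N) (1 - s) / (1 - s))%C.

Lemma Rpower_le_neg x y s : 0 < x -> x <= y -> 0 <= s -> Rpower y (- s) <= Rpower x (- s).
Proof.
  intros Hx xy Hs. unfold Rpower. assert (L : ln x <= ln y) by (apply ln_le; lra).
  assert (X : - s * ln y <= - s * ln x) by nra.
  destruct X as [X | ->]; [left; apply exp_increasing; auto | lra].
Qed.

(** The term compares n^(-s) with the integral of u^(-s) over [n, n + 1]. The derivative of the
    auxiliary G is u^(-s) - n^(-s), itself bounded through the derivative of u^(-s); two uses of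
    [Cder_mvt] give the factor 4. *)
Lemma zeta_term_bound s n : (1 <= n)%nat -> 0 < Re s -> (1 - s)%C <> 0%C ->
  Cmod (zeta_term s n) <= 4 * Cmod s * Rpower (INR n) (- Re s - 1).
Proof.
  intros Hn Hs H1. set (x := INR n).
  assert (x1 : 1 <= x) by (apply (le_INR 1); auto).
  assert (s0 := Cmod_ge_0 s). assert (p0 : 0 < Rpower x (- Re s - 1)) by apply exp_pos.
  set (B := Cmod s * Rpower x (- Re s - 1)). assert (B0 : 0 <= B) by (unfold B; nra).
  assert (DF : forall u, x <= u <= x + 1 -> Cmod (Rcpow u (- s) - Rcpow x (- s))%C <= 2 * B).
  { intros u Hu. apply Rle_trans with (2 * B * (u - x)); [| nra].
    apply (Cder_mvt (fun u => Rcpow u (- s)) (fun u => - s * Rcpow u (- s - 1))%C). lra.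
    - intros v Hv. apply Cder_Rcpow. lra.
    - intros v Hv. rewrite Cmod_mult, Cmod_opp, Cmod_Rcpow. unfold B. apply Rmult_le_compat_l; auto.
      replace (Re (- s - 1)%C) with (- (Re s + 1)) by (cbn; unfold Re; ring).
      replace (- Re s - 1) with (- (Re s + 1)) by ring. apply Rpower_le_neg; lra. }
  set (G := fun u => (Rcpow u (1 - s) * / (1 - s) - RtoC u * Rcpow x (- s))%C).
  replace (zeta_term s n) with (- (G (x + 1)%R - G x))%C.
  2: { unfold G, zeta_term. fold x. rewrite RtoC_plus. field. auto. }
  rewrite Cmod_opp. replace (4 * Cmod s * Rpower x (- Re s - 1)) with (2 * (2 * B) * (x + 1 - x)) by (unfold B; ring).
  apply (Cder_mvt G (fun u => Rcpow u (- s) - Rcpow x (- s))%C); [lra | | auto].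
  intros v Hv. unfold G. eapply Cder_eq. apply Cder_minus. apply Cder_mult. apply Cder_Rcpow; lra. apply Cder_const.
  apply Cder_mult. apply Cder_RtoC. apply is_derive_id. apply Cder_const.
  replace (1 - s - 1)%C with (- s)%C by ring. change (RtoC one) with (RtoC 1). field. auto.
Qed.

Lemma csum_zeta_term s N : (1 - s)%C <> 0%C ->
  csum (zeta_term s) N = (csum (fun n => Rcpow (INR n) (- s)) N - (Rcpow (INR (S N)) (1 - s) - 1) / (1 - s))%C.
Proof.
  intros H1. induction N.
  - cbn [csum]. replace (Rcpow (INR 1) (1 - s)) with (RtoC 1). field; auto.
    unfold Rcpow. cbn [INR]. rewrite ln_1, Cmult_0_r, Cexp_0. auto.
  - cbn [csum]. rewrite IHN. unfold zeta_term. rewrite (S_INR (S N)). field. auto.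
Qed.

Lemma CSeries_tail (a : nat -> C) (b : nat -> R) N : ex_series b -> (forall k, Cmod (a k) <= b k) ->
  Cmod (CSeries a - csum (fun n => a (pred n)) N)%C <= 2 * Series (fun k => b (N + k)%nat).
Proof.
  intros Hb Ha.
  assert (Eb : ex_series (fun k => b (N + k)%nat)) by (apply (ex_series_incr_n b N); auto).
  assert (K : forall r : C -> R, (forall z w, r (z + w)%C = r z + r w) -> r 0%C = 0 -> (forall z, Rabs (r z) <= Cmod z) ->
    Rabs (Series (fun k => r (a k)) - r (csum (fun n => a (pred n)) N)) <= Series (fun k => b (N + k)%nat)).
  { intros r Hr H0 Hc.
    assert (Ea : ex_series (fun k => Rabs (r (a k)))).
    { apply (ex_series_le (V := R_CompleteNormedModule) _ b); auto. intros n. 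
      change (Rabs (Rabs (r (a n))) <= b n). rewrite Rabs_Rabsolu. eapply Rle_trans; [apply Hc | apply Ha]. }
    assert (E : Series (fun k => r (a k)) - r (csum (fun n => a (pred n)) N) = Series (fun k => r (a (N + k)%nat))).
    { destruct N.
      - cbn [csum]. rewrite H0. rewrite Rminus_0_r. reflexivity.
      - rewrite (Series_incr_n _ (S N)) by (try lia; apply ex_series_Rabs; auto).
        rewrite <- sum_n_Reals. cbn [pred]. rewrite <- (sum_n_csum (fun n => a (pred n)) N r Hr H0). cbn [pred]. ring. }
    rewrite E. eapply Rle_trans. apply Series_Rabs. apply (ex_series_incr_n (fun k => Rabs (r (a k))) N); auto.
    apply Series_le; auto. intros k. split. apply Rabs_pos. eapply Rle_trans; [apply Hc | apply Ha]. }
  eapply Rle_trans. apply Cmod_le_Re_Im. unfold Cminus. rewrite Re_plus, Im_plus.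
  change (Re (- ?z)) with (- Re z). change (Im (- ?z)) with (- Im z).
  assert (K1 := K Re Re_plus eq_refl Re_le_Cmod). assert (K2 := K Im Im_plus eq_refl Im_le_Cmod).
  unfold CSeries. cbn [Re Im fst snd] in *. unfold Rminus in *. lra.
Qed.

(** The first part is the tail of the series: 4 from [zeta_term_bound], doubled by [CSeries_tail].
    The second part covers the half-weighted last term. *)
Definition zeta_err (sigma : R) (N : nat) : R :=
  8 * Series (fun k => Rpower (INR (S (N + k))) (- sigma - 1)) + Rpower (INR (S N)) (- sigma).

Lemma zeta_err_lim sigma : 0 < sigma -> is_lim_seq (zeta_err sigma) 0.
Proof.
  intros Hs. unfold zeta_err. replace 0 with (8 * 0 + 0) by ring.
  apply is_lim_seq_plus'. apply (is_lim_seq_scal_l _ 8 0).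
  apply (Series_tail_lim (fun k => Rpower (INR (S k)) (- sigma - 1))). apply ex_series_Rpower; auto.
  apply is_lim_seq_Rpower; auto.
Qed.

(** The first N terms of the series integrate up to N + 1, so they match the truncation at [S N];
    their lower end cancels the polar term 1/(s - 1). *)
Lemma zeta_zetaN s N : 0 < Re s -> (1 - s)%C <> 0%C ->
  Cmod (zeta s - zetaN (S N) s)%C <= (1 + Cmod s) * zeta_err (Re s) N.
Proof.
  intros Hs H1. set (b := fun k => Rpower (INR (S k)) (- Re s - 1)).
  assert (Eb : ex_series b) by (apply ex_series_Rpower; auto).
  assert (Eb4 : ex_series (fun k => 4 * Cmod s * b k)) by (apply (ex_series_scal (K := R_AbsRing) (V := R_NormedModule) (4 * Cmod s)); auto).
  assert (T := CSeries_tail (fun k => zeta_term s (S k)) (fun k => 4 * Cmod s * b k) N Eb4 (fun k => zeta_term_bound s (S k) ltac:(lia) Hs H1)).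
  rewrite (csum_ext _ (zeta_term s)) in T by (intros n Hn; destruct n; [lia | reflexivity]).
  rewrite csum_zeta_term, Series_scal_l in T by auto.
  assert (E : zeta s = (1 / (s - 1) + CSeries (fun k => zeta_term s (S k)))%C) by reflexivity.
  set (S0 := CSeries (fun k => zeta_term s (S k))) in *.
  set (A := csum (fun n => Rcpow (INR n) (- s)) N) in *.
  assert (Z : (zeta s - zetaN (S N) s)%C = ((S0 - (A - (Rcpow (INR (S N)) (1 - s) - 1) / (1 - s))) - RtoC (/ 2) * Rcpow (INR (S N)) (- s))%C).
  { rewrite E. unfold zetaN, ctrap. cbn [csum]. fold A. rewrite RtoC_inv by lra. field. split; auto.
    intros Z. apply H1. replace (1 - s)%C with (- (s - 1))%C by ring. rewrite Z. ring. }
  rewrite Z. eapply Rle_trans. apply Cmod_minus_le.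
  rewrite (Cmod_mult (RtoC (/ 2))), Cmod_R, Rabs_pos_eq, Cmod_Rcpow by lra.
  change (Re (- s)%C) with (- Re s).
  unfold zeta_err. fold (b N).
  change (fun k => Rpower (INR (S (N + k))) (- Re s - 1)) with (fun k => b (N + k)%nat).
  assert (P := Cmod_ge_0 s). assert (Q : 0 < Rpower (INR (S N)) (- Re s)) by apply exp_pos.
  assert (B0 : 0 <= Series (fun k => b (N + k)%nat)).
  { apply Series_nonneg. intros; left; apply exp_pos. apply (ex_series_incr_n b N); auto. }
  set (U := Series (fun k => b (N + k)%nat)) in *. set (V := Rpower (INR (S N)) (- Re s)) in *.
  assert (0 <= Cmod s * V) by nra. nra.
Qed.

(** * Zeta on vertical lines of the critical strip: continuity and growth *)

Lemma continuous_limit (f : nat -> R -> R) (g : R -> R) (K : R) (e : nat -> R) (t : R) :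
  (forall N, continuous (f N) t) -> is_lim_seq e 0 ->
  (forall N s, Rabs (s - t) <= 1 -> Rabs (g s - f N s) <= K * e N) -> continuous g t.
Proof.
  intros Hf He HK. apply continuity_pt_filterlim. intros eps Heps.
  assert (K1 : 0 < Rabs K + 1) by (assert (X := Rabs_pos K); lra).
  assert (E3 : 0 < eps / (4 * (Rabs K + 1))) by (apply Rdiv_lt_0_compat; lra).
  apply is_lim_seq_spec in He. destruct (He (mkposreal _ E3)) as [N HN]. specialize (HN N (le_n _)).
  cbn in HN. rewrite Rminus_0_r in HN.
  assert (Q : Rabs (K * e N) <= eps / 4).
  { rewrite Rabs_mult. apply Rle_trans with ((Rabs K + 1) * (eps / (4 * (Rabs K + 1)))).
    apply Rmult_le_compat; try apply Rabs_pos; lra. right; field; lra. }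
  assert (Cf := Hf N). apply continuity_pt_filterlim in Cf.
  destruct (Cf (eps / 4) ltac:(lra)) as (d & Hd & HC).
  exists (Rmin d 1). split. apply Rmin_pos; lra.
  intros s [Hs1 Hs2]. simpl in *. unfold R_dist in *.
  assert (B := HC s (conj Hs1 (Rlt_le_trans _ _ _ Hs2 (Rmin_l _ _)))).
  assert (s1 := Rlt_le_trans _ _ _ Hs2 (Rmin_r _ _)).
  assert (B1 := HK N s ltac:(lra)). assert (B2 := HK N t ltac:(replace (t - t) with 0 by ring; rewrite Rabs_R0; lra)).
  assert (Q1 := Rle_abs (K * e N)).
  replace (g s - g t) with ((g s - f N s) + (f N s - f N t) + - (g t - f N t)) by ring.
  eapply Rle_lt_trans. apply Rabs_triang. rewrite Rabs_Ropp.
  assert (T := Rabs_triang (g s - f N s) (f N s - f N t)). lra.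
Qed.

Lemma Ccont_csum (f : nat -> R -> C) N t : (forall n, Ccont (f n) t) -> Ccont (fun t => csum (fun n => f n t) N) t.
Proof. intros H. induction N; cbn [csum]. apply Ccont_const. apply Ccont_plus; auto. Qed.

Lemma Ccont_ctrap (f : nat -> R -> C) N t : (forall n, Ccont (f n) t) -> Ccont (fun t => ctrap (fun n => f n t) N) t.
Proof.
  intros H. unfold ctrap. apply Ccont_minus. apply Ccont_csum; auto. apply Ccont_mult; auto. apply Ccont_const.
Qed.

(* The estimates below hold for both factors zeta w and zeta (1 - w). *)
Definition strip_arg (s : R -> C) (sigma : R) :=
  0 < sigma /\ (forall t, Ccont s t) /\ (forall t, Re (s t) = sigma) /\
  (forall t, Cmod (s t) <= 2 * (1 + t ^ 2)) /\
  exists K, 0 < K /\ forall t, (1 - s t)%C <> 0%C /\ Cmod (/ (1 - s t))%C <= K.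

Lemma strip_arg_w c : 0 < c < 1 -> strip_arg (wpt c) c.
Proof.
  intros Hc. split; [lra | split; [| split; [| split]]].
  - intros t; apply Ccont_wpt.
  - intros t; apply Re_wpt.
  - intros t; apply Cmod_wpt_le; auto.
  - exists (/ (1 - c)). split. apply Rinv_0_lt_compat; lra.
    intros t; split; [apply one_minus_wpt_neq_0 | apply Cmod_inv_one_minus_wpt]; auto.
Qed.

Lemma strip_arg_1w c : 0 < c < 1 -> strip_arg (fun t => 1 - wpt c t)%C (1 - c).
Proof.
  intros Hc. split; [lra | split; [| split; [| split]]].
  - intros t; ccont.
  - intros t. change (1 - Re (wpt c t) = 1 - c). rewrite Re_wpt. auto.
  - intros t. rewrite <- Cmod_opp. replace (- (1 - wpt c t))%C with (wpt c t - 1)%C by ring. apply Cmod_1_wpt_le; auto.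
  - exists (/ c). split. apply Rinv_0_lt_compat; lra.
    intros t. replace (1 - (1 - wpt c t))%C with (wpt c t) by ring.
    split; [apply wpt_neq_0 | apply Cmod_inv_wpt]; auto.
Qed.

Section strip.
Variables (s : R -> C) (sigma : R).
Hypothesis Hs : strip_arg s sigma.

Lemma strip_zeta_diff N t : Cmod (zeta (s t) - zetaN (S N) (s t))%C <= 3 * (1 + t ^ 2) * zeta_err sigma N.
Proof.
  destruct Hs as (H0 & _ & Hre & Hm & K & K0 & HK). destruct (HK t) as [N1 _].
  eapply Rle_trans. apply zeta_zetaN; auto. rewrite Hre; auto. rewrite Hre.
  assert (0 <= zeta_err sigma N).
  { unfold zeta_err. assert (Q : 0 < Rpower (INR (S N)) (- sigma)) by apply exp_pos.
    assert (0 <= Series (fun k => Rpower (INR (S (N + k))) (- sigma - 1))); [| lra].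
    apply Series_nonneg. intros; left; apply exp_pos.
    apply (ex_series_incr_n (fun k => Rpower (INR (S k)) (- sigma - 1)) N). apply ex_series_Rpower; auto. }
  apply Rmult_le_compat_r; auto. specialize (Hm t). nra.
Qed.

Lemma strip_zetaN_cont N t : Ccont (fun t => zetaN N (s t)) t.
Proof.
  destruct Hs as (H0 & Hc & Hre & Hm & K & K0 & HK). destruct (HK t) as [N1 _].
  unfold zetaN. apply Ccont_minus. 
  - apply (Ccont_ctrap (fun n t => Rcpow (INR n) (- s t))). intros n. ccont. apply Hc.
  - unfold Cdiv. ccont; try apply Hc; auto.
Qed.

Lemma strip_zeta_cont t : Ccont (fun t => zeta (s t)) t.
Proof.
  destruct Hs as (H0 & _).
  assert (B : forall N u, Rabs (u - t) <= 1 -> Cmod (zeta (s u) - zetaN (S N) (s u))%C <= 3 * (1 + (Rabs t + 1) ^ 2) * zeta_err sigma N).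
  { intros N u Hu. eapply Rle_trans. apply strip_zeta_diff.
    assert (E : 0 <= zeta_err sigma N).
    { assert (X := strip_zeta_diff N 0). assert (Y := Cmod_ge_0 (zeta (s 0) - zetaN (S N) (s 0))%C). nra. }
    apply Rmult_le_compat_r; auto. apply Rmult_le_compat_l. lra. apply Rplus_le_compat_l.
    rewrite <- (pow2_abs u). apply pow_incr. split. apply Rabs_pos.
    replace u with (t + (u - t)) by ring. eapply Rle_trans. apply Rabs_triang. lra. }
  split.
  - apply continuous_limit with (f := fun N u => Re (zetaN (S N) (s u))) (K := 3 * (1 + (Rabs t + 1) ^ 2)) (e := zeta_err sigma).
    + intros N. apply (strip_zetaN_cont (S N) t).
    + apply zeta_err_lim; auto.
    + intros N u Hu. eapply Rle_trans; [| apply (B N u Hu)]. eapply Rle_trans; [| apply Re_le_Cmod]. right; reflexivity.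
  - apply continuous_limit with (f := fun N u => Im (zetaN (S N) (s u))) (K := 3 * (1 + (Rabs t + 1) ^ 2)) (e := zeta_err sigma).
    + intros N. apply (strip_zetaN_cont (S N) t).
    + apply zeta_err_lim; auto.
    + intros N u Hu. eapply Rle_trans; [| apply (B N u Hu)]. eapply Rle_trans; [| apply Im_le_Cmod]. right; reflexivity.
Qed.

Lemma zeta_err_bounds : exists E, 0 <= E /\ forall N, 0 <= zeta_err sigma N <= E.
Proof.
  destruct Hs as (H0 & _).
  assert (P : forall N, 0 <= zeta_err sigma N).
  { intros N. assert (X := strip_zeta_diff N 0). assert (Y := Cmod_ge_0 (zeta (s 0) - zetaN (S N) (s 0))%C). nra. }
  destruct (filterlim_bounded (K := R_AbsRing) (V := R_NormedModule) (zeta_err sigma)) as [E HE].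
  { exists 0. apply (zeta_err_lim sigma H0). }
  exists E. split. eapply Rle_trans; [| apply (HE 0%nat)]. apply (norm_ge_0 (V := R_NormedModule)).
  intros N. split; auto. eapply Rle_trans; [| apply (HE N)]. apply Rle_abs.
Qed.

(** Everything is compared with [zetaN 1], which is 1/2 - 1/(1 - s) and hence bounded on the line.
    The bound on the truncations is uniform in N, as domination requires. *)
Lemma strip_zeta_bound : exists A, 0 <= A /\ forall t,
  Cmod (zeta (s t)) <= A * (1 + t ^ 2) /\ forall N, Cmod (zetaN (S N) (s t)) <= A * (1 + t ^ 2).
Proof.
  destruct zeta_err_bounds as (E & E0 & HE).
  destruct Hs as (H0 & _ & Hre & Hm & K & K0 & HK).
  exists (6 * E + 1 + K). split. lra. intros t.
  destruct (HK t) as [N1 HKt].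
  assert (Pt := one_sq_pos t). assert (Pt1 : 1 <= 1 + t ^ 2) by nra.
  assert (D : forall N, Cmod (zeta (s t) - zetaN (S N) (s t))%C <= 3 * E * (1 + t ^ 2)).
  { intros N. eapply Rle_trans. apply strip_zeta_diff. assert (X := HE N). nra. }
  assert (B1 : Cmod (zetaN 1 (s t)) <= 1 + K).
  { unfold zetaN, ctrap. cbn [csum].
    assert (R1 : forall z, Rcpow (INR 1) z = 1%C).
    { intros z. unfold Rcpow. cbn [INR]. rewrite ln_1, Cmult_0_r, Cexp_0. auto. }
    rewrite !R1. replace (0 + 1 - RtoC (/ 2) * 1 - 1 / (1 - s t))%C with (RtoC (/ 2) - / (1 - s t))%C.
    2: { rewrite RtoC_inv by lra. field. auto. }
    eapply Rle_trans. apply Cmod_minus_le. rewrite Cmod_R, Rabs_pos_eq by lra. lra. }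
  assert (B2 : Cmod (zeta (s t)) <= 3 * E * (1 + t ^ 2) + (1 + K)).
  { replace (zeta (s t)) with ((zeta (s t) - zetaN 1 (s t)) + zetaN 1 (s t))%C by ring.
    eapply Rle_trans. apply Cmod_triangle. assert (X := D 0%nat). lra. }
  split. nra. intros N.
  replace (zetaN (S N) (s t)) with (zeta (s t) - (zeta (s t) - zetaN (S N) (s t)))%C by ring.
  eapply Rle_trans. apply Cmod_minus_le. assert (X := D N). nra.
Qed.
End strip.

Lemma Rcpow_wpt_bound c x : 0 < c < 1 -> 0 < x -> exists E, 0 < E /\ forall t,
  Cmod (Rcpow x (1 - wpt c t)) <= E /\ Cmod (Rcpow x (wpt c t)) <= E /\ Cmod (Rcpow x (- wpt c t)) <= E.
Proof.
  intros Hc Hx. destruct (Rcpow_bound x x Hx (Rle_refl _)) as (E & E0 & HE). exists E. split; auto.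
  intros t. repeat split; apply HE; try lra.
  - change (Rabs (1 - Re (wpt c t)) <= 2). rewrite Re_wpt. apply Rabs_le; lra.
  - rewrite Re_wpt. apply Rabs_le; lra.
  - change (Rabs (- Re (wpt c t)) <= 2). rewrite Re_wpt. apply Rabs_le; lra.
Qed.

Section limit.
Variables (c : R) (X : R -> C) (E : R).
Hypothesis Hc : 0 < c < 1.
Hypothesis HX : forall t, Ccont X t.
Hypothesis E0 : 0 < E.
Hypothesis HE : forall t, Cmod (X t) <= E.

(** The factor X is kept abstract because it is taken to be x^(-w), for H itself, and x^(1-w) - x^w,
    for the combination x H(x) - H(1/x). *)
Definition zz (t : R) : C := (mker c t * (zeta (wpt c t) * zeta (1 - wpt c t) * X t))%C.
Definition zzN (N : nat) (t : R) : C := (mker c t * (zetaN N (wpt c t) * zetaN N (1 - wpt c t) * X t))%C.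

Lemma zz_Ctame : Ctame zz.
Proof.
  destruct (strip_zeta_bound _ _ (strip_arg_w c Hc)) as (A & A0 & HA).
  destruct (strip_zeta_bound _ _ (strip_arg_1w c Hc)) as (B & B0 & HB).
  apply (mker_Ctame c (fun t => zeta (wpt c t) * zeta (1 - wpt c t) * X t)%C (A * B * E) 2); try lra; [| | lia |].
  - intros t. apply Ccont_mult; auto. apply Ccont_mult.
    apply (strip_zeta_cont _ _ (strip_arg_w c Hc)). apply (strip_zeta_cont _ _ (strip_arg_1w c Hc)).
  - apply Rmult_le_pos; nra.
  - intros t. rewrite !Cmod_mult. replace (A * B * E * (1 + t ^ 2) ^ 2) with (A * (1 + t ^ 2) * (B * (1 + t ^ 2)) * E) by ring.
    apply Rmult_le_compat; [apply Rmult_le_pos; apply Cmod_ge_0 | apply Cmod_ge_0 | | auto].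
    apply Rmult_le_compat; [apply Cmod_ge_0 | apply Cmod_ge_0 | exact (proj1 (HA t)) | exact (proj1 (HB t))].
Qed.

Lemma zzN_Ctame N : Ctame (zzN (S N)).
Proof.
  destruct (strip_zeta_bound _ _ (strip_arg_w c Hc)) as (A & A0 & HA).
  destruct (strip_zeta_bound _ _ (strip_arg_1w c Hc)) as (B & B0 & HB).
  apply (mker_Ctame c (fun t => zetaN (S N) (wpt c t) * zetaN (S N) (1 - wpt c t) * X t)%C (A * B * E) 2); try lra; [| | lia |].
  - intros t. apply Ccont_mult; auto. apply Ccont_mult.
    apply (strip_zetaN_cont _ _ (strip_arg_w c Hc)). apply (strip_zetaN_cont _ _ (strip_arg_1w c Hc)).
  - apply Rmult_le_pos; nra.
  - intros t. rewrite !Cmod_mult. replace (A * B * E * (1 + t ^ 2) ^ 2) with (A * (1 + t ^ 2) * (B * (1 + t ^ 2)) * E) by ring.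
    apply Rmult_le_compat; [apply Rmult_le_pos; apply Cmod_ge_0 | apply Cmod_ge_0 | | auto].
    apply Rmult_le_compat; [apply Cmod_ge_0 | apply Cmod_ge_0 | exact (proj2 (HA t) N) | exact (proj2 (HB t) N)].
Qed.

(** The difference of the two products is split so that each summand has one truncation error and
    one factor bounded uniformly in N. The growth (1 + t^2)^2 is absorbed by [mker]. *)
Lemma zzN_limit : exists e : nat -> R, is_lim_seq e 0 /\
  forall N, Cmod (Cline_int zz - Cline_int (zzN (S N)))%C <= e N.
Proof.
  destruct (strip_zeta_bound _ _ (strip_arg_w c Hc)) as (A & A0 & HA).
  destruct (strip_zeta_bound _ _ (strip_arg_1w c Hc)) as (B & B0 & HB).
  destruct (mker_bound c ltac:(lra)) as (M & M0 & HM).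
  exists (fun N => 2 * PI * (M * (3 * B * E * zeta_err c N + 3 * A * E * zeta_err (1 - c) N))). split.
  { replace 0 with (2 * PI * (M * (3 * B * E * 0 + 3 * A * E * 0))) by ring.
    apply (is_lim_seq_scal_l _ (2 * PI) (M * (3 * B * E * 0 + 3 * A * E * 0))).
    apply (is_lim_seq_scal_l _ M (3 * B * E * 0 + 3 * A * E * 0)).
    apply is_lim_seq_plus'.
    apply (is_lim_seq_scal_l _ (3 * B * E) 0). apply zeta_err_lim; lra.
    apply (is_lim_seq_scal_l _ (3 * A * E) 0). apply zeta_err_lim; lra. }
  intros N. rewrite <- Cline_int_minus by (apply zz_Ctame || apply zzN_Ctame).
  destruct (zeta_err_bounds _ _ (strip_arg_w c Hc)) as (E1 & _ & P1). specialize (P1 N).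
  destruct (zeta_err_bounds _ _ (strip_arg_1w c Hc)) as (E2 & _ & P2). specialize (P2 N).
  apply Cline_int_le. apply Ctame_minus; [apply zz_Ctame | apply zzN_Ctame].
  intros t. unfold zz, zzN.
  replace (mker c t * (zeta (wpt c t) * zeta (1 - wpt c t) * X t) - mker c t * (zetaN (S N) (wpt c t) * zetaN (S N) (1 - wpt c t) * X t))%C
   with (mker c t * (((zeta (wpt c t) - zetaN (S N) (wpt c t)) * zeta (1 - wpt c t) + zetaN (S N) (wpt c t) * (zeta (1 - wpt c t) - zetaN (S N) (1 - wpt c t))) * X t))%C by ring.
  apply mker_mult_bound with (n := 2%nat) (c := c); auto.
  { apply Rplus_le_le_0_compat; apply Rmult_le_pos; try lra; pos; lra. }
  rewrite Cmod_mult.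
  replace ((3 * B * E * zeta_err c N + 3 * A * E * zeta_err (1 - c) N) * (1 + t ^ 2) ^ 2) with
    ((3 * (1 + t ^ 2) * zeta_err c N * (B * (1 + t ^ 2)) + A * (1 + t ^ 2) * (3 * (1 + t ^ 2) * zeta_err (1 - c) N)) * E) by ring.
  apply Rmult_le_compat; auto; try apply Cmod_ge_0.
  eapply Rle_trans. apply Cmod_triangle. rewrite !Cmod_mult.
  apply Rplus_le_compat; apply Rmult_le_compat; try apply Cmod_ge_0.
  - exact (strip_zeta_diff _ _ (strip_arg_w c Hc) N t).
  - exact (proj1 (HB t)).
  - exact (proj2 (HA t) N).
  - exact (strip_zeta_diff _ _ (strip_arg_1w c Hc) N t).
Qed.
End limit.

Lemma Cline_int_ctrap (f : nat -> R -> C) N : (1 <= N)%nat -> (forall n, (1 <= n)%nat -> Ctame (f n)) ->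
  Ctame (fun t => ctrap (fun n => f n t) N) /\
  Cline_int (fun t => ctrap (fun n => f n t) N) = ctrap (fun n => Cline_int (f n)) N.
Proof.
  intros HN Hf.
  assert (Z : Ctame (fun _ => 0%C) /\ Cline_int (fun _ => 0%C) = 0%C).
  { assert (T := Ctame_scal 0%C _ (Hf 1%nat (le_n _))). split.
    - apply Ctame_ext with (2 := T). intros; ring.
    - rewrite (Cline_int_ext _ (fun t => 0 * f 1%nat t)%C) by (intros; ring). rewrite Cline_int_scal by auto. ring. }
  assert (S : forall M, Ctame (fun t => csum (fun n => f n t) M) /\ Cline_int (fun t => csum (fun n => f n t) M) = csum (fun n => Cline_int (f n)) M).
  { induction M as [| M [IH1 IH2]]; cbn [csum]. exact Z. split.
    - apply Ctame_plus; auto. apply Hf; lia.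
    - rewrite Cline_int_plus, IH2; auto. apply Hf; lia. }
  destruct (S N) as [S1 S2]. unfold ctrap.
  assert (T := Ctame_scal (RtoC (/ 2)) _ (Hf N HN)). split.
  - apply Ctame_minus; auto.
  - rewrite (Cline_int_minus _ _ S1 T), S2, Cline_int_scal; auto.
Qed.

(** * The truncated integral as a finite sum *)

Definition kfun (y : R) : R := ln y / (1 + y).

(** Write the truncations of zeta(w) and zeta(1 - w) as A - P and B - Q, sums minus power terms. The
    first line is the transform of AB, the next two together are that of the mixed products, the
    last that of PQ, all divided by -4 pi. *)
Definition Theta (N : nat) (x : R) : R :=
  rtrap (fun n => rtrap (fun m => x / INR m * kfun (INR n * x / INR m)) N) N
  - rtrap (fun m => qfun (INR N * x / INR m)) N
  + x * rtrap (fun n => qfun (INR N / (INR n * x))) N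
  + INR N * (qfun x - x * qfun (/ x)).

Definition Theta_integrand (c : R) (N : nat) (x t : R) : C :=
  (ctrap (fun n => ctrap (fun m => RtoC (x / INR m) * kap c (INR n * x / INR m) t) N) N
  - ctrap (fun m => bet c (INR N * x / INR m) t) N
  + RtoC x * ctrap (fun n => bet c (INR N / (INR n * x)) t) N
  + RtoC (INR N) * (bet c x t - RtoC x * bet c (/ x) t))%C.

Lemma INR_gt_0 n : (1 <= n)%nat -> 0 < INR n.
Proof. intros H. apply (lt_INR 0). lia. Qed.

(** An exact expansion of (A - P)(B - Q)(X - Y) with X = x^(1-w) and Y = x^w. The mixed monomials
    must be regrouped: PXB goes with QYA, and PYB with QXA, since only these pairs have the shape of
    [bet]. In the product PQ the factor N appears as N^(1-w) N^w. *)
Lemma Theta_integrand_eq c N x t : (1 <= N)%nat -> 0 < x -> 0 < c < 1 ->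
  Theta_integrand c N x t = zzN c (fun t => Rcpow x (1 - wpt c t) - Rcpow x (wpt c t))%C N t.
Proof.
  intros HN Hx Hc. set (w := wpt c t).
  assert (N1 : w <> 0%C) by (apply wpt_neq_0; auto). assert (N2 : (1 - w)%C <> 0%C) by (apply one_minus_wpt_neq_0; auto).
  set (A := ctrap (fun n => Rcpow (INR n) (- w)) N). set (B := ctrap (fun n => Rcpow (INR n) (w - 1)) N).
  set (P := (Rcpow (INR N) (1 - w) / (1 - w))%C). set (Q := (Rcpow (INR N) w / w)%C).
  set (X := Rcpow x (1 - w)). set (Y := Rcpow x w). set (mk := mker c t).
  assert (ix : 0 < / x) by (apply Rinv_0_lt_compat; auto). assert (PN := INR_gt_0 N HN).
  assert (EX : Rcpow x (- w) = (RtoC (/ x) * X)%C).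
  { unfold X. replace (- w)%C with (- (1) + (1 - w))%C by ring. rewrite Rcpow_add. f_equal.
    rewrite <- Rcpow_inv, Rcpow_1; auto. }
  assert (EY : Rcpow x (w - 1) = (RtoC (/ x) * Y)%C).
  { unfold Y. replace (w - 1)%C with (- (1) + w)%C by ring. rewrite Rcpow_add. f_equal.
    rewrite <- Rcpow_inv, Rcpow_1; auto. }
  assert (Eneg : forall a s, 0 < a -> Rcpow (/ a) s = Rcpow a (- s)) by (intros; apply Rcpow_inv; auto).
  assert (xi : RtoC (/ x) = (/ RtoC x)%C) by (apply RtoC_inv; lra).
  assert (x0 : RtoC x <> 0%C) by (intros E; apply RtoC_inj in E; lra).
  assert (H1 : ctrap (fun n => ctrap (fun m => RtoC (x / INR m) * kap c (INR n * x / INR m) t)%C N) N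
     = (mk * (X * A * B - Y * A * B))%C).
  { transitivity (ctrap (fun n => (mk * X * B) * Rcpow (INR n) (- w) + (- mk * Y * A) * Rcpow (INR n) (w - 1))%C N).
    2: { rewrite ctrap_lin. fold A B. ring. }
    apply ctrap_ext; auto. intros n Hn. assert (Pn := INR_gt_0 n ltac:(lia)).
    transitivity (ctrap (fun m => (mk * X * Rcpow (INR n) (- w)) * Rcpow (INR m) (w - 1) + (- mk * Y * Rcpow (INR n) (w - 1)) * Rcpow (INR m) (- w))%C N).
    2: { rewrite ctrap_lin. fold A B. ring. }
    apply ctrap_ext; auto. intros m Hm. assert (Pm := INR_gt_0 m ltac:(lia)).
    assert (im : 0 < / INR m) by (apply Rinv_0_lt_compat; auto).
    unfold kap. fold w mk. unfold Rdiv. rewrite !Rcpow_mult, !Eneg, EX, EY by (try apply Rmult_lt_0_compat; auto).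
    replace (- - w)%C with w by ring.
    assert (E1 : Rcpow (INR m) w = (RtoC (INR m) * Rcpow (INR m) (w - 1))%C).
    { rewrite <- (Rcpow_1 (INR m)), <- Rcpow_add by auto. f_equal. ring. }
    assert (E2 : Rcpow (INR m) (- (w - 1)) = (RtoC (INR m) * Rcpow (INR m) (- w))%C).
    { rewrite <- (Rcpow_1 (INR m)), <- Rcpow_add by auto. f_equal. ring. }
    rewrite E1, E2, !RtoC_mult, RtoC_inv, xi by lra. unfold Cminus. field. split; auto.
    intros E; apply RtoC_inj in E; lra. }
  assert (H2 : ctrap (fun m => bet c (INR N * x / INR m) t) N = (mk * (P * X * B - Q * Y * A))%C).
  { transitivity (ctrap (fun m => (mk * P * X) * Rcpow (INR m) (w - 1) + (- mk * Q * Y) * Rcpow (INR m) (- w))%C N).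
    2: { rewrite ctrap_lin. fold A B. ring. }
    apply ctrap_ext; auto. intros m Hm. assert (Pm := INR_gt_0 m ltac:(lia)).
    assert (im : 0 < / INR m) by (apply Rinv_0_lt_compat; auto).
    unfold bet. fold w mk. unfold Rdiv. rewrite !Rcpow_mult, !Eneg by (try apply Rmult_lt_0_compat; auto).
    fold X Y. replace (- (1 - w))%C with (w - 1)%C by ring. unfold P, Q. field. auto. }
  assert (H3 : ctrap (fun n => bet c (INR N / (INR n * x)) t) N = (mk * RtoC (/ x) * (P * Y * B - Q * X * A))%C).
  { transitivity (ctrap (fun n => (mk * RtoC (/ x) * P * Y) * Rcpow (INR n) (w - 1) + (- mk * RtoC (/ x) * Q * X) * Rcpow (INR n) (- w))%C N).
    2: { rewrite ctrap_lin. fold A B. ring. }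
    apply ctrap_ext; auto. intros n Hn. assert (Pn := INR_gt_0 n ltac:(lia)).
    assert (inn : 0 < / INR n) by (apply Rinv_0_lt_compat; auto).
    unfold bet. fold w mk. unfold Rdiv. rewrite Rinv_mult, !Rcpow_mult, !Eneg by (try apply Rmult_lt_0_compat; auto).
    replace (- (1 - w))%C with (w - 1)%C by ring. rewrite EX, EY. unfold P, Q. field. auto. }
  assert (H4 : (RtoC (INR N) * (bet c x t - RtoC x * bet c (/ x) t))%C = (mk * (P * Q * (X - Y)))%C).
  { unfold bet. fold w mk. rewrite !Eneg by auto. fold X Y. replace (- (1 - w))%C with (w - 1)%C by ring. rewrite EX, EY, xi.
    replace (RtoC (INR N)) with (Rcpow (INR N) (1 - w) * Rcpow (INR N) w)%C.
    unfold P, Q. field. auto.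
    rewrite <- Rcpow_add. replace (1 - w + w)%C with (RtoC 1) by ring. apply Rcpow_1; auto. }
  unfold Theta_integrand. rewrite H1, H2, H3, H4. unfold zzN. fold w mk.
  replace (zetaN N w) with (A - P)%C by reflexivity.
  replace (zetaN N (1 - w)) with (B - Q)%C.
  fold X Y. rewrite xi. field. auto.
  unfold zetaN. replace (- (1 - w))%C with (w - 1)%C by ring. replace (1 - (1 - w))%C with w by ring. reflexivity.
Qed.

Lemma Theta_integrand_int c N x : (1 <= N)%nat -> 0 < x -> 0 < c < 1 ->
  Cline_int (Theta_integrand c N x) = RtoC (- 4 * PI * Theta N x).
Proof.
  intros HN Hx Hc. assert (PN := INR_gt_0 N HN).
  assert (ix : 0 < / x) by (apply Rinv_0_lt_compat; auto).
  assert (Pos : forall m y, (1 <= m)%nat -> 0 < y -> 0 < y / INR m) by (intros; apply Rdiv_lt_0_compat; auto; apply INR_gt_0; auto).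
  assert (K : forall n m, (1 <= n)%nat -> (1 <= m)%nat ->
    Ctame (fun t => RtoC (x / INR m) * kap c (INR n * x / INR m) t)%C /\
    Cline_int (fun t => RtoC (x / INR m) * kap c (INR n * x / INR m) t)%C = RtoC (- 4 * PI * (x / INR m * kfun (INR n * x / INR m)))).
  { intros n m Hn Hm. assert (Pn := INR_gt_0 n Hn).
    destruct (kap_int c (INR n * x / INR m)) as [T I]; try lra. apply Pos; auto. apply Rmult_lt_0_compat; auto.
    split. apply Ctame_scal; auto. rewrite Cline_int_scal by auto. 
    transitivity (RtoC (x / INR m) * RtoC (-4 * PI * kfun (INR n * x / INR m)))%C. f_equal. exact I.
    rewrite <- RtoC_mult. f_equal. ring. }
  assert (T1 : forall n, (1 <= n)%nat -> Ctame (fun t => ctrap (fun m => RtoC (x / INR m) * kap c (INR n * x / INR m) t)%C N) /\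
    Cline_int (fun t => ctrap (fun m => RtoC (x / INR m) * kap c (INR n * x / INR m) t)%C N) = RtoC (- 4 * PI * rtrap (fun m => x / INR m * kfun (INR n * x / INR m)) N)).
  { intros n Hn. destruct (Cline_int_ctrap (fun m t => RtoC (x / INR m) * kap c (INR n * x / INR m) t)%C N HN) as [U V].
    intros; apply K; auto. split; auto. rewrite V.
    rewrite <- rtrap_scal, <- ctrap_RtoC. apply ctrap_ext; auto. intros m Hm. apply K; auto. lia. }
  destruct (Cline_int_ctrap (fun n t => ctrap (fun m => RtoC (x / INR m) * kap c (INR n * x / INR m) t)%C N) N HN) as [U1 V1].
  { intros; apply T1; auto. }
  destruct (Cline_int_ctrap (fun m t => bet c (INR N * x / INR m) t) N HN) as [U2 V2].
  { intros m Hm. apply bet_Ctame; auto. apply Pos; auto. apply Rmult_lt_0_compat; auto. }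
  assert (Pos3 : forall n, (1 <= n)%nat -> 0 < INR N / (INR n * x)).
  { intros. apply Rdiv_lt_0_compat; auto. apply Rmult_lt_0_compat; auto. apply INR_gt_0; auto. }
  destruct (Cline_int_ctrap (fun n t => bet c (INR N / (INR n * x)) t) N HN) as [U3 V3].
  { intros n Hn. apply bet_Ctame; auto. }
  assert (W1 : Cline_int (fun t => ctrap (fun n => ctrap (fun m => RtoC (x / INR m) * kap c (INR n * x / INR m) t)%C N) N)
     = RtoC (- 4 * PI * rtrap (fun n => rtrap (fun m => x / INR m * kfun (INR n * x / INR m)) N) N)).
  { rewrite V1, <- rtrap_scal, <- ctrap_RtoC. apply ctrap_ext; auto. intros n Hn. apply T1. lia. }
  assert (W2 : Cline_int (fun t => ctrap (fun m => bet c (INR N * x / INR m) t) N) = RtoC (- 4 * PI * rtrap (fun m => qfun (INR N * x / INR m)) N)).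
  { rewrite V2, <- rtrap_scal, <- ctrap_RtoC. apply ctrap_ext; auto. intros m Hm. apply bet_int; auto. apply Pos. lia. apply Rmult_lt_0_compat; auto. }
  assert (W3 : Cline_int (fun t => ctrap (fun n => bet c (INR N / (INR n * x)) t) N) = RtoC (- 4 * PI * rtrap (fun n => qfun (INR N / (INR n * x))) N)).
  { rewrite V3, <- rtrap_scal, <- ctrap_RtoC. apply ctrap_ext; auto. intros n Hn. apply bet_int; auto. apply Pos3; lia. }
  assert (B1 := bet_Ctame c x Hc Hx). assert (B2 := bet_Ctame c (/ x) Hc ix).
  assert (B2' := Ctame_scal (RtoC x) _ B2). assert (B3 := Ctame_minus _ _ B1 B2'). assert (B4 := Ctame_scal (RtoC (INR N)) _ B3).
  assert (U3' := Ctame_scal (RtoC x) _ U3). assert (S12 := Ctame_minus _ _ U1 U2). assert (S3 := Ctame_plus _ _ S12 U3').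
  unfold Theta_integrand.
  rewrite (Cline_int_plus _ _ S3 B4), (Cline_int_plus _ _ S12 U3'), (Cline_int_minus _ _ U1 U2), (Cline_int_scal _ _ U3), (Cline_int_scal _ _ B3), (Cline_int_minus _ _ B1 B2'), (Cline_int_scal _ _ B2).
  rewrite W1, W2, W3.
  change (Cline_int (fun t => bet c x t)) with (Cline_int (bet c x)). change (Cline_int (fun t => bet c (/ x) t)) with (Cline_int (bet c (/ x))).
  rewrite !bet_int by auto. unfold Theta.
  rewrite <- !RtoC_mult, <- !RtoC_minus, <- !RtoC_mult, <- !RtoC_plus. f_equal. ring.
Qed.

Lemma scrH_eq c x : 0 < c < 1 -> 0 < x ->
  Ctame (zz c (fun t => Rcpow x (- wpt c t))) /\
  scrH c x = (RtoC (/ (2 * PI)) * Cline_int (zz c (fun t => Rcpow x (- wpt c t))))%C.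
Proof.
  intros Hc Hx. destruct (Rcpow_wpt_bound c x Hc Hx) as (E & E0 & HE).
  assert (T : Ctame (zz c (fun t => Rcpow x (- wpt c t)))).
  { apply zz_Ctame with E; auto. intros t; ccont. intros t; apply HE. }
  split; auto. unfold scrH.
  set (F := fun w : C => _).
  assert (EF : forall t, zz c (fun t => Rcpow x (- wpt c t)) t = F (RtoC c + Ci * RtoC t)%C).
  { intros t. unfold F. fold (wpt c t). rewrite scrH_kernel by auto. reflexivity. }
  rewrite vertical_integral_eq by (apply Ctame_ext with (1 := EF); auto).
  rewrite <- (Cline_int_ext _ _ EF). assert (P := PI_RGT_0).
  rewrite RtoC_inv, RtoC_mult by lra. field. split; [apply RtoC_PI_neq_0 |].
  intros Z. injection Z. lra.
Qed.

(** Since x x^(-w) - (1/x)^(-w) = x^(1-w) - x^w, both values of H are integrals over the same line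
    and combine into one. Its truncations are real, hence so is the limit; -2 is -4 pi divided by 2
    pi. *)
Lemma scrH_antisymmetric_part c x : 0 < c < 1 -> 0 < x -> exists h : R,
  (RtoC x * scrH c x - scrH c (/ x))%C = RtoC h /\ is_lim_seq (fun N => - 2 * Theta (S N) x) h.
Proof.
  intros Hc Hx. assert (ix : 0 < / x) by (apply Rinv_0_lt_compat; auto). assert (P := PI_RGT_0).
  destruct (scrH_eq c x Hc Hx) as [T1 E1]. destruct (scrH_eq c (/ x) Hc ix) as [T2 E2].
  set (X := fun t => (Rcpow x (1 - wpt c t) - Rcpow x (wpt c t))%C).
  assert (D : (RtoC x * scrH c x - scrH c (/ x))%C = (RtoC (/ (2 * PI)) * Cline_int (zz c X))%C).
  { rewrite E1, E2.
    rewrite (Cline_int_ext (zz c X) (fun t => RtoC x * zz c (fun t => Rcpow x (- wpt c t)) t - zz c (fun t => Rcpow (/ x) (- wpt c t)) t)%C).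
    - rewrite Cline_int_minus, Cline_int_scal; auto. ring. apply Ctame_scal; auto.
    - intros t. unfold zz, X. rewrite Rcpow_inv by auto. replace (- - wpt c t)%C with (wpt c t) by ring.
      replace (Rcpow x (1 - wpt c t)) with (RtoC x * Rcpow x (- wpt c t))%C. ring.
      rewrite <- (Rcpow_1 x) at 1 by auto. rewrite <- Rcpow_add. f_equal; ring. }
  destruct (Rcpow_wpt_bound c x Hc Hx) as (E & E0 & HE).
  destruct (zzN_limit c X (E + E) Hc) as (e & He & HeN).
  { intros t. unfold X. ccont. }
  { lra. }
  { intros t. unfold X. eapply Rle_trans. apply Cmod_minus_le. apply Rplus_le_compat; apply HE. }
  assert (V : forall N, Cline_int (zzN c X (S N)) = RtoC (- 4 * PI * Theta (S N) x)).
  { intros N. rewrite <- (Theta_integrand_int c) by (auto; lia). apply Cline_int_ext.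
    intros t. symmetry. apply Theta_integrand_eq; auto. lia. }
  set (Z := Cline_int (zz c X)) in *.
  assert (B : forall N, Rabs (Re Z - - 4 * PI * Theta (S N) x) <= e N /\ Rabs (Im Z) <= e N).
  { intros N. specialize (HeN N). rewrite V in HeN. split.
    - eapply Rle_trans; [| apply HeN]. eapply Rle_trans; [| apply Re_le_Cmod]. right; reflexivity.
    - eapply Rle_trans; [| apply HeN]. eapply Rle_trans; [| apply Im_le_Cmod]. right. cbn. f_equal. unfold Im. ring. }
  assert (I0 : Im Z = 0).
  { apply Rabs_eq_0. apply Rle_antisym; [| apply Rabs_pos].
    apply (is_lim_seq_le (fun _ => Rabs (Im Z)) e (Rabs (Im Z)) 0); auto. intros; apply B. apply is_lim_seq_const. }
  exists (/ (2 * PI) * Re Z). split.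
  - rewrite D. assert (EZ : Z = RtoC (Re Z)) by (apply C_eq; [reflexivity | rewrite I0; reflexivity]).
    rewrite EZ at 1. rewrite <- RtoC_mult. reflexivity.
  - assert (L : is_lim_seq (fun N => Re Z - - 4 * PI * Theta (S N) x) 0).
    { apply is_lim_seq_abs_0. apply is_lim_seq_le_le with (fun _ => 0) e; auto. intros N; split; [apply Rabs_pos | apply B]. apply is_lim_seq_const. }
    apply is_lim_seq_ext with (fun N => / (2 * PI) * (Re Z - (Re Z - - 4 * PI * Theta (S N) x))).
    + intros N. field. lra.
    + replace (/ (2 * PI) * Re Z) with (/ (2 * PI) * (Re Z - 0)) by ring.
      apply (is_lim_seq_scal_l _ (/ (2 * PI)) (Re Z - 0)). apply is_lim_seq_minus'; auto. apply is_lim_seq_const.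
Qed.

(** * The function g and its trapezoidal truncations *)

Definition hker (y u : R) : R := ln (1 + u / y) / (u + y).

Definition hker_err (y : R) (k : nat) : R :=
  (hker y (INR k) + hker y (INR k + 1)) / 2
  - (ln (1 + (INR k + 1) / y) ^ 2 / 2 - ln (1 + INR k / y) ^ 2 / 2).

(** The integral of [hker y] over [0, N] is half the squared logarithm. As [hker y 0] vanishes, the
    half weight at 0 leaves no trace and the sum may start at 1. *)
Definition gN (N : nat) (y : R) : R := ln (1 + INR N / y) ^ 2 / 2 - rtrap (fun k => hker y (INR k)) N.

(** The integral and the sum diverge separately, so their difference is taken interval by interval:
    minus the sum of the trapezoidal errors. *)
Definition gfun (y : R) : R := - Series (hker_err y).

Definition Gsum (x : R) : R := Series (fun n => gfun (INR (S n) * x)).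

Fixpoint rsum0 (f : nat -> R) (N : nat) : R :=
  match N with O => 0 | S n => rsum0 f n + f n end.

Lemma rsum0_Series_bound f b N : ex_series b -> (forall k, Rabs (f k) <= b k) ->
  Rabs (Series f - rsum0 f N) <= Series (fun k => b (N + k)%nat) /\ ex_series f.
Proof.
  intros Hb Hf.
  assert (Ea : ex_series (fun k => Rabs (f k))).
  { apply (ex_series_le (V := R_CompleteNormedModule) _ b); auto. intros n.
    change (Rabs (Rabs (f n)) <= b n). rewrite Rabs_Rabsolu. auto. }
  assert (Ef : ex_series f) by (apply ex_series_Rabs; auto). split; auto.
  assert (E : Series f - rsum0 f N = Series (fun k => f (N + k)%nat)).
  { destruct N.
    - cbn [rsum0]. rewrite Rminus_0_r. reflexivity.
    - rewrite (Series_incr_n _ (S N)) by (auto; lia). cbn [pred].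
      replace (rsum0 f (S N)) with (sum_f_R0 f N). ring.
      clear. induction N; cbn in *. ring. rewrite IHN. ring. }
  rewrite E. eapply Rle_trans. apply Series_Rabs. apply (ex_series_incr_n (fun k => Rabs (f k)) N); auto.
  apply Series_le. intros k; split; [apply Rabs_pos | auto]. apply (ex_series_incr_n b N); auto.
Qed.

Lemma rsum0_lim f l : is_lim_seq (fun N => rsum0 f N) l <-> is_lim_seq (fun N => sum_n f N) l.
Proof.
  assert (E : forall N, rsum0 f (S N) = sum_n f N).
  { induction N. rewrite sum_O. cbn. ring. rewrite sum_Sn, <- IHN. reflexivity. }
  split; intros H.
  - apply is_lim_seq_ext with (1 := E). apply (is_lim_seq_incr_1 (rsum0 f)). auto.
  - apply is_lim_seq_incr_1. apply is_lim_seq_ext with (2 := H). intros; symmetry; auto.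
Qed.

Lemma rsum0_trap f N : rsum0 (fun k => (f k + f (S k)) / 2) N = rtrap f N + f 0%nat / 2.
Proof.
  unfold rtrap. induction N; cbn [rsum0 rsum]. field. rewrite IHN. field.
Qed.

Lemma rsum0_telescope f N : rsum0 (fun k => f (S k) - f k) N = f N - f 0%nat.
Proof. induction N; cbn [rsum0]. ring. rewrite IHN. ring. Qed.

Lemma rsum0_minus f g N : rsum0 (fun k => f k - g k) N = rsum0 f N - rsum0 g N.
Proof. induction N; cbn [rsum0]. ring. rewrite IHN. ring. Qed.

Lemma rsum0_ext f g N : (forall k, f k = g k) -> rsum0 f N = rsum0 g N.
Proof. intros H. induction N; cbn [rsum0]; auto. rewrite IHN, H. auto. Qed.

Lemma rsum0_abs_le f b N : (forall k, (k < N)%nat -> Rabs (f k) <= b k) -> Rabs (rsum0 f N) <= rsum0 b N.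
Proof.
  intros H. induction N; cbn [rsum0]. rewrite Rabs_R0; lra.
  eapply Rle_trans. apply Rabs_triang. apply Rplus_le_compat; auto.
Qed.

Lemma rsum_rsum0 f N : rsum f N = rsum0 (fun k => f (S k)) N.
Proof. induction N; cbn; auto. rewrite IHN; auto. Qed.

Lemma gN_eq N y : gN N y = - rsum0 (hker_err y) N.
Proof.
  unfold gN, hker_err. rewrite rsum0_minus.
  rewrite (rsum0_ext (fun k => (hker y (INR k) + hker y (INR k + 1)) / 2) (fun k => (hker y (INR k) + hker y (INR (S k))) / 2)) by (intros; rewrite S_INR; auto).
  rewrite (rsum0_trap (fun k => hker y (INR k))).
  rewrite (rsum0_ext _ (fun k => ln (1 + INR (S k) / y) ^ 2 / 2 - ln (1 + INR k / y) ^ 2 / 2)) by (intros; rewrite S_INR; auto).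
  rewrite (rsum0_telescope (fun k => ln (1 + INR k / y) ^ 2 / 2)).
  replace (hker y (INR 0)) with 0 by (unfold hker, Rdiv; cbn [INR]; rewrite Rmult_0_l, Rplus_0_r, ln_1; ring).
  replace (ln (1 + INR 0 / y)) with 0 by (unfold Rdiv; cbn [INR]; rewrite Rmult_0_l, Rplus_0_r, ln_1; ring).
  field.
Qed.

Definition pw54 (n : nat) : R := Rpower (INR (S n)) (- / 4 - 1).

Lemma ex_series_pw54 : ex_series pw54.
Proof. apply ex_series_Rpower. lra. Qed.

Lemma pw54_pos n : 0 < pw54 n.
Proof. apply exp_pos. Qed.

(* v^(-5/2) splits between the two summation indices *)
Lemma pow52_split x : 0 < x -> exists C, 0 < C /\ forall (n k : nat) v,
  INR (S n) * x + INR k <= v -> Rpower v (- (5 / 2)) <= C * (pw54 n * pw54 k).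
Proof.
  (* v is at least (n + 1) x and at least m (k + 1); each lower bound takes half of the exponent. *)
  intros Hx. set (m := Rmin x 1). assert (m0 : 0 < m) by (apply Rmin_pos; lra).
  assert (m1 : m <= x) by apply Rmin_l. assert (m2 : m <= 1) by apply Rmin_r.
  exists (Rpower x (- (5 / 4)) * Rpower m (- (5 / 4))). split. apply Rmult_lt_0_compat; apply exp_pos.
  intros n k v Hv. assert (Pn := pos_INR n). assert (Pk := pos_INR k). rewrite S_INR in Hv.
  replace (- (5 / 2)) with (- (5 / 4) + - (5 / 4)) by field. rewrite Rpower_plus.
  unfold pw54. replace (- / 4 - 1) with (- (5 / 4)) by field.
  replace (Rpower x (- (5 / 4)) * Rpower m (- (5 / 4)) * (Rpower (INR (S n)) (- (5 / 4)) * Rpower (INR (S k)) (- (5 / 4)))) with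
   ((Rpower (INR (S n)) (- (5 / 4)) * Rpower x (- (5 / 4))) * (Rpower (INR (S k)) (- (5 / 4)) * Rpower m (- (5 / 4)))) by ring.
  assert (SN : 0 < INR (S n)) by (rewrite S_INR; lra). assert (SK : 0 < INR (S k)) by (rewrite S_INR; lra).
  rewrite (Rpower_mult_distr (INR (S n)) x), (Rpower_mult_distr (INR (S k)) m) by lra.
  rewrite !S_INR.
  apply Rmult_le_compat; try (left; apply exp_pos); apply Rpower_le_neg; try lra; try nra.
Qed.

Lemma ln_le_2sqrt v : 0 < v -> ln v <= 2 * sqrt v.
Proof.
  intros Hv. assert (S := sqrt_lt_R0 v Hv). rewrite <- (sqrt_sqrt v) at 1 by lra.
  rewrite ln_mult by auto. assert (X := ln_le_sub_1 (sqrt v) S). lra.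
Qed.

Lemma Rpower_52 v : 0 < v -> Rpower v (- (5 / 2)) = sqrt v / v ^ 3.
Proof.
  intros Hv. replace (- (5 / 2)) with (/ 2 + - INR 3) by (simpl; field).
  rewrite Rpower_plus, Rpower_sqrt, Rpower_Ropp, Rpower_pow by auto. reflexivity.
Qed.

(** With v = u + y the second derivative is (2 ln (v/y) - 3)/v^3. Replacing the logarithm by 2 sqrt
    (v/y) costs half a power of v, and 7 = 4 + 3 because v/y >= 1. *)
Lemma hker_err_bound y k : 0 < y -> Rabs (hker_err y k) <= 7 * / sqrt y * Rpower (y + INR k) (- (5 / 2)).
Proof.
  intros Hy. assert (Pk := pos_INR k).
  assert (Sy := sqrt_lt_R0 y Hy).
  apply (trapezoid_error2 (fun u => ln (1 + u / y) ^ 2 / 2) (hker y)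
    (fun u => (1 - ln (1 + u / y)) / (u + y) ^ 2) (fun u => (2 * ln (1 + u / y) - 3) / (u + y) ^ 3) (INR k)).
  - intros u Hu. assert (0 <= u / y) by (apply Rdiv_le_0_compat; lra). unfold hker. auto_derive. lra. unfold Rdiv. field. split; lra.
  - intros u Hu. assert (0 <= u / y) by (apply Rdiv_le_0_compat; lra). unfold hker. auto_derive. split; [lra | split; [lra | auto]]. unfold Rdiv. field. split; lra.
  - intros u Hu. assert (0 <= u / y) by (apply Rdiv_le_0_compat; lra). auto_derive. split; [lra | split; [nra | auto]]. unfold Rdiv. field. split; lra.
  - intros u Hu.
    set (v := u + y). assert (v0 : 0 < v) by (unfold v; lra). assert (yv : y <= v) by (unfold v; lra).
    replace (1 + u / y) with (v / y) by (unfold v; field; lra).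
    assert (q1 : 1 <= v / y) by (apply (Rmult_le_reg_r y); auto; unfold Rdiv; rewrite Rmult_assoc, Rinv_l; lra).
    assert (L0 : 0 <= ln (v / y)) by (rewrite <- ln_1; apply ln_le; lra).
    assert (L1 := ln_le_2sqrt (v / y) ltac:(lra)).
    assert (Q : sqrt (v / y) = sqrt v * / sqrt y) by (apply sqrt_div; lra).
    assert (Q1 : 1 <= sqrt (v / y)) by (rewrite <- sqrt_1; apply sqrt_le_1; lra).
    assert (v3 : 0 < v ^ 3) by (apply pow_lt; auto).
    apply Rle_trans with (7 * / sqrt y * Rpower v (- (5 / 2))).
    + rewrite Rpower_52 by auto. unfold Rdiv. rewrite Rabs_mult, Rabs_inv, (Rabs_pos_eq (v ^ 3)) by lra.
      replace (7 * / sqrt y * (sqrt v * / v ^ 3)) with (7 * (sqrt v * / sqrt y) * / v ^ 3) by ring.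
      apply Rmult_le_compat_r. left; apply Rinv_0_lt_compat; auto. rewrite <- Q. 
      apply Rabs_le. lra.
    + apply Rmult_le_compat_l. assert (0 < / sqrt y) by (apply Rinv_0_lt_compat; auto). lra.
      apply Rpower_le_neg; unfold v; lra.
Qed.

Lemma hker_err_bound2 x : 0 < x -> exists C, 0 < C /\ forall n k,
  Rabs (hker_err (INR (S n) * x) k) <= C * pw54 n * pw54 k.
Proof.
  intros Hx. destruct (pow52_split x Hx) as (C & C0 & HC).
  assert (Sx := sqrt_lt_R0 x Hx). assert (iS : 0 < / sqrt x) by (apply Rinv_0_lt_compat; auto).
  exists (7 * / sqrt x * C). split. nra.
  intros n k. assert (Pn := pos_INR n). assert (Sn : 1 <= INR (S n)) by (rewrite S_INR; lra).
  eapply Rle_trans. apply hker_err_bound. nra.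
  specialize (HC n k (INR (S n) * x + INR k) (Rle_refl _)).
  assert (I : / sqrt (INR (S n) * x) <= / sqrt x).
  { apply Rinv_le_contravar; auto. apply sqrt_le_1; nra. }
  assert (I0 : 0 < / sqrt (INR (S n) * x)) by (apply Rinv_0_lt_compat, sqrt_lt_R0; nra).
  assert (E := exp_pos ((- (5 / 2)) * ln (INR (S n) * x + INR k))). fold (Rpower (INR (S n) * x + INR k) (- (5 / 2))) in E.
  replace (7 * / sqrt x * C * pw54 n * pw54 k) with ((7 * / sqrt x) * (C * (pw54 n * pw54 k))) by ring.
  apply Rmult_le_compat; try lra.
Qed.

(** The truncation error factors into a summable function of n and a null sequence in N. This
    uniformity is what the diagonal limit in [gN_sum_lim] needs. *)
Lemma gfun_summable x : 0 < x -> ex_series (fun n => gfun (INR (S n) * x)) /\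
  exists C e, is_lim_seq e 0 /\ 0 <= C /\ forall n N,
    Rabs (gN N (INR (S n) * x)) <= C * pw54 n /\
    Rabs (gfun (INR (S n) * x) - gN N (INR (S n) * x)) <= pw54 n * e N.
Proof.
  intros Hx. destruct (hker_err_bound2 x Hx) as (C & C0 & HC).
  assert (S54 : 0 <= Series pw54) by (apply Series_nonneg; [intros; left; apply pw54_pos | apply ex_series_pw54]).
  assert (Eb : forall n, ex_series (fun k => C * pw54 n * pw54 k)).
  { intros. apply (ex_series_scal (K := R_AbsRing) (V := R_NormedModule) (C * pw54 n)). apply ex_series_pw54. }
  assert (B : forall n N, Rabs (gfun (INR (S n) * x) - gN N (INR (S n) * x)) <= pw54 n * (C * Series (fun k => pw54 (N + k)%nat))).
  { intros n N. destruct (rsum0_Series_bound _ _ N (Eb n) (HC n)) as [H _].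
    rewrite (Series_scal_l (C * pw54 n) (fun k => pw54 (N + k)%nat)) in H.
    unfold gfun. rewrite gN_eq. rewrite <- Rabs_Ropp.
    replace (- (- Series (hker_err (INR (S n) * x)) - - rsum0 (hker_err (INR (S n) * x)) N)) with (Series (hker_err (INR (S n) * x)) - rsum0 (hker_err (INR (S n) * x)) N) by ring. lra. }
  assert (B0 : forall n, Rabs (gfun (INR (S n) * x)) <= C * Series pw54 * pw54 n).
  { intros n. assert (H := B n 0%nat). rewrite gN_eq in H. cbn [rsum0] in H. rewrite Ropp_0, Rminus_0_r in H.
    change (fun k => pw54 (0 + k)%nat) with pw54 in H. lra. }
  split.
  - apply (ex_series_le (V := R_CompleteNormedModule) _ (fun n => C * Series pw54 * pw54 n)). apply B0.
    apply (ex_series_scal (K := R_AbsRing) (V := R_NormedModule) (C * Series pw54)). apply ex_series_pw54.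
  - exists (2 * C * Series pw54), (fun N => C * Series (fun k => pw54 (N + k)%nat)). repeat split.
    + replace (Finite 0) with (Rbar_mult C 0). apply is_lim_seq_scal_l. apply Series_tail_lim, ex_series_pw54. cbn; f_equal; ring.
    + nra.
    + assert (T : Series (fun k => pw54 (N + k)%nat) <= Series pw54).
      { destruct N. right; reflexivity. rewrite (Series_incr_n pw54 (S N)) by (try lia; apply ex_series_pw54).
        assert (0 <= sum_f_R0 pw54 (pred (S N))) by (apply cond_pos_sum; intros; left; apply pw54_pos). lra. }
      assert (P := pw54_pos n).
      replace (gN N (INR (S n) * x)) with (gfun (INR (S n) * x) - (gfun (INR (S n) * x) - gN N (INR (S n) * x))) by ring.
      eapply Rle_trans. apply Rabs_triang. rewrite Rabs_Ropp. assert (X := B n N). assert (Y := B0 n).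
      assert (pw54 n * (C * Series (fun k => pw54 (N + k)%nat)) <= pw54 n * (C * Series pw54)).
      { apply Rmult_le_compat_l; [lra |]. apply Rmult_le_compat_l; lra. } lra.
    + apply B.
Qed.

Lemma rsum0_pos_le b N : (forall k, 0 <= b k) -> ex_series b -> rsum0 b N <= Series b.
Proof.
  intros Hb Eb. destruct N. cbn. apply Series_nonneg; auto.
  rewrite (Series_incr_n b (S N)) by (auto; lia). cbn [pred].
  replace (rsum0 b (S N)) with (sum_f_R0 b N).
  assert (0 <= Series (fun k => b (S N + k)%nat)) by (apply Series_nonneg; auto; apply (ex_series_incr_n b (S N)); auto). lra.
  clear. induction N; cbn in *. ring. rewrite IHN. ring.
Qed.

(** N is both the number of terms and the truncation inside each term. The sum is compared with the
    partial sum of [gfun]: the accumulated truncation errors are at most [Series pw54] times a null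
    sequence, and the half of the last term tends to 0. *)
Lemma gN_sum_lim x : 0 < x -> is_lim_seq (fun N => rtrap (fun n => gN N (INR n * x)) N) (Gsum x).
Proof.
  intros Hx. destruct (gfun_summable x Hx) as (Ex & C & e & He & C0 & HB).
  assert (P54 : is_lim_seq (fun N => pw54 N) 0) by (apply (ex_series_lim_0 pw54), ex_series_pw54).
  apply is_lim_seq_incr_1.
  apply is_lim_seq_ext with (fun N => rsum0 (fun n => gfun (INR (S n) * x)) (S N)
     - rsum0 (fun n => gfun (INR (S n) * x) - gN (S N) (INR (S n) * x)) (S N) - / 2 * gN (S N) (INR (S N) * x)).
  { intros N. unfold rtrap. rewrite rsum_rsum0, rsum0_minus. ring. }
  replace (Gsum x) with (Gsum x - 0 - / 2 * 0) by ring.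
  apply is_lim_seq_minus'. apply is_lim_seq_minus'.
  - apply (is_lim_seq_incr_1 (fun N => rsum0 (fun n => gfun (INR (S n) * x)) N)). apply rsum0_lim. apply (Series_correct _ Ex).
  - apply is_lim_seq_abs_0. apply is_lim_seq_le_le with (fun _ => 0) (fun N => Series pw54 * Rabs (e (S N))).
    + intros N. split. apply Rabs_pos.
      eapply Rle_trans. apply rsum0_abs_le with (b := fun n => pw54 n * Rabs (e (S N))).
      * intros k _. eapply Rle_trans. apply HB. apply Rmult_le_compat_l. left; apply pw54_pos. apply Rle_abs.
      * assert (E : rsum0 (fun n => pw54 n * Rabs (e (S N))) (S N) = rsum0 pw54 (S N) * Rabs (e (S N))).
        { generalize (Rabs (e (S N))). intros c. generalize (S N). intros M. induction M; cbn [rsum0]. ring. rewrite IHM. ring. }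
        rewrite E. apply Rmult_le_compat_r. apply Rabs_pos. apply rsum0_pos_le. intros; left; apply pw54_pos. apply ex_series_pw54.
    + apply is_lim_seq_const.
    + replace (Finite 0) with (Rbar_mult (Series pw54) 0) by (cbn; f_equal; ring).
      apply is_lim_seq_scal_l. apply (is_lim_seq_incr_1 (fun N => Rabs (e N))). apply (proj1 (is_lim_seq_abs_0 e)). auto.
  - evar_last; [apply is_lim_seq_scal_l with (lu := 0) | cbn; f_equal; ring].
    apply is_lim_seq_abs_0. apply is_lim_seq_le_le with (fun _ => 0) (fun N => C * pw54 N).
    + intros N. split. apply Rabs_pos. apply HB.
    + apply is_lim_seq_const.
    + replace (Finite 0) with (Rbar_mult C 0) by (cbn; f_equal; ring). apply is_lim_seq_scal_l. auto.
Qed.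

(** * Trapezoidal sums of [ell] *)

Lemma ln1p_div_decreasing u v : 0 <= u -> u <= v -> ln1p_div v <= ln1p_div u.
Proof.
  intros Hu uv. destruct (Req_dec u 0) as [-> | u0]. rewrite ln1p_div_0. apply ln1p_div_bound; auto.
  rewrite !ln1p_div_neq by lra.
  destruct (MVT_gen (fun v => ln (1 + v) / v) u v (fun v => (v / (1 + v) - ln (1 + v)) / v ^ 2)) as [w [Hw E]].
  - intros z Hz. rewrite Rmin_left, Rmax_right in Hz by lra. auto_derive. lra. field. lra.
  - intros z Hz. rewrite Rmin_left, Rmax_right in Hz by lra.
    apply continuity_pt_filterlim, (ex_derive_continuous (V := R_NormedModule) (fun v => ln (1 + v) / v)). auto_derive. lra.
  - rewrite Rmin_left, Rmax_right in Hw by lra.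
    assert (X := ln_le_sub_1 (/ (1 + w)) ltac:(apply Rinv_0_lt_compat; lra)). rewrite ln_Rinv in X by lra.
    assert (Y : w / (1 + w) - ln (1 + w) <= 0) by (replace (w / (1 + w)) with (1 - / (1 + w)) by (field; lra); lra).
    assert (Z : 0 < / w ^ 2) by (apply Rinv_0_lt_compat; nra).
    unfold Rdiv in E, Y |- *.
    assert (A : (w * / (1 + w) - ln (1 + w)) * / w ^ 2 <= 0) by nra. nra.
Qed.

(* Euler-Maclaurin for u |-> ell (u / Y), whose primitive is elementary up to ell itself; the sum
   starts at 1, whence the half value at 0. *)
Lemma ell_sum_bound Y N : 0 < Y ->
  Rabs (rtrap (fun m => ell (INR m / Y)) N - (INR N * ell (INR N / Y) + Y / 2 * ln (1 + INR N / Y) ^ 2) + ell 0 / 2) <= / Y.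
Proof.
  intros HY. set (W := fun u => u * ell (u / Y) + Y / 2 * ln (1 + u / Y) ^ 2).
  (* The function d is minus the derivative of [ell], that is ln (1 + v) / (v (1 + v)) with value 1
     at 0. It is nonnegative and decreasing. *)
  set (F := fun u => ell (u / Y)). set (d := fun v => ln1p_div v / (1 + v)).
  assert (iY : 0 < / Y) by (apply Rinv_0_lt_compat; auto).
  assert (uY : forall u, 0 <= u -> 0 <= u / Y) by (intros; apply Rdiv_le_0_compat; auto).
  assert (dd : forall v, 0 <= v -> ln (1 + v) / (1 + v) - ln1p_div v = - d v).
  { intros v Hv. unfold d. destruct (Req_dec v 0) as [-> | v0].
    rewrite ln1p_div_0, Rplus_0_r, ln_1. field. rewrite ln1p_div_neq by auto. field. lra. }
  assert (DF : forall u, 0 <= u -> is_derive F u (- d (u / Y) / Y)).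
  { intros u Hu. unfold F. specialize (uY u Hu). rewrite <- dd by auto. 
    apply (is_derive_comp_R ell (fun u => u / Y)). apply is_derive_ell0; lra.
    auto_derive; auto. field. lra. }
  assert (DW : forall u, 0 <= u -> is_derive W u (F u)).
  { intros u Hu. unfold W. specialize (uY u Hu). 
    assert (D2 : is_derive (fun u => Y / 2 * ln (1 + u / Y) ^ 2) u (ln (1 + u / Y) / (1 + u / Y))).
    { auto_derive. lra. unfold Rdiv. field. split; [|lra]. assert (0 < 1 + u / Y) by lra.
      replace (Y + u) with (Y * (1 + u / Y)) by (field; lra). nra. }
    evar_last. apply (is_derive_plus (V := R_NormedModule)); [| exact D2].
    apply (is_derive_mult_R (fun u => u) F). apply is_derive_id. apply DF; auto.
    unfold plus, one; cbn. fold (F u). 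
    assert (X : u / Y * d (u / Y) = ln (1 + u / Y) / (1 + u / Y)).
    { unfold d. destruct (Req_dec u 0) as [-> | u0].
      { replace (0 / Y) with 0 by (unfold Rdiv; ring). rewrite Rplus_0_r, ln_1. field. }
      rewrite ln1p_div_neq. field. repeat split; try lra. assert (0 < 1 + u / Y) by lra.
      replace (Y + u) with (Y * (1 + u / Y)) by (field; lra). nra. }
    replace (u * (- d (u / Y) / Y)) with (- (u / Y * d (u / Y))) by (field; lra). rewrite X. ring. }
  assert (dmono : forall u v, 0 <= u -> u <= v -> d v <= d u).
  { intros u v Hu uv. unfold d. assert (X := ln1p_div_decreasing u v Hu uv).
    assert (X0 := ln1p_div_bound v ltac:(lra)). unfold Rdiv.
    apply Rmult_le_compat; try lra. left; apply Rinv_0_lt_compat; lra. apply Rinv_le_contravar; lra. }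
  assert (d0 : forall v, 0 <= v -> 0 <= d v).
  { intros v Hv. unfold d. apply Rdiv_le_0_compat. apply ln1p_div_bound; auto. lra. }
  (* The derivative being monotone, its oscillation on [k, k + 1] is the difference of its end
     values. The error bounds therefore telescope, to at most d(0)/Y = 1/Y however large N is. *)
  assert (T : forall k, Rabs ((F (INR k) + F (INR (S k))) / 2 - (W (INR (S k)) - W (INR k))) <= d (INR k / Y) * / Y - d (INR (S k) / Y) * / Y).
  { intros k. assert (Pk := pos_INR k). rewrite S_INR.
    apply trapezoid_error with (fun u => - d (u / Y) / Y).
    - intros u Hu. apply DW; lra.
    - intros u Hu. apply DF; lra.
    - intros u v Hu Hv.
      assert (Q : forall z, INR k <= z <= INR k + 1 -> d ((INR k + 1) / Y) <= d (z / Y) <= d (INR k / Y)).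
      { intros z Hz. split; apply dmono; try (apply uY; lra); unfold Rdiv; apply Rmult_le_compat_r; lra. }
      assert (Qu := Q u Hu). assert (Qv := Q v Hv). unfold Rdiv in *. apply Rabs_le. split; nra. }
  assert (S := rsum0_abs_le (fun k => (F (INR k) + F (INR (S k))) / 2 - (W (INR (S k)) - W (INR k))) (fun k => d (INR k / Y) * / Y - d (INR (S k) / Y) * / Y) N (fun k _ => T k)).
  rewrite rsum0_minus, (rsum0_trap (fun k => F (INR k))), (rsum0_telescope (fun k => W (INR k))) in S.
  assert (E : rsum0 (fun k => d (INR k / Y) * / Y - d (INR (Datatypes.S k) / Y) * / Y) N = d 0 * / Y - d (INR N / Y) * / Y).
  { rewrite (rsum0_ext _ (fun k => - (d (INR (Datatypes.S k) / Y) * / Y) - - (d (INR k / Y) * / Y))) by (intros; ring).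
    rewrite (rsum0_telescope (fun k => - (d (INR k / Y) * / Y))). cbn [INR]. unfold Rdiv at 2. rewrite Rmult_0_l. ring. }
  rewrite E in S. unfold W in S at 2. cbn [INR] in S.
  assert (Z0 : 0 / Y = 0) by (unfold Rdiv; ring). unfold F at 2 in S. rewrite Z0, Rplus_0_r, ln_1 in S.
  assert (dz : d 0 = 1) by (unfold d; rewrite ln1p_div_0; field). rewrite dz in S.
  assert (dN := d0 _ (uY (INR N) (pos_INR N))).
  apply Rle_trans with (1 * / Y - d (INR N / Y) * / Y); [| nra].
  eapply Rle_trans; [| exact S]. right. f_equal. unfold F, W. ring.
Qed.

(** * The limit of [Theta] *)

Lemma rtrap_swap (f : nat -> nat -> R) M N :
  rtrap (fun n => rtrap (fun m => f n m) N) M = rtrap (fun m => rtrap (fun n => f n m) M) N.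
Proof.
  assert (S : forall K, rsum (fun n => rtrap (fun m => f n m) N) K = rtrap (fun m => rsum (fun n => f n m) K) N).
  { induction K; cbn [rsum].
    - assert (Z : rtrap (fun _ => 0) N = 0).
      { unfold rtrap. assert (E : rsum (fun _ => 0) N = 0) by (clear; induction N; cbn; auto; rewrite IHN; ring). rewrite E. ring. }
      rewrite Z. auto.
    - rewrite IHK. rewrite <- (Rmult_1_l (rtrap _ N)), <- (Rmult_1_l (rtrap (fun m => f (S K) m) N)), <- rtrap_lin.
      unfold rtrap. f_equal; [clear | ring]. induction N; cbn [rsum]; auto. rewrite IHN. ring. }
  unfold rtrap at 1. rewrite S.
  replace (rtrap (fun m => rsum (fun n => f n m) M) N - / 2 * rtrap (fun m => f M m) N)
    with (1 * rtrap (fun m => rsum (fun n => f n m) M) N + (- / 2) * rtrap (fun m => f M m) N) by ring.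
  rewrite <- rtrap_lin. unfold rtrap.
  f_equal; [| ring]. clear. induction N; cbn [rsum]; auto. rewrite IHN. ring.
Qed.

(** By [qfun_ell] each boundary term is half a squared logarithm minus an [ell] term. The squared
    logarithms are exactly the integrals that complete the rows and columns of the double sum to
    [gN]; the [ell] terms are left over. *)
Lemma Theta_eq N x : (1 <= N)%nat -> 0 < x ->
  Theta N x = x * rtrap (fun n => gN N (INR n * x)) N - rtrap (fun m => gN N (INR m * / x)) N
   + (rtrap (fun m => ell (INR m / (INR N * x))) N - x * rtrap (fun n => ell (INR n / (INR N * / x))) N
      + INR N * (qfun x - x * qfun (/ x))).
Proof.
  intros HN Hx. assert (PN := INR_gt_0 N HN). assert (ix : 0 < / x) by (apply Rinv_0_lt_compat; auto).
  set (A := rtrap (fun m => rtrap (fun n => hker (INR m * / x) (INR n)) N) N).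
  set (B := rtrap (fun n => rtrap (fun m => hker (INR n * x) (INR m)) N) N).
  set (L1 := rtrap (fun m => ln (1 + INR N / (INR m * / x)) ^ 2 / 2) N).
  set (L2 := rtrap (fun n => ln (1 + INR N / (INR n * x)) ^ 2 / 2) N).
  set (E1 := rtrap (fun m => ell (INR m / (INR N * x))) N). set (E2 := rtrap (fun n => ell (INR n / (INR N * / x))) N).
  assert (H1 : rtrap (fun n => rtrap (fun m => x / INR m * kfun (INR n * x / INR m)) N) N = A - x * B).
  { transitivity (rtrap (fun n => 1 * rtrap (fun m => hker (INR m * / x) (INR n)) N + (- x) * rtrap (fun m => hker (INR n * x) (INR m)) N) N).
    - apply rtrap_ext; auto. intros n Hn. assert (Pn := INR_gt_0 n ltac:(lia)).
      rewrite <- rtrap_lin. apply rtrap_ext; auto. intros m Hm. assert (Pm := INR_gt_0 m ltac:(lia)).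
      assert (Pnx : 0 < INR n * x) by nra.
      unfold kfun, hker.
      replace (1 + INR n / (INR m * / x)) with ((INR m + INR n * x) / INR m) by (field; lra).
      replace (1 + INR m / (INR n * x)) with ((INR m + INR n * x) / (INR n * x)) by (field; lra).
      rewrite !ln_div by lra. field. repeat split; nra.
    - rewrite rtrap_lin. rewrite (rtrap_swap (fun n m => hker (INR m * / x) (INR n))). fold A B. ring. }
  assert (H2 : rtrap (fun m => qfun (INR N * x / INR m)) N = L1 - E1).
  { transitivity (rtrap (fun m => 1 * (ln (1 + INR N / (INR m * / x)) ^ 2 / 2) + (-1) * ell (INR m / (INR N * x))) N).
    - apply rtrap_ext; auto. intros m Hm. assert (Pm := INR_gt_0 m ltac:(lia)).
      rewrite qfun_ell. 2: { apply Rdiv_lt_0_compat; nra. }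
      replace (/ (INR N * x / INR m)) with (INR m / (INR N * x)) by (field; lra).
      replace (INR N * x / INR m) with (INR N / (INR m * / x)) by (field; lra). ring.
    - rewrite rtrap_lin. fold L1 E1. ring. }
  assert (H3 : rtrap (fun n => qfun (INR N / (INR n * x))) N = L2 - E2).
  { transitivity (rtrap (fun n => 1 * (ln (1 + INR N / (INR n * x)) ^ 2 / 2) + (-1) * ell (INR n / (INR N * / x))) N).
    - apply rtrap_ext; auto. intros n Hn. assert (Pn := INR_gt_0 n ltac:(lia)).
      rewrite qfun_ell. 2: { apply Rdiv_lt_0_compat; nra. }
      replace (/ (INR N / (INR n * x))) with (INR n / (INR N * / x)) by (field; lra). ring.
    - rewrite rtrap_lin. fold L2 E2. ring. }
  assert (H4 : rtrap (fun n => gN N (INR n * x)) N = L2 - B).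
  { transitivity (rtrap (fun n => 1 * (ln (1 + INR N / (INR n * x)) ^ 2 / 2) + (-1) * rtrap (fun m => hker (INR n * x) (INR m)) N) N).
    - apply rtrap_ext; auto. intros n Hn. unfold gN. ring.
    - rewrite rtrap_lin. fold L2 B. ring. }
  assert (H5 : rtrap (fun m => gN N (INR m * / x)) N = L1 - A).
  { transitivity (rtrap (fun m => 1 * (ln (1 + INR N / (INR m * / x)) ^ 2 / 2) + (-1) * rtrap (fun n => hker (INR m * / x) (INR n)) N) N).
    - apply rtrap_ext; auto. intros n Hn. unfold gN. ring.
    - rewrite rtrap_lin. fold L1 A. ring. }
  unfold Theta. rewrite H1, H2, H3, H4, H5. ring.
Qed.

(** The parts of order N supplied by [ell_sum_bound] cancel against the last line of [Theta], by
    [qfun_ell] at x and 1/x. Only the end corrections -[ell 0]/2 survive, with the weights 1 and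
    -x. *)
Lemma Theta_lim x : 0 < x ->
  is_lim_seq (fun N => Theta (S N) x) (x * Gsum x - Gsum (/ x) - PI ^ 2 / 12 * (1 - x)).
Proof.
  intros Hx. assert (ix : 0 < / x) by (apply Rinv_0_lt_compat; auto).
  set (R0 := fun (Y : R) N => rtrap (fun m => ell (INR m / Y)) N - (INR N * ell (INR N / Y) + Y / 2 * ln (1 + INR N / Y) ^ 2) + ell 0 / 2).
  apply is_lim_seq_ext with (fun N => x * rtrap (fun n => gN (S N) (INR n * x)) (S N) - rtrap (fun m => gN (S N) (INR m * / x)) (S N)
    + (R0 (INR (S N) * x) (S N) - x * R0 (INR (S N) * / x) (S N) - PI ^ 2 / 12 * (1 - x))).
  { intros N. rewrite Theta_eq by (auto; lia). assert (PN := INR_gt_0 (S N) ltac:(lia)).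
    f_equal. unfold R0. rewrite ell_0, !qfun_ell by auto. rewrite Rinv_inv.
    replace (INR (S N) / (INR (S N) * x)) with (/ x) by (field; lra).
    replace (INR (S N) / (INR (S N) * / x)) with x by (field; lra). field. lra. }
  replace (x * Gsum x - Gsum (/ x) - PI ^ 2 / 12 * (1 - x)) with (x * Gsum x - Gsum (/ x) + (0 - x * 0 - PI ^ 2 / 12 * (1 - x))) by ring.
  assert (L : forall z, 0 < z -> is_lim_seq (fun N => R0 (INR (S N) * z) (S N)) 0).
  { intros z Hz. apply is_lim_seq_abs_0.
    apply is_lim_seq_le_le with (fun _ => 0) (fun N => / z * / INR (S N)).
    - intros N. split. apply Rabs_pos. assert (PN := INR_gt_0 (S N) ltac:(lia)).
      replace (/ z * / INR (S N)) with (/ (INR (S N) * z)) by (field; lra). apply ell_sum_bound. nra.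
    - apply is_lim_seq_const.
    - replace (Finite 0) with (Rbar_mult (/ z) 0) by (cbn; f_equal; ring). apply is_lim_seq_scal_l.
      replace (Finite 0) with (Rbar_inv p_infty) by reflexivity.
      apply is_lim_seq_inv; [| discriminate]. apply (is_lim_seq_incr_1 INR). apply is_lim_seq_INR. }
  apply is_lim_seq_plus'; [apply is_lim_seq_minus' |].
  - apply (is_lim_seq_scal_l _ x (Gsum x)). apply (is_lim_seq_incr_1 (fun N => rtrap (fun n => gN N (INR n * x)) N)). apply gN_sum_lim; auto.
  - apply (is_lim_seq_incr_1 (fun N => rtrap (fun n => gN N (INR n * / x)) N)). apply gN_sum_lim; auto.
  - apply is_lim_seq_minus'; [apply is_lim_seq_minus' |]. apply L; auto.
    apply (is_lim_seq_scal_l _ x 0). apply L; auto. apply is_lim_seq_const.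
Qed.

(** * The functions psi_1 and phi_0 at positive real arguments *)

Lemma Clog_RtoC x : 0 < x -> Clog (RtoC x) = RtoC (ln x).
Proof.
  intros Hx. unfold Clog. rewrite Cmod_R, Rabs_pos_eq by lra. cbn [Re Im RtoC fst snd].
  replace (0 / (x + x)) with 0 by (field; lra). rewrite atan_0, Rmult_0_r. reflexivity.
Qed.

Lemma CSeries_RtoC (a : nat -> C) (r : nat -> R) : (forall n, a n = RtoC (r n)) -> CSeries a = RtoC (Series r).
Proof.
  intros H. unfold CSeries. rewrite (Series_ext _ r) by (intros; rewrite H; auto).
  rewrite (Series_ext (fun n => Im (a n)) (fun n => 0 * 0)) by (intros; rewrite H; cbn; ring).
  rewrite (Series_scal_l 0 (fun _ => 0)). rewrite Rmult_0_l. reflexivity.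
Qed.

Lemma CLim_seq_RtoC (a : nat -> C) (r : nat -> R) (l : R) : (forall n, a n = RtoC (r n)) ->
  is_lim_seq r l -> CLim_seq a = RtoC l.
Proof.
  intros H L. unfold CLim_seq. rewrite (Lim_seq_ext _ r) by (intros; rewrite H; auto).
  rewrite (Lim_seq_ext (fun n => Im (a n)) (fun n => 0)) by (intros; rewrite H; auto).
  rewrite Lim_seq_const, (is_lim_seq_unique _ _ L). reflexivity.
Qed.

Definition inv_err (y : R) (k : nat) : R :=
  (/ (y + INR k) + / (y + INR k + 1)) / 2 - (ln (y + INR k + 1) - ln (y + INR k)).

Lemma inv_err_bound y k : 0 < y -> Rabs (inv_err y k) <= 2 * / (y + INR k) ^ 3.
Proof.
  intros Hy. assert (Pk := pos_INR k). unfold inv_err.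
  apply (trapezoid_error2 ln Rinv (fun u => - / u ^ 2) (fun u => 2 * / u ^ 3) (y + INR k)).
  - intros u Hu. apply is_derive_ln. lra.
  - intros u Hu. auto_derive. lra. field. lra.
  - intros u Hu. auto_derive. nra. field. lra.
  - intros u Hu. assert (0 < (y + INR k) ^ 3) by (apply pow_lt; lra).
    assert ((y + INR k) ^ 3 <= u ^ 3) by (apply pow_incr; lra).
    rewrite Rabs_pos_eq. apply Rmult_le_compat_l. lra. apply Rinv_le_contravar; lra.
    apply Rmult_le_pos. lra. left. apply Rinv_0_lt_compat. lra.
Qed.

(** The exponent is left as -1 - 1 to be an instance of [ex_series_Rpower]; [pw2_eq] gives the plain
    form. *)
Definition pw2 (n : nat) : R := Rpower (INR (S n)) (- 1 - 1).

Lemma pw2_eq n : pw2 n = / INR (S n) ^ 2.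
Proof.
  unfold pw2. replace (- 1 - 1) with (- INR 2) by (simpl; ring).
  rewrite Rpower_Ropp, Rpower_pow; auto. apply lt_0_INR; lia.
Qed.

Lemma ex_series_pw2 : ex_series pw2.
Proof. exact (ex_series_Rpower 1 Rlt_0_1). Qed.

Lemma pw2_pos n : 0 < pw2 n.
Proof. apply exp_pos. Qed.

Lemma shift_lower y k : 0 < y -> Rmin y 1 * INR (S k) <= y + INR k.
Proof.
  intros Hy. rewrite S_INR. assert (P := pos_INR k).
  assert (m0 : 0 < Rmin y 1) by (apply Rmin_pos; lra).
  assert (m1 := Rmin_l y 1). assert (m2 := Rmin_r y 1). nra.
Qed.

Lemma inv_err_summable y : 0 < y -> ex_series (inv_err y).
Proof.
  intros Hy. set (m := Rmin y 1). assert (m0 : 0 < m) by (apply Rmin_pos; lra).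
  apply (ex_series_le (V := R_CompleteNormedModule) _ (fun k => 2 * / m ^ 3 * pw2 k)).
  - intros k. eapply Rle_trans. apply inv_err_bound; auto. assert (L := shift_lower y k Hy). fold m in L.
    assert (S1 : 1 <= INR (S k)) by (rewrite S_INR; assert (P := pos_INR k); lra).
    rewrite pw2_eq, Rmult_assoc, <- Rinv_mult. apply Rmult_le_compat_l. lra.
    assert (m3 : 0 < m ^ 3) by (apply pow_lt; auto).
    assert (s2 : 1 <= INR (S k) ^ 2) by nra.
    apply Rinv_le_contravar. nra. apply Rle_trans with ((m * INR (S k)) ^ 3).
    replace ((m * INR (S k)) ^ 3) with (m ^ 3 * INR (S k) ^ 2 * INR (S k)) by ring. assert (0 < m ^ 3 * INR (S k) ^ 2) by nra. nra.
    apply pow_incr. split; auto. nra.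
  - apply (ex_series_scal (K := R_AbsRing) (V := R_NormedModule) (2 * / m ^ 3)). apply ex_series_pw2.
Qed.

(** phi_0 on the positive reals as a remainder: minus the sum of the trapezoidal errors of 1/u from
    y onwards. The identification with the digamma function comes in [phi0_RtoC]. *)
Definition phi0R (y : R) : R := - Series (inv_err y).
Definition psiR (y : R) : R := phi0R y - / (2 * y) + ln y.

Lemma rsum0_inv_err y n : rsum0 (inv_err y) n =
  rsum0 (fun k => / (y + INR k)) (S n) - / (2 * y) - / 2 * / (y + INR n) - (ln (y + INR n) - ln y).
Proof.
  unfold inv_err. rewrite rsum0_minus.
  rewrite (rsum0_ext _ (fun k => (/ (y + INR k) + / (y + INR (S k))) / 2)) by (intros; rewrite S_INR, Rplus_assoc; auto).
  rewrite (rsum0_ext (fun k => ln (y + INR k + 1) - ln (y + INR k)) (fun k => ln (y + INR (S k)) - ln (y + INR k))) by (intros; rewrite S_INR, Rplus_assoc; auto).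
  rewrite (rsum0_telescope (fun k => ln (y + INR k))).
  rewrite (rsum0_trap (fun k => / (y + INR k))). cbn [INR]. rewrite Rplus_0_r.
  assert (E : rsum0 (fun k => / (y + INR k)) (S n) = / y + rsum (fun k => / (y + INR k)) n).
  { induction n. cbn. rewrite Rplus_0_r. ring. cbn [rsum]. rewrite <- Rplus_assoc, <- IHn. reflexivity. }
  rewrite E. unfold rtrap. rewrite Rinv_mult. unfold Rdiv. lra.
Qed.

Lemma is_lim_seq_ln_shift y : 0 < y -> is_lim_seq (fun n => ln (INR (S n)) - ln (y + INR (S n))) 0.
Proof.
  intros Hy. apply is_lim_seq_abs_0.
  apply is_lim_seq_le_le with (fun _ => 0) (fun n => y * / INR (S n)).
  - intros n. split. apply Rabs_pos. assert (P : 0 < INR (S n)) by (apply lt_0_INR; lia).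
    rewrite Rabs_minus_sym, <- ln_div by lra.
    replace ((y + INR (S n)) / INR (S n)) with (1 + y * / INR (S n)) by (field; lra).
    assert (Q : 0 < y * / INR (S n)) by (apply Rmult_lt_0_compat; auto; apply Rinv_0_lt_compat; auto).
    rewrite Rabs_pos_eq. assert (X := ln_le_sub_1 (1 + y * / INR (S n)) ltac:(lra)). lra.
    rewrite <- ln_1. apply ln_le; lra.
  - apply is_lim_seq_const.
  - replace (Finite 0) with (Rbar_mult y 0) by (cbn; f_equal; ring). apply is_lim_seq_scal_l.
    replace (Finite 0) with (Rbar_inv p_infty) by reflexivity.
    apply is_lim_seq_inv; [| discriminate]. apply (is_lim_seq_incr_1 INR). apply is_lim_seq_INR.
Qed.

Lemma is_lim_seq_inv_shift y : 0 < y -> is_lim_seq (fun n => / (y + INR (S n))) 0.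
Proof.
  intros Hy. replace (Finite 0) with (Rbar_inv p_infty) by reflexivity.
  apply is_lim_seq_inv; [| discriminate].
  apply is_lim_seq_plus with (l1 := y) (l2 := p_infty). apply is_lim_seq_const.
  apply (is_lim_seq_incr_1 INR). apply is_lim_seq_INR. reflexivity.
Qed.

(** The sequence is the derivative at y of Gauss's logarithmic expressions [lgauss (S n)]. Its limit
    appears by telescoping the trapezoidal errors of 1/u. *)
Lemma psiR_lim y : 0 < y ->
  is_lim_seq (fun n => ln (INR (S n)) - rsum0 (fun k => / (y + INR k)) (S (S n))) (psiR y).
Proof.
  intros Hy.
  apply is_lim_seq_ext with (fun n => (ln (INR (S n)) - ln (y + INR (S n))) - rsum0 (inv_err y) (S n) - / 2 * / (y + INR (S n)) - / (2 * y) + ln y).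
  { intros n. rewrite rsum0_inv_err. ring. }
  unfold psiR, phi0R. replace (- Series (inv_err y) - / (2 * y) + ln y) with (0 - Series (inv_err y) - / 2 * 0 - / (2 * y) + ln y) by ring.
  apply is_lim_seq_plus'; [| apply is_lim_seq_const]. apply is_lim_seq_minus'; [| apply is_lim_seq_const].
  apply is_lim_seq_minus'; [apply is_lim_seq_minus' |].
  - apply is_lim_seq_ln_shift; auto.
  - apply (is_lim_seq_incr_1 (rsum0 (inv_err y))). apply rsum0_lim. apply (Series_correct _ (inv_err_summable y Hy)).
  - apply (is_lim_seq_scal_l _ (/ 2) 0). apply is_lim_seq_inv_shift; auto.
Qed.

(** * Gauss's limit for the Gamma function on the positive reals *)

Definition lgauss (n : nat) (x : R) : R :=
  ln (INR (fact n)) + x * ln (INR n) - rsum0 (fun k => ln (x + INR k)) (S n).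

Lemma ln1p_lower u : 0 <= u -> u - u ^ 2 <= ln (1 + u).
Proof.
  intros Hu. assert (X := ln_le_sub_1 (/ (1 + u)) ltac:(apply Rinv_0_lt_compat; lra)).
  rewrite ln_Rinv in X by lra.
  assert (E : / (1 + u) - 1 <= - u + u ^ 2); [| lra].
  apply (Rmult_le_reg_l (1 + u)). lra. replace ((1 + u) * (/ (1 + u) - 1)) with (- u) by (field; lra). nra.
Qed.

(** The increment is x ln (1 + 1/m) - ln (1 + x/(m + 1)) with m = n + 1; the first-order terms agree
    up to O(1/m^2). *)
Lemma lgauss_step n x : 0 < x -> Rabs (lgauss (S (S n)) x - lgauss (S n) x) <= (x + x + x ^ 2 + 1) * pw2 n.
Proof.
  intros Hx. rewrite pw2_eq. set (m := INR (S n)). assert (Hm : 1 <= m) by (unfold m; rewrite S_INR; assert (P := pos_INR n); lra).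
  assert (Em : INR (S (S n)) = m + 1) by (unfold m; rewrite (S_INR (S n)); auto).
  assert (D : lgauss (S (S n)) x - lgauss (S n) x = x * ln (1 + / m) - ln (1 + x / (m + 1))).
  { unfold lgauss. change (rsum0 (fun k => ln (x + INR k)) (S (S (S n)))) with (rsum0 (fun k => ln (x + INR k)) (S (S n)) + ln (x + INR (S (S n)))).
    rewrite (fact_simpl (S n)), mult_INR, Em. fold m. rewrite ln_mult by (try lra; apply INR_fact_lt_0).
    replace (1 + / m) with ((m + 1) / m) by (field; lra). replace (1 + x / (m + 1)) with ((x + (m + 1)) / (m + 1)) by (field; lra).
    rewrite !ln_div by lra. ring. }
  rewrite D.
  assert (im : 0 < / m) by (apply Rinv_0_lt_compat; lra).
  assert (im1 : / (m + 1) <= / m) by (apply Rinv_le_contravar; lra).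
  assert (im2 : 0 < / (m + 1)) by (apply Rinv_0_lt_compat; lra).
  assert (im3 : / m - / (m + 1) <= / m * / m).
  { replace (/ m - / (m + 1)) with (/ m * / (m + 1)) by (field; lra). apply Rmult_le_compat_l; lra. }
  assert (A1 := ln1p_lower (/ m) ltac:(lra)). assert (A2 := ln_le_sub_1 (1 + / m) ltac:(lra)).
  assert (q0 : 0 <= x / (m + 1)) by (unfold Rdiv; nra).
  assert (B1 := ln1p_lower (x / (m + 1)) q0). assert (B2 := ln_le_sub_1 (1 + x / (m + 1)) ltac:(lra)).
  replace (/ m ^ 2) with (/ m * / m) by (field; lra). unfold Rdiv in *.
  assert (C1 : (x * / (m + 1)) ^ 2 <= x ^ 2 * (/ m * / m)) by (replace ((x * / (m + 1)) ^ 2) with (x ^ 2 * (/ (m + 1) * / (m + 1))) by ring; apply Rmult_le_compat_l; nra).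
  assert (C2 : x * / m - x * / (m + 1) <= x * (/ m * / m)) by nra.
  assert (C3 : x * ln (1 + / m) <= x * / m) by nra.
  assert (C4 : x * / m - x * (/ m * / m) <= x * ln (1 + / m)) by nra.
  assert (C5 : 0 <= / m * / m) by nra. assert (C6 : 0 <= x ^ 2 * (/ m * / m)) by (apply Rmult_le_pos; nra).
  assert (C7 : 0 <= x * (/ m * / m)) by nra. assert (C8 : x * / (m + 1) <= x * / m) by nra.
  apply Rabs_le. split; lra.
Qed.

Lemma lgauss_lim x : 0 < x -> exists l : R, is_lim_seq (fun n => lgauss (S n) x) l.
Proof.
  intros Hx. assert (Ex : ex_series (fun n => lgauss (S (S n)) x - lgauss (S n) x)).
  { apply (ex_series_le (V := R_CompleteNormedModule) _ (fun n => (x + x + x ^ 2 + 1) * pw2 n)).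
    intros n. apply lgauss_step; auto.
    apply (ex_series_scal (K := R_AbsRing) (V := R_NormedModule) (x + x + x ^ 2 + 1)). apply ex_series_pw2. }
  exists (Series (fun n => lgauss (S (S n)) x - lgauss (S n) x) + lgauss 1 x).
  apply is_lim_seq_ext with (fun n => rsum0 (fun n => lgauss (S (S n)) x - lgauss (S n) x) n + lgauss 1 x).
  { intros n. rewrite (rsum0_telescope (fun n => lgauss (S n) x)). ring. }
  apply is_lim_seq_plus'; [| apply is_lim_seq_const]. apply rsum0_lim. apply (Series_correct _ Ex).
Qed.

Definition lgammaR (x : R) : R := real (Lim_seq (fun n => lgauss (S n) x)).

Lemma lgammaR_lim x : 0 < x -> is_lim_seq (fun n => lgauss (S n) x) (lgammaR x).
Proof.
  intros Hx. destruct (lgauss_lim x Hx) as [l Hl]. unfold lgammaR. rewrite (is_lim_seq_unique _ _ Hl). auto.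
Qed.

(** The Taylor remainder of each ln (y + k) is at most a multiple of (y - x)^2/(k + 1)^2. Summed
    over k it gives a quadratic bound independent of n, which passes to the limit together with the
    derivatives of [psiR_lim]. *)
Lemma is_derive_lgammaR x : 0 < x -> is_derive lgammaR x (psiR x).
Proof.
  intros Hx. set (m := Rmin (x / 2) 1). assert (m0 : 0 < m) by (apply Rmin_pos; lra).
  set (K := 4 * / m ^ 2 * Series pw2).
  apply is_derive_of_quadratic_bound with (d := x / 2) (K := K). lra.
  intros y Hy. apply Rabs_def2 in Hy.
  set (Dn := fun n => ln (INR (S n)) - rsum0 (fun k => / (x + INR k)) (S (S n))).
  assert (B : forall n, Rabs (lgauss (S n) y - lgauss (S n) x - Dn n * (y - x)) <= K * (y - x) ^ 2).
  { intros n.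
    assert (E : lgauss (S n) y - lgauss (S n) x - Dn n * (y - x) = - rsum0 (fun k => ln (y + INR k) - ln (x + INR k) - (y - x) * / (x + INR k)) (S (S n))).
    { unfold lgauss, Dn. rewrite !rsum0_minus.
      assert (F : forall c M, rsum0 (fun k => c * / (x + INR k)) M = c * rsum0 (fun k => / (x + INR k)) M).
      { intros c M. induction M; cbn [rsum0]. ring. rewrite IHM. ring. }
      rewrite F. ring. }
    rewrite E, Rabs_Ropp. eapply Rle_trans.
    apply rsum0_abs_le with (b := fun k => 4 * / m ^ 2 * (y - x) ^ 2 * pw2 k).
    - intros k _. assert (Pk := pos_INR k).
      apply Rle_trans with (4 * / (x / 2 + INR k) ^ 2 * (y - x) ^ 2).
      + apply (taylor_abs_le (fun y => ln (y + INR k)) (fun y => / (y + INR k)) (fun y => - / (y + INR k) ^ 2) (x / 2) (2 * x)); try lra.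
        * intros z Hz. auto_derive. lra. field. lra.
        * intros z Hz. auto_derive. lra. field. lra.
        * intros z Hz. rewrite Rabs_Ropp, Rabs_pos_eq. apply Rinv_le_contravar. nra. apply pow_incr; lra.
          left; apply Rinv_0_lt_compat. nra.
      + assert (L := shift_lower (x / 2) k ltac:(lra)). fold m in L. assert (S1 : 0 < INR (S k)) by (apply lt_0_INR; lia).
        assert (I : / (x / 2 + INR k) ^ 2 <= / m ^ 2 * pw2 k).
        { rewrite pw2_eq, <- Rinv_mult, <- Rpow_mult_distr. assert (0 < m * INR (S k)) by nra. apply Rinv_le_contravar. nra. apply pow_incr. lra. }
        assert (Q := pow2_ge_0 (y - x)).
        replace (4 * / m ^ 2 * (y - x) ^ 2 * pw2 k) with (4 * (/ m ^ 2 * pw2 k) * (y - x) ^ 2) by ring.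
        apply Rmult_le_compat_r; auto. lra.
    - assert (F : forall c M, rsum0 (fun k => c * pw2 k) M = c * rsum0 pw2 M).
      { intros c M. induction M; cbn [rsum0]. ring. rewrite IHM. ring. }
      rewrite F. unfold K. replace (4 * / m ^ 2 * Series pw2 * (y - x) ^ 2) with (4 * / m ^ 2 * (y - x) ^ 2 * Series pw2) by ring.
      apply Rmult_le_compat_l. assert (0 < / m ^ 2) by (apply Rinv_0_lt_compat; nra). assert (Q := pow2_ge_0 (y - x)). nra.
      apply rsum0_pos_le. intros; left; apply pw2_pos. apply ex_series_pw2. }
  apply (is_lim_seq_le (fun n => Rabs (lgauss (S n) y - lgauss (S n) x - Dn n * (y - x))) (fun _ => K * (y - x) ^ 2)
    (Rabs (lgammaR y - lgammaR x - psiR x * (y - x))) (K * (y - x) ^ 2)); auto.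
  - apply (is_lim_seq_abs _ (lgammaR y - lgammaR x - psiR x * (y - x))).
    apply is_lim_seq_minus'. apply is_lim_seq_minus'; apply lgammaR_lim; lra.
    apply (is_lim_seq_scal_r _ (y - x) (psiR x)). apply psiR_lim; auto.
  - apply is_lim_seq_const.
Qed.

Lemma CGamma_RtoC x : 0 < x -> CGamma (RtoC x) = RtoC (exp (lgammaR x)).
Proof.
  intros Hx.
  set (rr := fun n => prod_f_R0 (fun k => x + INR k) n).
  assert (Hr : forall n, rising (RtoC x) (S n) = RtoC (rr n) /\ 0 < rr n /\ ln (rr n) = rsum0 (fun k => ln (x + INR k)) (S n)).
  { induction n as [| n (I1 & I2 & I3)].
    - cbn. rewrite !Rplus_0_r. repeat split; auto. rewrite Cmult_1_l, <- RtoC_plus. f_equal; ring. rewrite Rplus_0_l; auto.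
    - assert (P : 0 < x + INR (S n)) by (assert (Q := pos_INR (S n)); lra).
      change (rr (S n)) with (rr n * (x + INR (S n))).
      change (rising (RtoC x) (S (S n))) with (rising (RtoC x) (S n) * (RtoC x + RtoC (INR (S n))))%C.
      rewrite I1, <- RtoC_plus, <- RtoC_mult. repeat split; auto. apply Rmult_lt_0_compat; auto.
      rewrite ln_mult, I3; auto. }
  set (u := fun n => INR (fact n) * exp (x * ln (INR n)) / rr n).
  apply CLim_seq_RtoC with u.
  - intros n. destruct (Hr n) as (I1 & I2 & _). unfold u. rewrite I1. unfold Rcpow. rewrite <- RtoC_mult, Cexp_RtoC.
    rewrite RtoC_div, RtoC_mult by lra. auto.
  - apply is_lim_seq_incr_1. apply is_lim_seq_ext with (fun n => exp (lgauss (S n) x)).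
    + intros n. destruct (Hr (S n)) as (_ & I2 & I3). unfold lgauss, u. rewrite <- I3.
      unfold Rminus. rewrite !exp_plus, exp_Ropp, !exp_ln by (auto; apply INR_fact_lt_0). reflexivity.
    + apply is_lim_seq_continuous. apply derivable_continuous_pt, derivable_pt_exp. apply lgammaR_lim; auto.
Qed.

(** [C_derive] takes the difference quotient along the real direction. Within distance x of x it
    meets only positive reals, where [CGamma] is the real function exp [lgammaR]. *)
Lemma digamma_RtoC x : 0 < x -> digamma (RtoC x) = RtoC (psiR x).
Proof.
  intros Hx. set (G := fun u => exp (lgammaR u)).
  assert (D : is_derive G x (psiR x * G x)).
  { evar_last. apply (is_derive_comp_R exp lgammaR). apply is_derive_exp. apply is_derive_lgammaR; auto. unfold G; ring. }
  assert (C : C_derive CGamma (RtoC x) = RtoC (psiR x * G x)).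
  { unfold C_derive, C_lim. cbn [fst snd RtoC].
    assert (Q : forall u, 0 < u -> u <> x -> ((CGamma (u, 0) - CGamma (RtoC x)) / ((u, 0) - RtoC x))%C = RtoC ((G u - G x) / (u - x))).
    { intros u Hu Hux. change ((u, 0) : C) with (RtoC u). rewrite !CGamma_RtoC by auto.
      rewrite RtoC_div, !RtoC_minus by lra. reflexivity. }
    assert (L : forall (r : C -> R) (g : R -> R), (forall z, r (RtoC z) = g z) -> (forall eps : posreal, exists d : posreal, forall u, Rabs (u - x) < d -> u <> x -> Rabs (g ((G u - G x) / (u - x)) - g (psiR x * G x)) < eps) ->
       Lim (fun u => r ((CGamma (u, 0) - CGamma (RtoC x)) / ((u, 0) - RtoC x))%C) x = g (psiR x * G x)).
    { intros r g Hr Hl. apply is_lim_unique. apply is_lim_spec. intros eps. destruct (Hl eps) as [d Hd].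
      assert (P : 0 < Rmin d x) by (apply Rmin_pos; [apply cond_pos | auto]).
      exists (mkposreal _ P). intros u Hu Hux. change (Rabs (u - x) < Rmin d x) in Hu.
      assert (u1 := Rlt_le_trans _ _ _ Hu (Rmin_l _ _)). assert (u2 := Rlt_le_trans _ _ _ Hu (Rmin_r _ _)).
      apply Rabs_def2 in u2. rewrite Q, Hr by (auto; lra). apply Hd; auto. }
    rewrite (L fst (fun z => z)), (L snd (fun _ => 0)); auto.
    - intros eps. exists (mkposreal 1 Rlt_0_1). intros. rewrite Rminus_diag, Rabs_R0. apply cond_pos.
    - intros eps. apply is_derive_Reals in D. destruct (D eps (cond_pos eps)) as [d Hd]. exists d. intros u Hu Hux.
      replace u with (x + (u - x)) by ring. replace (x + (u - x) - x) with (u - x) by ring. apply Hd; auto. lra. }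
  unfold digamma. rewrite C, CGamma_RtoC by auto. fold (G x). rewrite <- RtoC_div by (apply Rgt_not_eq, exp_pos).
  f_equal. field. apply Rgt_not_eq, exp_pos.
Qed.

Lemma phi0_RtoC y : 0 < y -> phi0 (RtoC y) = RtoC (phi0R y).
Proof.
  intros Hy. unfold phi0. rewrite digamma_RtoC, Clog_RtoC by auto.
  unfold psiR. rewrite RtoC_plus, RtoC_minus, RtoC_inv, RtoC_mult by lra. field.
  intros E. apply RtoC_inj in E. lra.
Qed.

(** * The first Stieltjes constant *)

(** The error of the left-endpoint rule for ln u / u on a unit interval. The sum of these terms is
    gamma_1, the limit of the sum of ln n / n minus ln^2 N / 2; [euler_term] is the analogue for 1/u
    and gamma. *)
Definition stieltjes_term (k : nat) : R :=
  ln (INR (S k)) / INR (S k) - (ln (INR (S k) + 1) ^ 2 / 2 - ln (INR (S k)) ^ 2 / 2).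
Definition euler_term (k : nat) : R := / INR (S k) - (ln (INR (S k) + 1) - ln (INR (S k))).

Definition pw32 (n : nat) : R := Rpower (INR (S n)) (- / 2 - 1).

Lemma ex_series_pw32 : ex_series pw32.
Proof. apply (ex_series_Rpower (/ 2)). lra. Qed.

Lemma pw32_eq n : pw32 n = sqrt (INR (S n)) * / INR (S n) ^ 2.
Proof.
  assert (P : 0 < INR (S n)) by (apply lt_0_INR; lia).
  unfold pw32. replace (- / 2 - 1) with (/ 2 + - INR 2) by (simpl; field).
  rewrite Rpower_plus, Rpower_Ropp, Rpower_pow, Rpower_sqrt; auto.
Qed.

Lemma sqrt_over_sq_decreasing x u : 0 < x -> x <= u -> sqrt u * / u ^ 2 <= sqrt x * / x ^ 2.
Proof.
  intros Hx xu. assert (E : forall v, 0 < v -> sqrt v * / v ^ 2 = Rpower v (- (3 / 2))).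
  { intros v Hv. replace (- (3 / 2)) with (/ 2 + - INR 2) by (simpl; field).
    rewrite Rpower_plus, Rpower_Ropp, Rpower_pow, Rpower_sqrt; auto. }
  rewrite !E by lra. apply Rpower_le_neg; lra.
Qed.

(** The series for zeta compares the value at n with the integral over [n, n + 1], so the
    left-endpoint rule is the matching one here instead of the trapezoidal rule. *)
Lemma left_rule_error (W F F1 : R -> R) (a M : R) :
  (forall u, a <= u <= a + 1 -> is_derive W u (F u)) ->
  (forall u, a <= u <= a + 1 -> is_derive F u (F1 u)) ->
  (forall u, a <= u <= a + 1 -> Rabs (F1 u) <= M) ->
  Rabs (F a - (W (a + 1) - W a)) <= M.
Proof.
  intros HW HF HM.
  assert (M0 : 0 <= M) by (eapply Rle_trans; [apply Rabs_pos | apply (HM a); lra]).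
  replace (F a - (W (a + 1) - W a)) with (- ((W (a + 1) - (a + 1) * F a) - (W a - a * F a))) by ring.
  rewrite Rabs_Ropp. replace M with (M * (a + 1 - a)) by ring.
  apply (mvt_abs_le (fun u => W u - u * F a) (fun u => F u - F a)). lra.
  - intros u Hu. evar_last. apply (is_derive_minus (V := R_NormedModule)). apply HW; auto.
    apply (is_derive_mult_R (fun u => u) (fun _ => F a)). apply is_derive_id. apply (is_derive_const (V := R_NormedModule)).
    unfold minus, plus, opp, zero, one; cbn. ring.
  - intros u Hu. eapply Rle_trans. apply (mvt_abs_le F F1 a u M). lra.
    intros; apply HF; lra. intros; apply HM; lra. nra.
Qed.

Lemma INR_S_ge_1 k : 1 <= INR (S k).
Proof. rewrite S_INR. assert (P := pos_INR k). lra. Qed.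

Lemma ln_nonneg u : 1 <= u -> 0 <= ln u.
Proof. intros. rewrite <- ln_1. apply ln_le; lra. Qed.

Lemma sqrt_ge_1 u : 1 <= u -> 1 <= sqrt u.
Proof. intros. rewrite <- sqrt_1. apply sqrt_le_1; lra. Qed.

Lemma euler_term_bound k : Rabs (euler_term k) <= pw32 k.
Proof.
  rewrite pw32_eq. assert (P := INR_S_ge_1 k). set (x := INR (S k)) in *.
  apply (left_rule_error ln Rinv (fun u => - / u ^ 2) x).
  - intros u Hu. apply is_derive_ln. lra.
  - intros u Hu. auto_derive. lra. field. lra.
  - intros u Hu. rewrite Rabs_Ropp, Rabs_pos_eq by (left; apply Rinv_0_lt_compat; nra).
    eapply Rle_trans. 2: apply sqrt_over_sq_decreasing with (u := u); lra.
    assert (S := sqrt_ge_1 u ltac:(lra)). assert (0 < / u ^ 2) by (apply Rinv_0_lt_compat; nra). nra.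
Qed.

Lemma stieltjes_term_bound k : Rabs (stieltjes_term k) <= 3 * pw32 k.
Proof.
  rewrite pw32_eq. assert (P := INR_S_ge_1 k). unfold stieltjes_term. set (x := INR (S k)) in *.
  apply (left_rule_error (fun u => ln u ^ 2 / 2) (fun u => ln u / u) (fun u => (1 - ln u) * / u ^ 2) x).
  - intros u Hu. auto_derive. lra. field. lra.
  - intros u Hu. auto_derive. split; [lra | split; [lra | auto]]. field. lra.
  - intros u Hu. assert (0 < / u ^ 2) by (apply Rinv_0_lt_compat; nra).
    rewrite Rabs_mult, (Rabs_pos_eq (/ u ^ 2)) by lra.
    apply Rle_trans with (3 * (sqrt u * / u ^ 2)).
    + rewrite <- Rmult_assoc. apply Rmult_le_compat_r. lra.
      assert (S := sqrt_ge_1 u ltac:(lra)). assert (L := ln_le_2sqrt u ltac:(lra)). assert (L0 := ln_nonneg u ltac:(lra)).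
      apply Rabs_le. lra.
    + apply Rmult_le_compat_l. lra. apply sqrt_over_sq_decreasing; lra.
Qed.

Lemma summable_pw32 f c : (forall k, Rabs (f k) <= c * pw32 k) -> ex_series f.
Proof.
  intros H. apply (ex_series_le (V := R_CompleteNormedModule) _ (fun k => c * pw32 k)). exact H.
  apply (ex_series_scal (K := R_AbsRing) (V := R_NormedModule) c). apply ex_series_pw32.
Qed.

Lemma euler_summable : ex_series euler_term.
Proof. apply summable_pw32 with 1. intros. rewrite Rmult_1_l. apply euler_term_bound. Qed.

Lemma stieltjes_summable : ex_series stieltjes_term.
Proof. apply summable_pw32 with 3. apply stieltjes_term_bound. Qed.

Definition zeta_termR (h : R) (k : nat) : R :=
  exp (- (1 + h) * ln (INR (S k))) - (exp (- h * ln (INR (S k) + 1)) - exp (- h * ln (INR (S k)))) / - h.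

Lemma exp_opp_bounds v : 0 <= v -> 0 <= exp (- v) - 1 + v <= v ^ 2 /\ 0 <= 1 - exp (- v) <= v.
Proof.
  intros Hv. assert (A := exp_ineq1_le (- v)). assert (B := exp_ineq1_le v).
  assert (E : exp (- v) * exp v = 1) by (rewrite <- exp_plus, Rplus_opp_l; apply exp_0).
  assert (P := exp_pos (- v)). assert (C : exp (- v) * (1 + v) <= 1) by (rewrite <- E; apply Rmult_le_compat_l; lra).
  assert (D : exp (- v) <= 1) by nra.
  assert (F : exp (- v) - 1 + v <= v ^ 2).
  { assert ((1 + v) * (exp (- v) - 1 + v) <= (1 + v) * v ^ 2); nra. }
  lra.
Qed.

Lemma ln_fourth_root u : 1 <= u -> ln u ^ 2 <= 16 * sqrt u.
Proof.
  intros Hu. assert (S := sqrt_ge_1 u Hu). assert (Q := ln_le_2sqrt (sqrt u) ltac:(lra)).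
  assert (E : ln u = 2 * ln (sqrt u)).
  { rewrite <- (sqrt_sqrt u) at 1 by lra. rewrite ln_mult by lra. ring. }
  assert (L0 := ln_nonneg (sqrt u) S). assert (T := sqrt_sqrt (sqrt u) ltac:(lra)).
  assert (T0 := sqrt_pos (sqrt u)). rewrite E. nra.
Qed.

(** The combination is the left-rule error of u^(-1-h) - 1/u + h ln u / u, whose derivative is of
    second order in h. With ln^2 u <= 16 sqrt u and ln u <= 2 sqrt u the constant is 18 = 16 + 2. *)
Lemma zeta_termR_expansion h k : 0 < h ->
  Rabs (zeta_termR h k - euler_term k + h * stieltjes_term k) <= 18 * h ^ 2 * pw32 k.
Proof.
  intros Hh. rewrite pw32_eq. assert (P := INR_S_ge_1 k). set (x := INR (S k)) in *.
  set (F := fun u => exp (- (1 + h) * ln u) - / u + h * (ln u / u)).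
  set (W := fun u => exp (- h * ln u) / - h - ln u + h * (ln u ^ 2 / 2)).
  set (F1 := fun u => ((1 - h * ln u - exp (- (h * ln u))) + h * (1 - exp (- (h * ln u)))) * / u ^ 2).
  replace (zeta_termR h k - euler_term k + h * stieltjes_term k) with (F x - (W (x + 1) - W x)).
  2: { unfold F, W, zeta_termR, euler_term, stieltjes_term. fold x. field. lra. }
  assert (X : forall u, 0 < u -> exp (- (1 + h) * ln u) = exp (- (h * ln u)) / u).
  { intros u Hu. replace (- (1 + h) * ln u) with (- (h * ln u) + - ln u) by ring. rewrite exp_plus, exp_Ropp, exp_Ropp, exp_ln by auto. field.
    repeat split; first [lra | apply Rgt_not_eq, exp_pos]. }
  apply left_rule_error with F1.
  - intros u Hu. unfold W, F. rewrite X by lra. replace (- h * ln u) with (- (h * ln u)) by ring.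
    auto_derive. lra. replace (- h * ln u) with (- (h * ln u)) by ring. field. lra.
  - intros u Hu. unfold F, F1. auto_derive. split; [lra | split; [lra | split; [lra | split; [lra | auto]]]].
    rewrite X by lra. field. lra.
  - intros u Hu. unfold F1. assert (iu : 0 < / u ^ 2) by (apply Rinv_0_lt_compat; nra).
    rewrite Rabs_mult, (Rabs_pos_eq (/ u ^ 2)) by lra.
    apply Rle_trans with (18 * h ^ 2 * (sqrt u * / u ^ 2)).
    + rewrite <- Rmult_assoc. apply Rmult_le_compat_r. lra.
      assert (S := sqrt_ge_1 u ltac:(lra)). assert (L := ln_le_2sqrt u ltac:(lra)). assert (L0 := ln_nonneg u ltac:(lra)).
      assert (L2 := ln_fourth_root u ltac:(lra)).
      assert (v0 : 0 <= h * ln u) by nra. destruct (exp_opp_bounds (h * ln u) v0) as [A B].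
      set (e := exp (- (h * ln u))) in *.
      assert (A' : e - 1 + h * ln u <= h ^ 2 * (16 * sqrt u)).
      { eapply Rle_trans. apply A. replace ((h * ln u) ^ 2) with (h ^ 2 * ln u ^ 2) by ring. apply Rmult_le_compat_l; nra. }
      assert (B' : h * (1 - e) <= h ^ 2 * (2 * sqrt u)).
      { apply Rle_trans with (h * (h * ln u)). apply Rmult_le_compat_l; lra. replace (h * (h * ln u)) with (h ^ 2 * ln u) by ring. apply Rmult_le_compat_l; nra. }
      assert (0 <= h * (1 - e)) by nra. assert (0 <= h ^ 2 * sqrt u) by nra. apply Rabs_le. split; lra.
    + apply Rmult_le_compat_l. nra. apply sqrt_over_sq_decreasing; lra.
Qed.

Lemma zeta_near_1 h : 0 < h -> zeta (RtoC (1 + h)) = RtoC (/ h + Series (zeta_termR h)).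
Proof.
  intros Hh. assert (h0 : RtoC h <> 0%C) by (intros E; apply RtoC_inj in E; lra).
  unfold zeta. rewrite (CSeries_RtoC _ (zeta_termR h)).
  - replace (RtoC (1 + h) - 1)%C with (RtoC h) by (rewrite RtoC_plus; ring).
    rewrite RtoC_plus, RtoC_inv by lra. field. auto.
  - intros k. unfold zeta_termR. assert (P := INR_S_ge_1 k). set (x := INR (S k)) in *. cbv zeta.
    unfold Rcpow.
    replace (1 - RtoC (1 + h))%C with (RtoC (- h)) by (rewrite RtoC_plus, RtoC_opp; ring).
    rewrite <- !RtoC_opp, <- !RtoC_mult, !Cexp_RtoC, <- RtoC_minus, <- RtoC_div, <- RtoC_minus by lra. reflexivity.
Qed.

Lemma affine_quadratic_zero (a b C d : R) : 0 < d -> (forall h, 0 < h < d -> Rabs (a + b * h) <= C * h ^ 2) -> a = 0 /\ b = 0.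
Proof.
  intros Hd H.
  set (K := Rabs C + Rabs b + Rabs a + 1).
  assert (pC := Rabs_pos C). assert (pb := Rabs_pos b). assert (pa := Rabs_pos a). assert (qC := Rle_abs C).
  assert (a = 0).
  { apply Rabs_eq_0. apply Rle_antisym; auto. apply Rnot_lt_le. intros Ha.
    set (h := Rmin (d / 2) (Rmin 1 (Rabs a / (2 * K)))).
    assert (h1 : h <= d / 2) by apply Rmin_l. assert (h2 : h <= 1) by (eapply Rle_trans; [apply Rmin_r | apply Rmin_l]).
    assert (h3 : h <= Rabs a / (2 * K)) by (eapply Rle_trans; [apply Rmin_r | apply Rmin_r]).
    assert (K0 : 0 < K) by (unfold K; lra).
    assert (h0 : 0 < h) by (repeat apply Rmin_pos; try lra; apply Rdiv_lt_0_compat; lra).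
    assert (B := H h ltac:(lra)).
    assert (T : Rabs a <= Rabs (a + b * h) + Rabs b * h).
    { replace a with ((a + b * h) + - (b * h)) at 1 by ring. eapply Rle_trans. apply Rabs_triang.
      rewrite Rabs_Ropp, Rabs_mult, (Rabs_pos_eq h) by lra. lra. }
    assert (K * h <= Rabs a / 2).
    { apply Rle_trans with (K * (Rabs a / (2 * K))). apply Rmult_le_compat_l; lra. right; field; lra. }
    assert (hh : 0 <= h ^ 2 <= h) by nra.
    assert (C * h ^ 2 <= Rabs C * h).
    { apply Rle_trans with (Rabs C * h ^ 2). apply Rmult_le_compat_r; lra. apply Rmult_le_compat_l; lra. }
    assert (0 <= Rabs a * h) by nra. unfold K in *. lra. }
  split; auto. subst a.
  apply Rabs_eq_0. apply Rle_antisym; auto. apply Rnot_lt_le. intros Hb.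
  set (h := Rmin (d / 2) (Rabs b / (2 * K))).
  assert (h1 : h <= d / 2) by apply Rmin_l. assert (h3 : h <= Rabs b / (2 * K)) by apply Rmin_r.
  assert (K0 : 0 < K) by (unfold K; lra).
  assert (h0 : 0 < h) by (repeat apply Rmin_pos; try lra; apply Rdiv_lt_0_compat; lra).
  assert (B := H h ltac:(lra)). rewrite Rplus_0_l, Rabs_mult, (Rabs_pos_eq h) in B by lra.
  assert (K * h <= Rabs b / 2).
  { apply Rle_trans with (K * (Rabs b / (2 * K))). apply Rmult_le_compat_l; lra. right; field; lra. }
  assert (B2 : Rabs b <= C * h).
  { apply (Rmult_le_reg_r h); auto. lra. }
  unfold K in *. nra.
Qed.

(** Along s = 1 + h with h -> 0+, zeta has the given expansion and the one obtained by summing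
    [zeta_termR_expansion]. They agree up to O(h^2), so their affine parts coincide, and the
    coefficient of h is gamma_1. *)
Lemma first_stieltjes_eq gamma1 : is_first_stieltjes gamma1 -> gamma1 = Series stieltjes_term.
Proof.
  intros (M & d & Hd & H).
  assert (E := euler_summable). assert (S := stieltjes_summable).
  destruct (affine_quadratic_zero (Series euler_term - euler_gamma) (gamma1 - Series stieltjes_term)
    (M + 18 * Series pw32) d Hd) as [_ Z]; [| lra].
  intros h Hh.
  assert (Hs : Cmod (RtoC (1 + h) - 1)%C = h).
  { rewrite <- RtoC_minus, Cmod_R, Rabs_pos_eq by lra. ring. }
  specialize (H (RtoC (1 + h))). rewrite Hs in H. specialize (H Hh).
  rewrite zeta_near_1 in H by lra.
  assert (h0 : RtoC h <> 0%C) by (intros X; apply RtoC_inj in X; lra).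
  replace (RtoC (1 + h) - 1)%C with (RtoC h) in H by (rewrite RtoC_plus; ring).
  replace (1 / RtoC h)%C with (RtoC (/ h)) in H by (rewrite RtoC_inv by lra; field; auto).
  rewrite <- RtoC_mult, <- RtoC_plus, <- !RtoC_minus, Cmod_R in H.
  set (e := fun k => zeta_termR h k - euler_term k + h * stieltjes_term k).
  assert (Be : forall k, Rabs (e k) <= 18 * h ^ 2 * pw32 k) by (intros; apply zeta_termR_expansion; lra).
  assert (Ee : ex_series e) by (apply summable_pw32 with (18 * h ^ 2); auto).
  assert (Z : Series (zeta_termR h) = Series e + Series euler_term - h * Series stieltjes_term).
  { rewrite <- Series_scal_l, <- Series_plus, <- Series_minus; auto.
    - apply Series_ext. intros; unfold e; ring.
    - apply (ex_series_plus (V := R_NormedModule)); auto.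
    - apply (ex_series_scal (K := R_AbsRing) (V := R_NormedModule) h); auto. }
  rewrite Z in H.
  assert (Bs : Rabs (Series e) <= 18 * h ^ 2 * Series pw32).
  { destruct (rsum0_Series_bound e (fun k => 18 * h ^ 2 * pw32 k) 0) as [B _]; auto.
    apply (ex_series_scal (K := R_AbsRing) (V := R_NormedModule) (18 * h ^ 2)), ex_series_pw32.
    cbn [rsum0] in B. rewrite Rminus_0_r in B. eapply Rle_trans. apply B.
    change (Series (fun k => 18 * h ^ 2 * pw32 k) <= 18 * h ^ 2 * Series pw32). rewrite Series_scal_l. lra. }
  replace (Series euler_term - euler_gamma + (gamma1 - Series stieltjes_term) * h) with
    ((/ h + (Series e + Series euler_term - h * Series stieltjes_term) - (/ h + euler_gamma - gamma1 * h)) + - Series e) by ring.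
  eapply Rle_trans. apply Rabs_triang. rewrite Rabs_Ropp. lra.
Qed.

(** * The function phi_1 and the final identity *)

Lemma hker_err_summable y : 0 < y -> ex_series (hker_err y).
Proof.
  intros Hy. destruct (hker_err_bound2 y Hy) as (C & C0 & HC).
  replace y with (INR 1 * y) by (cbn; ring).
  apply (ex_series_le (V := R_CompleteNormedModule) _ (fun k => C * pw54 0 * pw54 k)). apply (HC 0%nat).
  apply (ex_series_scal (K := R_AbsRing) (V := R_NormedModule) (C * pw54 0)). apply ex_series_pw54.
Qed.

(** The trapezoidal error of ln u / u on [y + k, y + k + 1] ([log_err_eq]), split by ln u = ln (u/y)
    + ln y. This splitting is the source of phi_1 = g + ln y phi_0. *)
Definition log_err (y : R) (k : nat) : R := hker_err y k + ln y * inv_err y k.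

Lemma log_err_eq y k : 0 < y -> log_err y k =
  (ln (y + INR k) / (y + INR k) + ln (y + INR k + 1) / (y + INR k + 1)) / 2
  - (ln (y + INR k + 1) ^ 2 / 2 - ln (y + INR k) ^ 2 / 2).
Proof.
  intros Hy. assert (Pk := pos_INR k). unfold log_err, hker_err, inv_err, hker.
  replace (1 + (INR k + 1) / y) with ((y + INR k + 1) / y) by (field; lra).
  replace (1 + INR k / y) with ((y + INR k) / y) by (field; lra).
  rewrite !ln_div by lra.
  replace (INR k + 1 + y) with (y + INR k + 1) by ring. replace (INR k + y) with (y + INR k) by ring.
  field. split; lra.
Qed.

(** These are the boundary terms between the partial sums for psi_1 and those of the error series.
    The difference of squares factors into a difference of logarithms, O(1/k), times a sum of
    logarithms, O(sqrt k). *)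
Lemma psi1_telescope_lim y : 0 < y ->
  is_lim_seq (fun k => ln (y + INR k) / (y + INR k) / 2 + (ln (y + INR k) ^ 2 / 2 - ln (INR k + 1) ^ 2 / 2)) 0.
Proof.
  intros Hy. apply is_lim_seq_incr_1. set (m := Rmin y 1). assert (m0 : 0 < m) by (apply Rmin_pos; lra).
  assert (m1 := Rmin_l y 1). assert (m2 := Rmin_r y 1). fold m in m1, m2.
  set (A := sqrt (y + 1) * / m).
  set (B := 2 * sqrt (y + 2) * Rabs (y - 1) * / m).
  apply is_lim_seq_abs_0.
  apply is_lim_seq_le_le with (fun _ => 0) (fun k => (A + B) * Rpower (INR (S k)) (- / 2)).
  - intros k. split. apply Rabs_pos. assert (P := INR_S_ge_1 k). set (n := INR (S k)) in *.
    assert (Sn := sqrt_ge_1 n P).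
    assert (E : Rpower n (- / 2) = sqrt n * / n).
    { rewrite Rpower_Ropp, Rpower_sqrt by lra. rewrite <- (sqrt_sqrt n) at 3 by lra. field. lra. }
    rewrite E. assert (inn : 0 < / n) by (apply Rinv_0_lt_compat; lra).
    assert (L1 : 0 <= ln (y + n)) by (apply ln_nonneg; lra). assert (L2 : 0 <= ln (n + 1)) by (apply ln_nonneg; lra).
    assert (U : forall z, 0 < z -> n + z <= (z + 1) * n) by (intros; nra).
    assert (Q1 : ln (y + n) <= 2 * (sqrt (y + 1) * sqrt n)).
    { rewrite <- sqrt_mult by lra. eapply Rle_trans. apply ln_le_2sqrt. lra.
      apply Rmult_le_compat_l. lra. apply sqrt_le_1; try lra. nra. specialize (U y Hy). lra. }
    assert (Q2 : ln (n + 1) <= 2 * (sqrt (y + 2) * sqrt n)).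
    { rewrite <- sqrt_mult by lra. eapply Rle_trans. apply ln_le_2sqrt. lra.
      apply Rmult_le_compat_l. lra. apply sqrt_le_1; try lra. nra. nra. }
    assert (Q3 : sqrt (y + 1) <= sqrt (y + 2)) by (apply sqrt_le_1; lra).
    assert (Q0 := sqrt_pos (y + 1)).
    assert (low : m * n <= y + n) by nra. assert (low2 : m * n <= n + 1) by nra.
    assert (mn : 0 < m * n) by nra.
    assert (I1 : / (y + n) <= / m * / n) by (rewrite <- Rinv_mult; apply Rinv_le_contravar; lra).
    assert (I0 : 0 < / (y + n)) by (apply Rinv_0_lt_compat; lra).
    assert (im : 0 < / m) by (apply Rinv_0_lt_compat; auto).
    assert (D : Rabs (ln (y + n) - ln (n + 1)) <= Rabs (y - 1) * (/ m * / n)).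
    { assert (X : forall a b, 0 < a -> a <= b -> m * n <= a -> Rabs (ln b - ln a) <= (b - a) * (/ m * / n)).
      { intros a b Ha ab Hma. rewrite <- ln_div by lra. assert (1 <= b / a) by (apply (Rmult_le_reg_r a); auto; unfold Rdiv; rewrite Rmult_assoc, Rinv_l; lra).
        rewrite Rabs_pos_eq by (apply ln_nonneg; auto). eapply Rle_trans. apply ln_le_sub_1. lra.
        replace (b / a - 1) with ((b - a) * / a) by (field; lra). apply Rmult_le_compat_l. lra. rewrite <- Rinv_mult. apply Rinv_le_contravar; lra. }
      destruct (Rle_dec 1 y).
      - rewrite (Rabs_pos_eq (y - 1)) by lra. replace (y - 1) with (y + n - (n + 1)) by ring. apply X; lra.
      - rewrite Rabs_minus_sym, (Rabs_minus_sym y), (Rabs_pos_eq (1 - y)) by lra. replace (1 - y) with (n + 1 - (y + n)) by ring. apply X; lra. }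
    assert (T1 : Rabs (ln (y + n) / (y + n) / 2) <= A * (sqrt n * / n)).
    { unfold Rdiv. rewrite Rabs_pos_eq by (apply Rmult_le_pos; [apply Rmult_le_pos |]; lra).
      apply Rle_trans with (2 * (sqrt (y + 1) * sqrt n) * (/ m * / n) * / 2).
      apply Rmult_le_compat_r. lra. apply Rmult_le_compat; lra.
      unfold A. right; field; lra. }
    assert (T2 : Rabs (ln (y + n) ^ 2 / 2 - ln (n + 1) ^ 2 / 2) <= B * (sqrt n * / n)).
    { replace (ln (y + n) ^ 2 / 2 - ln (n + 1) ^ 2 / 2) with ((ln (y + n) - ln (n + 1)) * ((ln (y + n) + ln (n + 1)) / 2)) by field.
      rewrite Rabs_mult, (Rabs_pos_eq ((ln (y + n) + ln (n + 1)) / 2)) by lra.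
      apply Rle_trans with (Rabs (y - 1) * (/ m * / n) * (2 * (sqrt (y + 2) * sqrt n))).
      apply Rmult_le_compat; try lra. apply Rabs_pos. 
      assert (sqrt (y + 1) * sqrt n <= sqrt (y + 2) * sqrt n) by (apply Rmult_le_compat_r; lra). lra.
      unfold B. right; field; lra. }
    eapply Rle_trans. apply Rabs_triang. lra.
  - apply is_lim_seq_const.
  - replace (Finite 0) with (Rbar_mult (A + B) 0) by (cbn; f_equal; ring). apply is_lim_seq_scal_l.
    apply is_lim_seq_Rpower. lra.
Qed.

(** The partial sums of the series in psi_1 are those of [log_err] minus those of [stieltjes_term]
    plus a telescoping term t. The initial value t(0) = ln y/(2y) + ln^2 y/2 is what the elementary
    terms of phi_1 and psi_1 cancel, and the second sum cancels gamma_1. *)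
Lemma phi1_RtoC gamma1 y : gamma1 = Series stieltjes_term -> 0 < y ->
  phi1 gamma1 (RtoC y) = RtoC (gfun y + ln y * phi0R y).
Proof.
  intros Hg Hy. set (a := fun k => ln (y + INR (S k)) / (y + INR (S k)) - ln (INR (S k)) / INR (S k)).
  set (t := fun k => ln (y + INR k) / (y + INR k) / 2 + (ln (y + INR k) ^ 2 / 2 - ln (INR k + 1) ^ 2 / 2)).
  assert (Eh := hker_err_summable y Hy). assert (Ei := inv_err_summable y Hy).
  assert (Ei' : ex_series (fun k => ln y * inv_err y k)) by (apply (ex_series_scal (K := R_AbsRing) (V := R_NormedModule) (ln y)); auto).
  assert (El : Series (log_err y) = - (gfun y + ln y * phi0R y)).
  { unfold log_err. rewrite Series_plus, Series_scal_l; auto. unfold gfun, phi0R. ring. }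
  assert (El' : ex_series (log_err y)) by (apply (ex_series_plus (V := R_NormedModule)); auto).
  assert (A : is_series a (Series (log_err y) - gamma1 - (ln y / y / 2 + ln y ^ 2 / 2))).
  { change (is_lim_seq (sum_n a) (Series (log_err y) - gamma1 - (ln y / y / 2 + ln y ^ 2 / 2))). apply rsum0_lim.
    apply is_lim_seq_ext with (fun n => rsum0 (log_err y) n - rsum0 stieltjes_term n + (t n - t 0%nat)).
    - intros n. rewrite <- rsum0_minus, <- rsum0_telescope.
      induction n; cbn [rsum0]. ring.
      rewrite <- IHn. rewrite log_err_eq by auto. unfold a, t, stieltjes_term. rewrite !S_INR. 
      replace (y + (INR n + 1)) with (y + INR n + 1) by ring. field. assert (P := pos_INR n). split; lra.
    - replace (Series (log_err y) - gamma1 - (ln y / y / 2 + ln y ^ 2 / 2)) with (Series (log_err y) - gamma1 + (0 - t 0%nat)).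
      2: { unfold t. cbn [INR]. rewrite Rplus_0_r, Rplus_0_l, ln_1. field. lra. }
      apply is_lim_seq_plus'; apply is_lim_seq_minus'.
      + apply rsum0_lim. apply (Series_correct _ El').
      + apply rsum0_lim. rewrite Hg. apply (Series_correct _ stieltjes_summable).
      + apply psi1_telescope_lim; auto.
      + apply is_lim_seq_const. }
  unfold phi1, psi1. rewrite (CSeries_RtoC _ a).
  2: { intros k. cbv zeta. assert (P := INR_S_ge_1 k). rewrite <- RtoC_plus, !Clog_RtoC by lra. unfold a.
       rewrite (Rplus_comm y), RtoC_minus, !RtoC_div by lra. reflexivity. }
  rewrite (is_series_unique _ _ A), El, Clog_RtoC by auto.
  assert (y0 : RtoC y <> 0%C) by (intros E; apply RtoC_inj in E; lra).
  replace (ln y ^ 2) with (ln y * ln y) by ring.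
  rewrite !RtoC_minus, RtoC_opp, !RtoC_plus, !RtoC_div, !RtoC_mult by lra. field. auto.
Qed.

(** Needed to split the series of phi_1 into those of g and ln y phi_0. The logarithm is at most a
    multiple of sqrt (y + k), so the bound (y + k)^(-3) of [inv_err] drops to the exponent -5/2 of
    [pow52_split]. *)
Lemma ln_phi0_summable x : 0 < x -> ex_series (fun n => ln (INR (S n) * x) * phi0R (INR (S n) * x)).
Proof.
  intros Hx. destruct (pow52_split x Hx) as (C & C0 & HC).
  set (K := 2 + Rabs (ln x) * / sqrt x). assert (Sx := sqrt_lt_R0 x Hx).
  assert (iS : 0 < / sqrt x) by (apply Rinv_0_lt_compat; auto).
  assert (K0 : 0 < K) by (unfold K; assert (P := Rabs_pos (ln x)); nra).
  apply (ex_series_le (V := R_CompleteNormedModule) _ (fun n => 2 * K * C * Series pw54 * pw54 n)).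
  2: { apply (ex_series_scal (K := R_AbsRing) (V := R_NormedModule) (2 * K * C * Series pw54)). apply ex_series_pw54. }
  intros n. set (y := INR (S n) * x). assert (P := INR_S_ge_1 n). assert (xy : x <= y) by (unfold y; nra).
  change (Rabs (ln y * phi0R y) <= 2 * K * C * Series pw54 * pw54 n).
  assert (Sy : sqrt x <= sqrt y) by (apply sqrt_le_1; lra).
  assert (L : Rabs (ln y) <= K * sqrt y).
  { assert (A1 := ln_le_2sqrt y ltac:(lra)). assert (A2 : ln x <= ln y) by (apply ln_le; lra).
    assert (A3 := Rle_abs (- ln x)). rewrite Rabs_Ropp in A3.
    assert (A4 : Rabs (ln x) <= Rabs (ln x) * / sqrt x * sqrt y).
    { rewrite Rmult_assoc. rewrite <- (Rmult_1_r (Rabs (ln x))) at 1. apply Rmult_le_compat_l. apply Rabs_pos.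
      rewrite <- (Rinv_l (sqrt x)) by lra. apply Rmult_le_compat_l; lra. }
    assert (A5 := Rabs_pos (ln x)). unfold K. apply Rabs_le. nra. }
  assert (B : forall k, Rabs (ln y * inv_err y k) <= 2 * K * C * pw54 n * pw54 k).
  { intros k. assert (Pk := pos_INR k). set (v := y + INR k). assert (v0 : 0 < v) by (unfold v; lra).
    assert (Sv : sqrt y <= sqrt v) by (apply sqrt_le_1; unfold v; lra).
    rewrite Rabs_mult. assert (I := inv_err_bound y k ltac:(lra)). fold v in I.
    assert (v3 : 0 < / v ^ 3) by (apply Rinv_0_lt_compat, pow_lt; auto).
    apply Rle_trans with (K * sqrt v * (2 * / v ^ 3)).
    { apply Rmult_le_compat; try apply Rabs_pos; auto. eapply Rle_trans. apply L. apply Rmult_le_compat_l; lra. }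
    assert (X := HC n k v (Rle_refl _)). rewrite Rpower_52 in X by auto. unfold Rdiv in X.
    replace (K * sqrt v * (2 * / v ^ 3)) with (2 * K * (sqrt v * / v ^ 3)) by ring.
    replace (2 * K * C * pw54 n * pw54 k) with (2 * K * (C * (pw54 n * pw54 k))) by ring.
    apply Rmult_le_compat_l; lra. }
  unfold phi0R. rewrite Ropp_mult_distr_r_reverse, Rabs_Ropp, <- Series_scal_l.
  assert (Eb : ex_series (fun k => 2 * K * C * pw54 n * pw54 k)) by (apply (ex_series_scal (K := R_AbsRing) (V := R_NormedModule) (2 * K * C * pw54 n)); apply ex_series_pw54).
  destruct (rsum0_Series_bound _ _ 0 Eb B) as [D _]. cbn [rsum0] in D. rewrite Rminus_0_r in D.
  eapply Rle_trans. apply D. change (Series (fun k => 2 * K * C * pw54 n * pw54 k) <= 2 * K * C * Series pw54 * pw54 n).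
  rewrite Series_scal_l. right; ring.
Qed.

Lemma scrF_eq gamma1 c x : gamma1 = Series stieltjes_term -> 0 < x ->
  scrF gamma1 c x = (RtoC (Gsum x) + 1 / 2 * scrH c x - RtoC (PI ^ 2 / (12 * x)))%C.
Proof.
  intros Hg Hx. unfold scrF. f_equal. f_equal.
  destruct (gfun_summable x Hx) as [Eg _]. assert (Ep := ln_phi0_summable x Hx).
  assert (Pos : forall n, 0 < INR (S n) * x) by (intros; apply Rmult_lt_0_compat; auto; apply lt_0_INR; lia).
  rewrite (CSeries_RtoC _ (fun n => gfun (INR (S n) * x) + ln (INR (S n) * x) * phi0R (INR (S n) * x))) by (intros; apply phi1_RtoC; auto).
  rewrite (CSeries_RtoC _ (fun n => ln (INR (S n) * x) * phi0R (INR (S n) * x))) by (intros; rewrite phi0_RtoC, RtoC_mult; auto).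
  rewrite Series_plus, RtoC_plus by auto. unfold Gsum. ring.
Qed.

(** Half of x H(x) - H(1/x) contributes minus the corresponding combination of [Gsum] plus pi^2/12
    (1 - x). That last term is exactly compensated by the summand -pi^2/(12 x) of F. *)
Lemma scrF_inversion gamma1 c x : is_first_stieltjes gamma1 -> 0 < c < 1 -> 0 < x ->
  scrF gamma1 c (/ x) = (RtoC x * scrF gamma1 c x)%C.
Proof.
  intros Hg Hc Hx. apply first_stieltjes_eq in Hg. assert (ix : 0 < / x) by (apply Rinv_0_lt_compat; auto).
  rewrite !scrF_eq by auto.
  destruct (scrH_antisymmetric_part c x Hc Hx) as (h & Eh & Lh).
  assert (V : h = - (2 * (x * Gsum x - Gsum (/ x) - PI ^ 2 / 12 * (1 - x)))).
  { assert (L := is_lim_seq_scal_l _ (- 2) _ (Theta_lim x Hx)).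
    apply is_lim_seq_unique in L. apply is_lim_seq_unique in Lh. rewrite L in Lh. injection Lh. lra. }
  assert (E : scrH c (/ x) = (RtoC x * scrH c x - RtoC h)%C) by (rewrite <- Eh; ring).
  rewrite E, V.
  replace (PI ^ 2 / (12 * / x)) with (PI ^ 2 / 12 * x) by (field; lra).
  replace (PI ^ 2 / (12 * x)) with (PI ^ 2 / 12 * / x) by (field; lra).
  assert (x0 : RtoC x <> 0%C) by (intros E0; apply RtoC_inj in E0; lra).
  rewrite RtoC_opp, !RtoC_mult, !RtoC_minus, !RtoC_mult, !RtoC_minus, RtoC_inv by lra. field. auto.
Qed.

Theorem theorem3p2 (gamma1 : R) (hgamma1 : is_first_stieltjes gamma1)
  (c : R) (hc : (0 < c < 1)%R)
  (alpha beta : R) (halpha : (0 < alpha)%R) (hbeta : (0 < beta)%R)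
  (hab : (alpha * beta = 1)%R) :
  (RtoC (sqrt alpha) * scrF gamma1 c alpha
   = RtoC (sqrt beta) * scrF gamma1 c beta)%C.
Proof.
  assert (Eb : beta = / alpha) by (apply (Rmult_eq_reg_l alpha); [rewrite hab, Rinv_r |]; lra).
  subst beta. rewrite scrF_inversion, Cmult_assoc, <- RtoC_mult by auto. f_equal. f_equal.
  rewrite sqrt_inv. assert (S := sqrt_lt_R0 alpha halpha). assert (Q := sqrt_sqrt alpha ltac:(lra)).
  rewrite <- Q at 3. field. lra.
Qed.
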